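(* Let $p\ge1$ and let $(X,d,\mathfrak m)$ be a doubling metric measure space. The following properties are quantitatively equivalent: (i) $X$ satisfies a $p$-Poincaré inequality for all couples $(u,\mathrm{lip}\,u)$, with $u\in\mathrm{Lip}(X)$; (ii) there exist $C>0$ and $L\ge1$ such that for every Borel $u:X\to\mathbb R$, for every $x,y\in\mathrm{Leb}(u)$, for every $\varepsilon>0$ and for every $g\in\mathrm{UG}^\varepsilon(u)$ it holds $$|u(x)-u(y)|^p\le C\,d(x,y)^{p-1}\int g^p\,d\mathfrak m^L_{x,y};$$ (iii) there exist $C>0$ and $L\ge1$ such that for every $u\in\mathrm{Lip}(X)$ and for every $x,y\in X$ it holds $$|u(x)-u(y)|^p\le C\,d(x,y)^{p-1}\int(\mathrm{lip}\,u)^p\,d\mathfrak m^L_{x,y}.$$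
   Context: A metric measure space $(X,d,\mathfrak m)$ is a separable metric space $(X,d)$ (not necessarily complete) with a non-trivial outer measure $\mathfrak m$ which is Radon and finite on bounded sets. It is doubling if there is $C_D\ge1$ with $\mathfrak m(B_{2r}(x))\le C_D\,\mathfrak m(B_r(x))$ for all $x\in X$, $r>0$. ''Quantitatively equivalent'' means that the constants in each property can be chosen depending only on the constants of any other one, on $p$ and on $C_D$. A $p$-Poincaré inequality for a class of couples $(u,g)$ means that there are $C,\lambda\ge1$ (the same for all couples in the class) such that $$\frac1{\mathfrak m(B_r(x))}\int_{B_r(x)}\Big|u-\frac1{\mathfrak m(B_r(x))}\int_{B_r(x)}u\,d\mathfrak m\Big|\,d\mathfrak m\le C\,r\Big(\frac1{\mathfrak m(B_{\lambda r}(x))}\int_{B_{\lambda r}(x)}g^p\,d\mathfrak m\Big)^{1/p}$$ for every ball $B_r(x)\subseteq X$ and every couple in the class. $\mathrm{Lip}(X)$ is the set of Lipschitz functions $X\to\mathbb R$ and $\mathrm{lip}\,u(x):=\lim_{\varepsilon\to0}\sup_{y\in B_\varepsilon(x),\,y\ne x}\frac{|u(y)-u(x)|}{d(x,y)}$ (equal to $0$ at isolated points). For Borel $u$, $\mathrm{Leb}(u)$ is the set of Lebesgue points, i.e. points $x$ with $u(x)=\lim_{r\to0}\frac1{\mathfrak m(B_r(x))}\int_{B_r(x)}u\,d\mathfrak m$. For $\varepsilon>0$, an $\varepsilon$-chain is a finite sequence of points $c=\{q_i\}_{i=0}^N$ of $X$ with $d(q_i,q_{i+1})\le\varepsilon$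 for all $i$; $\alpha(c)=q_0$, $\omega(c)=q_N$. For $g:X\to[0,+\infty]$, $\int_c g:=\sum_{i=0}^{N-1}\frac{g(q_i)+g(q_{i+1})}{2}d(q_i,q_{i+1})$ (with $0\cdot\infty=0$). A Borel function $g:X\to[0,+\infty]$ belongs to $\mathrm{UG}^\varepsilon(u)$ if $|u(\omega(c))-u(\alpha(c))|\le\int_c g$ for every $\varepsilon$-chain $c$. For $x,y\in X$, $L\ge1$, let $B^L_{x,y}=B_{Ld(x,y)}(x)\cup B_{Ld(x,y)}(y)$ and $$R^L_{x,y}(z):=\Big(\frac{d(x,z)}{\mathfrak m(B_{d(x,z)}(x))}+\frac{d(y,z)}{\mathfrak m(B_{d(y,z)}(y))}\Big)\chi_{B^L_{x,y}}(z),\qquad R^L_{x,y}(x)=R^L_{x,y}(y)=0,$$ and $\mathfrak m^L_{x,y}:=R^L_{x,y}\,\mathfrak m$. *)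

(* Defs.v *)
From HB Require Import structures.
From mathcomp Require Import all_boot all_order all_algebra.
From mathcomp Require Import all_classical all_reals all_analysis.
From mathcomp Require Import measurable_realfun.

Set Implicit Arguments.
Unset Strict Implicit.
Unset Printing Implicit Defensive.

Import Order.TTheory GRing.Theory Num.Theory.
Import numFieldNormedType.Exports.

Local Open Scope classical_set_scope.
Local Open Scope ring_scope.

(* The measurable types of the library are pointed, so metric spaces are taken
   with a distinguished point; it plays no role, and a space carrying a
   non-trivial measure is inhabited anyway. *)
#[short(type="pmetricType")]
HB.structure Definition PointedMetric (R : numDomainType) :=
  {X of Metric R X & Pointed X}.

Definition borel (X : ptopologicalType) := g_sigma_algebraType (@open X).

Section MetricMeasureSpaces.
Context {R : realType} {X : pmetricType R}.
Implicit Types (m : set X -> \bar R) (A D : set X) (u : X -> R)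
  (g : X -> \bar R) (x y z : X) (p r C L lam eps : R).
Local Open Scope ereal_scope.

Definition separable_space := exists2 S : set X, countable S & dense S.

(* A Radon outer measure on a possibly non complete metric space: Borel sets are
   Caratheodory measurable, compact sets have finite measure, open sets are
   inner regular and all sets are outer regular. *)
Record radon m : Prop := Radon {
  radon_borel : forall A, <<s (@open X) >> A -> m.-caratheodory A ;
  radon_compact : forall K : set X, compact K -> m K < +oo ;
  radon_inner : forall U : set X, open U ->
    m U = ereal_sup [set m K | K in [set K | compact K /\ K `<=` U]] ;
  radon_outer : forall A,
    m A = ereal_inf [set m U | U in [set U | open U /\ A `<=` U]] }.

Record metric_measure_space (m : {outer_measure set X -> \bar R}) : Prop :=
  MetricMeasureSpace {
  mms_separable : separable_space ;
  mms_nontrivial : m [set: X] != 0 ;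
  mms_radon : radon m ;
  mms_bounded : forall A x r, A `<=` ball x r -> m A < +oo }.

Definition doubling m (CD : R) := forall x r, (0 < r)%R ->
  m (ball x (2 * r)) <= CD%:E * m (ball x r).

(* The integral of the library only uses the values of [m] on Borel sets, where
   a Radon outer measure is a measure. *)
Definition integ m D g : \bar R :=
  \int[m : set (borel X) -> \bar R]_(z in (D : set (borel X))) g z.

Definition avg m D g : \bar R := (m D)^-1 * integ m D g.

Definition poincare m p (F : set ((X -> R) * (X -> \bar R))) C lam :=
  forall u g, F (u, g) -> forall x r, (0 < r)%R ->
  avg m (ball x r) (fun z => `|(u z)%:E - avg m (ball x r) (EFin \o u)|)
  <= (C * r)%:E * avg m (ball x (lam * r)) (fun z => g z `^ p) `^ p^-1.

Definition Lip : set (X -> R) :=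
  [set u | exists K : R, forall x y, (`|u x - u y| <= K * mdist x y)%R].

Definition lip u x : \bar R :=
  if `[< isolated [set: X] x >] then 0 else
  lim (ereal_sup [set (`|u y - u x| / mdist x y)%R%:E
                 | y in [set y | ball x e y /\ y != x]] @[e --> 0^'+]).

(* An integral that does not exist takes an infinite value in the library, so
   convergence to the real number [u x] forces [u] to be integrable on all small
   balls around [x]. *)
Definition Leb m u : set X :=
  [set x | avg m (ball x r) (EFin \o u) @[r --> 0^'+] --> (u x)%:E].

(* A chain is given by [q 0, ..., q N]; the later values of [q] are ignored. *)
Definition is_chain eps (q : nat -> X) (N : nat) :=
  forall i, (i < N)%N -> (mdist (q i) (q i.+1) <= eps)%R.

Definition chain_int g (q : nat -> X) (N : nat) : \bar R :=
  \sum_(0 <= i < N) (g (q i) + g (q i.+1)) / 2%:E * (mdist (q i) (q i.+1))%:E.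

Definition UG eps u : set (X -> \bar R) :=
  [set g | [/\ measurable_fun [set: borel X] (g : borel X -> \bar R),
    (forall x, 0 <= g x) &
    forall q N, is_chain eps q N ->
      `|u (q N) - u (q 0%N)|%:E <= chain_int g q N]].

Definition twoballs L x y : set X :=
  ball x (L * mdist x y) `|` ball y (L * mdist x y).

Definition riesz m L x y z : \bar R :=
  if (z == x) || (z == y) then 0 else
  ((mdist x z)%:E / m (ball x (mdist x z)) +
   (mdist y z)%:E / m (ball y (mdist y z))) * (\1_(twoballs L x y) z)%:E.

Definition riesz_measure m L x y : set X -> \bar R :=
  fun A => integ m A (riesz m L x y).

Definition poincare_lip p m C lam :=
  [/\ (1 <= C)%R, (1 <= lam)%R &
  poincare m p [set ug | Lip ug.1 /\ ug.2 = lip ug.1] C lam].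

Definition pointwise_chain p m C L :=
  [/\ (0 < C)%R, (1 <= L)%R &
  forall u, measurable_fun [set: borel X] (u : borel X -> R) ->
  forall x y, Leb m u x -> Leb m u y ->
  forall eps, (0 < eps)%R -> forall g, UG eps u g ->
  (`|u x - u y| `^ p)%:E <= (C * mdist x y `^ (p - 1))%:E *
    integ (riesz_measure m L x y) [set: X] (fun z => g z `^ p)].

Definition pointwise_lip p m C L :=
  [/\ (0 < C)%R, (1 <= L)%R &
  forall u, Lip u -> forall x y,
  (`|u x - u y| `^ p)%:E <= (C * mdist x y `^ (p - 1))%:E *
    integ (riesz_measure m L x y) [set: X] (fun z => lip u z `^ p)].

End MetricMeasureSpaces.

Section QuantitativeEquivalence.
Context {R : realType}.

(* A property of a space depending on two real constants; the admissible range
   of the constants is part of the property. *)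
Definition mms_property :=
  forall X : pmetricType R, {outer_measure set X -> \bar R} -> R -> R -> Prop.

(* The constants of [Q] are chosen before the space, so they depend only on the
   doubling constant, on the constants of [P], and on the parameters of [P] and
   [Q] (here, the exponent). *)
Definition quant_implies (CD : R) (P Q : mms_property) :=
  forall a b : R, exists a' b' : R,
  forall (X : pmetricType R) (m : {outer_measure set X -> \bar R}),
  metric_measure_space m -> doubling m CD -> P X m a b -> Q X m a' b'.

Definition quant_equivalent (CD : R) (P Q : mms_property) :=
  quant_implies CD P Q /\ quant_implies CD Q P.

End QuantitativeEquivalence.

(* Main.v *)
Require Import Defs.
From HB Require Import structures.
From mathcomp Require Import all_boot all_order all_algebra.
From mathcomp Require Import all_classical all_reals all_analysis.
From mathcomp Require Import measurable_realfun.
From mathcomp Require Import ring lra zify.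

Set Implicit Arguments.
Unset Strict Implicit.
Unset Printing Implicit Defensive.

Import Order.TTheory GRing.Theory Num.Theory.
Import numFieldNormedType.Exports.

Local Open Scope classical_set_scope.
Local Open Scope ring_scope.

(** The three properties are proved in a cycle: the Poincare inequality implies the
  pointwise estimate for chain gradients, which implies the pointwise estimate for
  Lipschitz functions, which implies the Poincare inequality. Everything happens for
  the Borel measure induced by the outer measure ([borel_measure]).

  Exponents. The numbers [k] with [t <= tau + k * t `^ p] for all [t >= 0], the
  predicate [young], turn an inequality between [p]-th powers into the family of
  linear inequalities [a <= D * tau + k * A], and optimizing in [tau] gives the power
  back ([powR_linear], [powR_optimize]). All intermediate estimates are linear in
  [h = g `^ p], so Hoelder's inequality never enters and infinite integrals are
  harmless. All kernels are expressed by [kern mu x z], the quotient of [mdist x z] by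
  the measure of the ball of that radius.

  From chains to Lipschitz constants ([chain_to_lip]). The supremum of the difference
  quotients of [u] at distance less than [2 * e] is an admissible chain gradient for
  [e]-chains. It decreases to [lip u] as [e] tends to [0], and the Riesz measure is
  finite, so dominated convergence applies.

  From the pointwise estimate to the Poincare inequality ([lip_to_poincare]). For a
  good choice of [w] in a ball, [|u z - u w|] is bounded by the potentials of
  [lip u `^ p] at [z] and [w]; integrated over the ball, a potential is controlled by
  the integral of the function, since the potential is a sum of averages over dyadic
  balls ([potential_majorant]).

  From the Poincare inequality to chains. First, the inequality extends to bounded
  Borel [u] with a chain gradient [g] ([chain_poincare]): on balls smaller than the
  length of the chains it follows from the two-point inequality, and on larger ones
  from the inequality for a Lipschitz mollification of [u], whose slope is controlled
  by averages of [g]. Second, two points are joined by chains of arbitrarily small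
  step in a ball of comparable radius ([well_chained]); otherwise the indicator of the
  points reached by chains would violate the inequality. A shortest chain from [y]
  towards [x], stopped when the distance to [x] has dropped by the factor
  [step_ratio], has a bounded number of elements ([chain_size]) and stays away from
  [x]. Small balls along the chain have comparable mean values of [u], with an error
  given by the integral of [h] on an annulus around [x] ([step]). Iterating, the
  annuli are essentially disjoint, so the mean value of [u] on a ball near [y] is
  compared with one on a ball at any prescribed small distance from [x], at the cost
  of the potential of [h] at [x] ([approach]).

  The last step cannot use balls centred at [x], because [h] need not be integrable
  near [x] even if its potential is finite. But at distances smaller than the length
  of the chains, [u z] is compared directly with the mean value on a ball at distance
  [mdist x z] from [x], by the two-point inequality ([dist_endpoint]). The resulting
  bound contains the term [mdist x z * h z], whose integral on [ball x s] is at most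
  the measure of that ball times the potential. Hence the averages of [u] on small
  balls around [x] and [y] differ by the expected amount ([bounded_estimate]).
  Truncation removes the boundedness of [u], and the radius tends to [0] at Lebesgue
  points ([chain_linear]). *)

(** * Powers, linearized *)

Section Linearization.
Context {R : realType}.
Implicit Types (p a b D t tau k : R) (A : \bar R).

Definition young p tau k :=
  [/\ 0 < tau, 0 < k & forall t, 0 <= t -> t <= tau + k * t `^ p].

Let powRDp (x r s : R) : 0 < x -> x `^ (r + s) = x `^ r * x `^ s.
Proof. by move=> x0; apply: powRD; rewrite (gt_eqF x0) implybT. Qed.

Let powR_pred (x p : R) : 0 < x -> x `^ p = x * x `^ (p - 1).
Proof.
by move=> x0; rewrite -[X in _ = X * _](powRr1 (ltW x0)) -powRDp// subrKC.
Qed.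

Lemma young_powR p tau : 1 <= p -> 0 < tau -> young p tau (tau `^ (1 - p)).
Proof.
move=> p1 tau0; split => //; first exact: powR_gt0.
move=> t t0; have [le|lt] := leP t tau.
  by rewrite (le_trans le)// lerDl mulr_ge0 ?powR_ge0.
rewrite ler_wpDl ?(ltW tau0)//.
have t_gt0 : 0 < t by rewrite (lt_trans tau0).
rewrite (powR_pred _ t_gt0) mulrCA ler_peMr// -opprB powRN mulrC ler_pdivlMr ?powR_gt0// mul1r.
by rewrite ge0_ler_powR ?subr_ge0 ?nnegrE ?(ltW tau0) ?(ltW lt).
Qed.

Lemma young_poweR p tau k A : 1 <= p -> young p tau k -> (0 <= A)%E ->
  (A <= tau%:E + k%:E * A `^ p)%E.
Proof.
move=> p1 [tau0 k0 H]; case: A => [t| |]// t0.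
  by rewrite poweR_EFin -EFinM -EFinD lee_fin H.
by rewrite poweRyr ?gt_eqF ?(lt_le_trans _ p1)// gt0_muley ?lte_fin.
Qed.

Lemma young_root p tau k A : 1 <= p -> young p tau k -> (0 <= A)%E ->
  (A `^ p^-1 <= tau%:E + k%:E * A)%E.
Proof.
move=> p1 yg A0; have p0 : p != 0 by rewrite gt_eqF// (lt_le_trans _ p1).
have := young_poweR p1 yg (poweR_ge0 A p^-1).
by rewrite -poweRrM mulVf// poweRe1.
Qed.

(** For finite positive [A] the choice of [tau] that balances both terms is
  [tau = (A / D) `^ p^-1]; the exponent then reappears. *)
Lemma powR_optimize p a D A : 1 <= p -> 0 <= a -> 0 < D -> (0 <= A)%E ->
  (forall tau k, young p tau k -> a%:E <= (D * tau)%:E + k%:E * A)%E ->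
  ((a `^ p)%:E <= (2 `^ p * D `^ (p - 1))%:E * A)%E.
Proof.
move=> p1 a0 D0; have p0 : 0 < p by rewrite (lt_le_trans _ p1).
case: A => [A| |]// A0 H; last first.
  by rewrite gt0_muley ?leey// lte_fin mulr_gt0 ?powR_gt0.
have {}H tau k : young p tau k -> a <= D * tau + k * A.
  by move=> /H; rewrite -EFinM -EFinD lee_fin.
rewrite -EFinM lee_fin; move: A0; rewrite lee_fin le_eqVlt => /predU1P[A0|A0].
  suff -> : a = 0 by rewrite powR0 ?gt_eqF// -A0 mulr0.
  apply/eqP; rewrite eq_le a0 andbT; apply/ler_addgt0Pl => e e0.
  have eD : 0 < e / D by rewrite divr_gt0.
  have := H _ _ (young_powR p1 eD).
  by rewrite -A0 mulr0 !addr0 mulrC divfK ?gt_eqF.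
have AD0 : 0 < A / D by rewrite divr_gt0.
pose tau := (A / D) `^ p^-1.
have tau0 : 0 < tau by rewrite powR_gt0.
have taup : tau `^ p = A / D.
  by rewrite /tau -powRrM mulVf ?gt_eqF// powRr1// ltW.
have kA : tau `^ (1 - p) * A = D * tau.
  rewrite powRDp// powRr1 ?ltW// powRN taup.
  by field; rewrite !gt_eqF.
have := H _ _ (young_powR p1 tau0); rewrite kA => aD.
have {}aD : a <= 2 * (D * tau) by rewrite mulr_natl mulr2n.
apply: (@le_trans _ _ ((2 * (D * tau)) `^ p)).
  by rewrite ge0_ler_powR ?nnegrE ?mulr_ge0 ?(ltW p0) ?(ltW D0) ?(ltW tau0).
rewrite powRM ?mulr_ge0 ?(ltW D0) ?(ltW tau0)// powRM ?(ltW D0) ?(ltW tau0)//.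
rewrite taup -mulrA ler_wpM2l ?powR_ge0//.
rewrite (powR_pred p D0).
rewrite le_eqVlt; apply/orP; left; apply/eqP.
by field; rewrite gt_eqF.
Qed.

Lemma poweR_optimize p (a : \bar R) D A : 1 <= p -> (0 <= a)%E -> 0 < D ->
  (0 <= A)%E ->
  (forall tau k, young p tau k -> a <= (D * tau)%:E + k%:E * A)%E ->
  (a `^ p <= (2 `^ p * D `^ (p - 1))%:E * A)%E.
Proof.
move=> p1 a0 D0 A0 H; have p0 : 0 < p by rewrite (lt_le_trans _ p1).
case: A A0 H => [A| |]// A0 H; last first.
  by rewrite gt0_muley ?leey// lte_fin mulr_gt0 ?powR_gt0.
have := H _ _ (young_powR p1 ltr01).
case: a a0 H => [a| |]// a0 H _.
by rewrite poweR_EFin; exact: powR_optimize.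
Qed.

(** The converse of [powR_optimize]: inequalities proved for powers are only used in
  this linear form. *)
Lemma powR_linear p a d C A tau k : 1 <= p -> 0 <= a -> 0 < d -> 0 < C ->
  (0 <= A)%E -> young p tau k ->
  ((a `^ p)%:E <= (C * d `^ (p - 1))%:E * A)%E ->
  (a%:E <= (d * tau)%:E + (k * C)%:E * A)%E.
Proof.
move=> p1 a0 d0 C0 A0 [t0 k0 yg]; case: A A0 => [A| |]// A0; last first.
  by move=> _; rewrite gt0_muley ?lte_fin ?mulr_gt0// addey// leey.
rewrite -!EFinM -EFinD !lee_fin => H.
have ad0 : 0 <= a / d by rewrite divr_ge0// ltW.
have adp : (a / d) `^ p = a `^ p * d `^ - p.
  by rewrite powRM ?invr_ge0 ?(ltW d0)// -powR_inv1 ?(ltW d0)// -powRrM mulN1r.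
have := yg _ ad0; rewrite adp ler_pdivrMr// => H2.
apply: (le_trans H2); rewrite mulrDl (mulrC tau) lerD2l -!mulrA ler_pM2l//.
apply: (@le_trans _ _ (C * d `^ (p - 1) * A * (d `^ (- p) * d))).
  by rewrite ler_wpM2r// mulr_ge0 ?powR_ge0// ltW.
rewrite powRN (powR_pred p d0).
have := powR_gt0 (p - 1) d0; set q := _ `^ _ => q0.
rewrite le_eqVlt; apply/orP; left; apply/eqP; field.
by rewrite !gt_eqF.
Qed.

End Linearization.

(** * Integrals of nonnegative Borel functions *)

Section Integ.
Context {R : realType} {X : pmetricType R}.
Variable mu : {measure set (borel X) -> \bar R}.
Implicit Types (A B D : set X) (f g : X -> \bar R) (k : R).
Local Open Scope ereal_scope.

Definition bmeas f := measurable_fun [set: borel X] (f : borel X -> \bar R).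
Definition bset A := @measurable _ (borel X) A.

Lemma integ_patch D f : integ mu D f = integ mu setT (f \_ D).
Proof. by rewrite /integ integral_mkcond. Qed.

Lemma integ_ge0 D f : (forall x, D x -> 0 <= f x) -> 0 <= integ mu D f.
Proof. move=> f0; rewrite /integ; apply: integral_ge0; exact: f0. Qed.

Lemma integ_mono A B f g : (forall x, A x -> 0 <= f x) ->
  (forall x, B x -> 0 <= g x) -> (forall x, A x -> B x /\ f x <= g x) ->
  integ mu A f <= integ mu B g.
Proof.
move=> f0 g0 fg; rewrite /integ !ge0_integralE//.
apply: ge_ereal_sup => _ [h hf <-].
apply: ereal_sup_ubound; exists h => //= x; apply: (le_trans (hf x)).
rewrite !patchE; case: ifPn => [|_]; first by rewrite inE => /fg [Bx fgx]; rewrite mem_set.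
by case: ifPn => // /set_mem /g0.
Qed.

Lemma integ_le D f g : (forall x, D x -> 0 <= f x) ->
  (forall x, D x -> f x <= g x) -> integ mu D f <= integ mu D g.
Proof.
by move=> f0 fg; apply: integ_mono => // x Dx; [apply: (le_trans (f0 _ Dx)); apply: fg|split=> //; apply: fg].
Qed.

Lemma integ_sub A B f : (forall x, B x -> 0 <= f x) -> A `<=` B ->
  integ mu A f <= integ mu B f.
Proof. by move=> f0 AB; apply: integ_mono => // x Ax; [exact/f0/AB|split => //; exact: AB]. Qed.

Lemma integ_eq D f g : (forall x, D x -> f x = g x) -> integ mu D f = integ mu D g.
Proof. by move=> fg; apply: eq_integral => x /set_mem; exact: fg. Qed.

Lemma integD D f g : bset D -> bmeas f -> bmeas g ->
  (forall x, D x -> 0 <= f x) -> (forall x, D x -> 0 <= g x) ->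
  integ mu D (fun x => f x + g x) = integ mu D f + integ mu D g.
Proof.
move=> mD mf mg f0 g0; apply: ge0_integralD => //; exact: measurable_funTS.
Qed.

Lemma integZ D f k : bset D -> bmeas f -> (0 <= k)%R ->
  (forall x, D x -> 0 <= f x) ->
  integ mu D (fun x => k%:E * f x) = k%:E * integ mu D f.
Proof.
move=> mD mf k0 f0; apply: ge0_integralZl_EFin => //; exact: measurable_funTS.
Qed.

Lemma integ_cst D k : bset D -> integ mu D (fun=> k%:E) = k%:E * mu D.
Proof. by move=> mD; rewrite /integ -integral_cst. Qed.

Lemma integ_setU A B C f : bset A -> bset B -> bmeas f ->
  (forall x, C x -> 0 <= f x) -> A `&` B = set0 -> A `<=` C -> B `<=` C ->
  integ mu A f + integ mu B f <= integ mu C f.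
Proof.
move=> mA mB mf f0 AB AC BC.
have f0' : forall x, (A `|` B) x -> 0 <= f x by move=> x [/AC|/BC] /f0.
rewrite /integ -ge0_integral_setU//; first by apply: integ_sub => // x [/AC|/BC].
- exact: measurable_funTS.
- exact/disj_set2P.
Qed.

Lemma bsetT : bset [set: X].
Proof. exact: measurableT. Qed.

Lemma bset_setD A B : bset A -> bset B -> bset (A `\` B).
Proof. exact: measurableD. Qed.

Lemma bset_open A : open A -> bset A.
Proof. by move=> oA; apply: sub_sigma_algebra. Qed.

Lemma bmeas_poweR f (p : R) : bmeas f -> bmeas (fun x => f x `^ p).
Proof. by move=> mf; apply: (measurableT_comp (measurable_poweR p)). Qed.

Lemma bmeasZ f (k : \bar R) : bmeas f -> bmeas (fun x => k * f x).
Proof. by move=> mf; apply: emeasurable_funM => //; exact: measurable_cst. Qed.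

Lemma bmeasD f g : bmeas f -> bmeas g -> bmeas (fun x => f x + g x).
Proof. exact: emeasurable_funD. Qed.

Lemma bmeasM f g : bmeas f -> bmeas g -> bmeas (fun x => f x * g x).
Proof. exact: emeasurable_funM. Qed.

Lemma bmeas_restrict D f : bset D -> bmeas f -> bmeas (f \_ D).
Proof.
by move=> mD mf; apply: (measurable_restrictT _ mD).1; exact: measurable_funTS.
Qed.

Lemma bmeas_cst (k : \bar R) : bmeas (fun=> k).
Proof. exact: measurable_cst. Qed.

Lemma bmeas_indic A : bset A -> bmeas (fun x => (\1_A x)%:E).
Proof. by move=> mA; apply/measurable_EFinP; exact: measurable_indic. Qed.

Lemma bmeas_open f : (forall a : R, open [set x | a%:E < f x]) -> bmeas f.
Proof.
move=> of_; apply: (measurability _ (ErealGenOInfty.measurableE R)).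
move=> /= _ [_ [a ->]] <-; apply: measurableI => //.
by rewrite preimage_itvoy; apply: bset_open; exact: of_.
Qed.

(** Some point of a set of finite positive measure does not exceed the average;
  the slack [eta] spares any measurability assumption. *)
Lemma exists_le_average D f v (eta : R) : bset D -> mu D = v%:E -> (0 < v)%R ->
  (0 < eta)%R -> (forall x, D x -> 0 <= f x) ->
  exists2 w, D w & v%:E * f w <= integ mu D f + eta%:E.
Proof.
move=> mD Dv v0 eta0 f0; apply: contrapT => H.
have H' x : D x -> integ mu D f + eta%:E <= v%:E * f x.
  by move=> Dx; rewrite leNgt; apply/negP => /ltW lt; apply: H; exists x.
have [x0 Dx0] : D !=set0.
  by apply/set0P/eqP => D0; move: Dv v0; rewrite D0 measure0 => -[<-]; rewrite ltxx.
have I0 := integ_ge0 f0.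
have [Ioo|Ifin] := eqVneq (integ mu D f) +oo.
  by apply: H; exists x0 => //; rewrite Ioo addye// leey.
have [a aE] : exists a, integ mu D f = a%:E.
  by exists (fine (integ mu D f)); rewrite fineK// ge0_fin_numE// lt_neqAle leey Ifin.
move: I0; rewrite aE lee_fin => a0.
have : integ mu D (fun=> (v^-1 * (a + eta))%:E) <= integ mu D f.
  apply: integ_le => x Dx.
    by rewrite lee_fin mulr_ge0 ?invr_ge0 ?(ltW v0)// addr_ge0 ?(ltW eta0).
  have := H' x Dx; rewrite aE -EFinD.
  case: (f x) (f0 x Dx) => [fx| |]// _; last by rewrite leey.
  by rewrite -EFinM !lee_fin ler_pdivrMl//.
rewrite integ_cst// Dv -EFinM aE lee_fin mulrAC mulVf ?gt_eqF// mul1r.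
by rewrite gerDl leNgt eta0.
Qed.

End Integ.

#[export] Hint Resolve bsetT : core.

(** * Doubling measures *)

Section Metric.
Context {R : realType} {X : pmetricType R}.
Implicit Types (x y z w : X) (r s e : R).

Lemma in_ball x r y : ball x r y = (mdist x y < r)%R :> Prop.
Proof. by rewrite ballEmdist. Qed.

Lemma mdist_le0 x y : mdist x y <= 0 -> mdist x y = 0.
Proof. by move=> d0; apply: le_anti; rewrite d0 mdist_ge0. Qed.

Lemma mem_ball x r y : (y \in (ball x r : set X)) = (mdist x y < r).
Proof.
apply/idP/idP => [/set_mem|H]; first by rewrite in_ball.
by apply: mem_set; rewrite in_ball. Qed.

Lemma ball_sub x y r s : mdist x y + r <= s -> ball y r `<=` ball x s.
Proof.
move=> le z; rewrite !in_ball => yz.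
by apply: le_lt_trans (metric_triangle x y z) _; apply: lt_le_trans le; rewrite ltrD2l.
Qed.

Lemma open_mball x r : open (ball x r).
Proof.
rewrite openE => y; rewrite in_ball => xy.
apply/nbhs_ballP; exists (r - mdist x y) => /=; first by rewrite subr_gt0.
by apply: ball_sub; rewrite subrKC.
Qed.

Lemma bset_ball x r : bset (ball x r).
Proof. by apply: bset_open; exact: open_mball. Qed.

Lemma open_ballP (U : set X) :
  open U <-> forall x, U x -> exists2 e, 0 < e & ball x e `<=` U.
Proof.
rewrite openE; split => [H x Ux|H x Ux].
  by have /nbhs_ballP [e e0 eU] := H x Ux; exists e.
by apply/nbhs_ballP; have [e e0 eU] := H x Ux; exists e.
Qed.

Lemma mdist_lip x y z : `|mdist x y - mdist x z| <= mdist y z.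
Proof.
rewrite ler_norml; apply/andP; split.
  by have := metric_triangle x y z; lra.
by have := metric_triangle x z y; rewrite (metric_sym z y); lra.
Qed.

Lemma bmeas_lip (u : X -> R) : Lip u -> measurable_fun [set: borel X] (u : borel X -> R).
Proof.
move=> [K uK]; apply/measurable_EFinP; apply: bmeas_open => a.
apply/open_ballP => x /=; rewrite lte_fin => ax.
have K1 : 0 < `|K| + 1 by rewrite ltr_wpDl.
exists ((u x - a) / (`|K| + 1)); first by rewrite divr_gt0// subr_gt0.
move=> y; rewrite in_ball ltr_pdivlMr// => xy /=.
rewrite lte_fin; have := uK x y; have := mdist_ge0 x y; have := ler_norm K.
move=> KK d0 uxy; have := ler_norm (u x - u y).
have : K * mdist x y <= `|K| * mdist x y by rewrite ler_wpM2r.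
by move: xy; lra.
Qed.

Lemma Lip_dist x : Lip (mdist x).
Proof. by exists 1 => y z; rewrite mul1r mdist_lip. Qed.

Lemma dense_sequence : separable_space (X := X) ->
  exists a : nat -> X, forall z e, 0 < e -> exists n, mdist z (a n) < e.
Proof.
move=> [S /pcard_surjP [a aS] dS]; exists a => z e e0.
have [|y [zy Sy]] := dS (ball z e) _ (open_mball z e).
  by exists z; rewrite in_ball mdistxx.
by have [n _ an] := aS _ Sy; exists n; rewrite an -in_ball.
Qed.

Lemma measurable_dist_lt r : separable_space (X := X) ->
  measurable [set zw : borel X * borel X | mdist (zw.1 : X) (zw.2 : X) < r].
Proof.
move=> /dense_sequence [a aP].
pose f n (zw : borel X * borel X) := mdist (a n) zw.1 + mdist (a n) zw.2.
have mf n : measurable_fun [set: borel X * borel X] (f n).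
  by apply: measurable_funD; apply: (measurableT_comp (bmeas_lip (Lip_dist _))).
rewrite (_ : [set _ | _] = \bigcup_n (f n @^-1` `]-oo, r[)).
  apply: bigcupT_measurable => n; rewrite -[X in measurable X]setTI.
  exact: mf.
apply/seteqP; split => [[z w]/= zw|[z w] /= [n _]].
  have e0 : 0 < (r - mdist z w) / 2 by rewrite divr_gt0// subr_gt0.
  have [n nz] := aP z _ e0; exists n => //; rewrite /f /= in_itv /=.
  have := metric_triangle (a n) z w; rewrite (metric_sym (a n) z).
  by move: nz zw; rewrite ltr_pdivlMr//; lra.
rewrite /f /= in_itv /= => H; apply: le_lt_trans H.
by rewrite (metric_sym _ z) metric_triangle.
Qed.

End Metric.

Section Doubling.
Context {R : realType} {X : pmetricType R}.
Implicit Types (x y z w : X) (r s e H : R).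

Record doubling_measure (mu : {sigma_finite_measure set (borel X) -> \bar R}) (CD : R) : Prop :=
 DoublingMeasure {
  dm_ball : forall z r, 0 < r -> exists2 v, 0 < v & mu (ball z r) = v%:E ;
  dm_dbl : doubling mu CD ;
  dm_CD : 1 <= CD ;
  dm_sep : separable_space (X := X) }.

Variable mu : {sigma_finite_measure set (borel X) -> \bar R}.
Definition vol x r : R := fine (mu (ball x r)).

Variable CD : R.
Hypothesis dm : doubling_measure mu CD.

Lemma mu_ball z r : 0 < r -> mu (ball z r) = (vol z r)%:E.
Proof. by rewrite /vol => /(dm_ball dm z) [v v0 ->]. Qed.

Lemma vol_gt0 z r : 0 < r -> 0 < vol z r.
Proof. by rewrite /vol => /(dm_ball dm z) [v v0 ->]. Qed.

Lemma vol_le z w r s : 0 < r -> 0 < s -> ball z r `<=` ball w s -> vol z r <= vol w s.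
Proof.
move=> r0 s0 sub; rewrite -lee_fin -!mu_ball//.
by apply: le_measure => //; rewrite inE; exact: bset_ball.
Qed.

Lemma mdist_radius_gt0 z w r H s : mdist z w + s <= H * r -> 0 < s -> 0 < r -> 0 < H.
Proof.
move=> le s0 r0; rewrite -(pmulr_lgt0 _ r0); apply: lt_le_trans le.
by rewrite ltr_wpDl// mdist_ge0.
Qed.

Definition dblc H := CD ^+ (Num.bound H).

Lemma dblc_ge1 H : 1 <= dblc H.
Proof. by rewrite exprn_ege1// (dm_CD dm). Qed.

Lemma dblc_gt0 H : 0 < dblc H.
Proof. by rewrite (lt_le_trans ltr01)// dblc_ge1. Qed.

Lemma vol_dbl n z r : 0 < r -> vol z (2 ^+ n * r) <= CD ^+ n * vol z r.
Proof.
move=> r0; elim: n => [|n ih]; first by rewrite !expr0 !mul1r.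
rewrite !exprS -!mulrA; apply: (@le_trans _ _ (CD * vol z (2 ^+ n * r))).
  have s0 : 0 < 2 ^+ n * r by rewrite mulr_gt0// exprn_gt0.
  by have := dm_dbl dm z s0; rewrite !mu_ball// ?mulr_gt0// -EFinM lee_fin.
by rewrite ler_wpM2l// (le_trans ler01)// (dm_CD dm).
Qed.

(** The iterated doubling condition, in the form used to compare any two balls. *)
Lemma vol_comp H z r w s : 0 < r -> 0 < s -> mdist z w + s <= H * r ->
  vol w s <= dblc H * vol z r.
Proof.
move=> r0 s0 le; have H0 := mdist_radius_gt0 le s0 r0.
apply: le_trans (vol_dbl (Num.bound H) z r0); apply: vol_le => //.
  by rewrite mulr_gt0// exprn_gt0.
apply: ball_sub; apply: (le_trans le); rewrite ler_wpM2r ?(ltW r0)//.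
apply: (le_trans (ltW (archi_boundP (ltW H0)))).
by rewrite -natrX ler_nat ltnW// ltn_expl.
Qed.

Lemma bset_mu_fin x r (A : set X) : bset A -> A `<=` ball x r -> (mu A < +oo)%E.
Proof.
move=> mA AB; have r1 : 0 < `|r| + 1 by rewrite ltr_wpDl.
apply: (@le_lt_trans _ _ (mu (ball x (`|r| + 1)))).
  apply: le_measure; rewrite ?inE//; first exact: bset_ball.
  by apply: (subset_trans AB); apply: ball_sub; rewrite mdistxx add0r ler_wpDr// ler_norm.
by rewrite mu_ball// ltry.
Qed.

End Doubling.

Section Averages.
Context {R : realType} {X : pmetricType R}.
Implicit Types (x y z w : X) (r s e H : R).
Variables (mu : {sigma_finite_measure set (borel X) -> \bar R}) (CD : R).
Hypothesis dm : doubling_measure mu CD.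
Local Open Scope ereal_scope.

Lemma bmeas_vol s : bmeas (fun z => mu (ball z s)).
Proof.
pose E := [set zw : borel X * borel X | (mdist (zw.1 : X) (zw.2 : X) < s)%R].
have := measurable_fun_xsection mu (measurable_dist_lt s (dm_sep dm)).
apply: eq_measurable_fun => z _; congr (mu _).
apply/seteqP; split => w; rewrite in_ball /xsection /= ?inE //.
Qed.


Lemma bmeas_inv_vol s : (0 < s)%R -> bmeas (fun z => ((vol mu z s)^-1)%:E).
Proof.
move=> s0; apply/measurable_EFinP.
have mvol : measurable_fun [set: borel X] ((fun z => vol mu z s) : borel X -> R).
  have := bmeas_vol s => /(measurableT_comp (fine_measurable measurableT)).
  exact.
have := measurableT_comp (measurable_powR (-1)) mvol.
apply: eq_measurable_fun => z _ /=.
by rewrite powR_inv1// ltW// (vol_gt0 dm).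
Qed.

Lemma avgE z s h : (0 < s)%R ->
  avg mu (ball z s) h = ((vol mu z s)^-1)%:E * integ mu (ball z s) h.
Proof.
by move=> s0; rewrite /avg (mu_ball dm)// inver gt_eqF// (vol_gt0 dm).
Qed.

Lemma integ_ball_cst z s (k : R) : (0 < s)%R ->
  integ mu (ball z s) (fun=> k%:E) = (k * vol mu z s)%:E.
Proof.
move=> s0; rewrite integ_cst; last exact: bset_ball.
by rewrite EFinM; congr (_ * _); exact: (mu_ball dm).
Qed.

Lemma avg_ge0 z s h : (0 < s)%R -> (forall x, 0 <= h x) -> 0 <= avg mu (ball z s) h.
Proof.
move=> s0 h0; rewrite avgE// mule_ge0 ?integ_ge0//.
by rewrite lee_fin invr_ge0 ltW// (vol_gt0 dm).
Qed.

Let mem_pair s z w :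
  ((z, w) \in [set zw : borel X * borel X | (mdist (zw.1 : X) (zw.2 : X) < s)%R]) =
  (mdist z w < s)%R.
Proof. by apply/idP/idP => [/set_mem|H]; rewrite ?inE. Qed.

Let K s (h : X -> \bar R) (zw : borel X * borel X) : \bar R :=
  (\1_[set zw : borel X * borel X | (mdist (zw.1 : X) (zw.2 : X) < s)%R] zw)%:E *
  h zw.2.

Let K_ge0 s h zw : (forall x, 0 <= h x) -> 0 <= K s h zw.
Proof. by move=> h0; rewrite /K mule_ge0// lee_fin indic_ge0. Qed.

Let mK s h : bmeas h -> measurable_fun [set: borel X * borel X] (K s h).
Proof.
move=> mh; apply: emeasurable_funM; last by apply: (measurableT_comp mh).
apply/measurable_EFinP; apply: measurable_indic; apply: measurable_dist_lt.
exact: dm_sep dm.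
Qed.

Let integ_ballK z s h : integ mu (ball z s) h = \int[mu]_w K s h (z, w).
Proof.
rewrite integ_patch /integ; apply: eq_integral => w _.
rewrite patchE /K indicE mem_pair mem_ball.
by case: ifPn; rewrite ?mul1e ?mul0e.
Qed.

Lemma bmeas_avg s h : (0 < s)%R -> bmeas h -> (forall x, 0 <= h x) ->
  bmeas (fun z => avg mu (ball z s) h).
Proof.
move=> s0 mh h0.
have := measurable_fun_fubini_tonelli_F (m2 := mu) (K s h) (mK s mh) (fun zw => K_ge0 s zw h0).
move=> /(bmeasM (bmeas_inv_vol s0)); apply: eq_measurable_fun => z _.
by rewrite avgE// integ_ballK.
Qed.

(** Exchanging the integrals, a point [w] is counted in [avg mu (ball z s)] for
  the centres [z] in [ball w s], whose total weight is bounded by doubling. *)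
Lemma integ_avg_le A A' s h : bset A -> bset A' -> (0 < s)%R -> bmeas h ->
  (forall x, 0 <= h x) -> (forall z, A z -> ball z s `<=` A') ->
  integ mu A (fun z => avg mu (ball z s) h) <= (dblc CD 2)%:E * integ mu A' h.
Proof.
move=> mA mA' s0 mh h0 AA'.
pose c z : \bar R := (\1_A z)%:E * ((vol mu z s)^-1)%:E.
have c0 z : 0 <= c z.
  by rewrite mule_ge0 ?lee_fin ?indic_ge0// invr_ge0 ltW// (vol_gt0 dm).
have mc : bmeas c by apply: bmeasM; [exact: bmeas_indic|exact: bmeas_inv_vol].
pose F (zw : borel X * borel X) : \bar R := c zw.1 * K s h zw.
have mF : measurable_fun [set: borel X * borel X] F.
  by apply: emeasurable_funM; [apply: (measurableT_comp mc)|exact: mK].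
have F0 zw : 0 <= F zw by rewrite mule_ge0 ?K_ge0.
have -> : integ mu A (fun z => avg mu (ball z s) h) = \int[mu]_z \int[mu]_w F (z, w).
  rewrite integ_patch /integ; apply: eq_integral => z _.
  rewrite /F /= ge0_integralZl//; last first.
  - by move=> w _; exact: K_ge0.
  - exact: (measurableT_comp (mK s mh)).
  rewrite -integ_ballK patchE /c indicE.
  by case: ifPn => zA; rewrite ?mul1e ?avgE// !mul0e.
rewrite (fubini_tonelli F)// [integ mu A' h]integ_patch -integZ//; last first.
- by move=> x _; exact: erestrict_ge0.
- by rewrite ltW// (dblc_gt0 dm).
- exact: bmeas_restrict.
have F'0 w : 0 <= \int[mu]_z F (z, w) by exact: integral_ge0.
apply: (@integ_le _ _ mu setT (fun w => \int[mu]_z F (z, w))) => // w _.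
rewrite patchE; case: ifPn => [_|]; last first.
  rewrite notin_setE => A'w; rewrite mule0 le_eqVlt; apply/orP; left; apply/eqP.
  apply: integral0_eq => z _; rewrite /F /K /c /= !indicE.
  have [/set_mem Az|] := boolP (z \in A); last by rewrite !mul0e.
  rewrite mem_pair; case: (boolP (mdist z w < s)%R) => zw; last by rewrite mul0e mule0.
  by exfalso; apply: A'w; apply: (AA' z Az); rewrite in_ball.
apply: (@le_trans _ _ (integ mu (ball w s) (fun=> (dblc CD 2 / vol mu w s)%:E * h w))).
  rewrite integ_patch; apply: integ_le => // z _.
  rewrite patchE /F /K /c /= !indicE mem_pair mem_ball metric_sym.
  case: ifPn => zw; last by rewrite mul0e mule0.
  rewrite mul1e lee_wpmul2r//.
  have v0 := vol_gt0 dm z s0; have w0 := vol_gt0 dm w s0.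
  rewrite -EFinM lee_fin; apply: (@le_trans _ _ (vol mu z s)^-1%R).
    by rewrite ler_piMl ?invr_ge0 ?(ltW v0)//; case: (_ \in _).
  rewrite ler_pdivlMr// mulrC ler_pdivrMr//; apply: (vol_comp dm) => //.
  by move: zw; rewrite (metric_sym z w); lra.
rewrite /integ integral_cst; last exact: bset_ball.
rewrite [X in _ * X](_ : _ = (vol mu w s)%:E); last exact: (mu_ball dm).
by rewrite muleAC -EFinM divfK// gt_eqF// (vol_gt0 dm).
Qed.

End Averages.

(** * Measures with a density, and the Riesz kernel *)

Section Density.
Context {R : realType} {X : pmetricType R}.
Variables (mu : {measure set (borel X) -> \bar R}) (f : X -> R).
Hypothesis f0 : forall x, 0 <= f x.
Hypothesis mf : measurable_fun [set: borel X] (f : borel X -> R).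
Local Open Scope ereal_scope.

Let dens : set (borel X) -> \bar R := fun A => integ mu A (EFin \o f).

Let dens0 : dens set0 = 0. Proof. exact: integral_set0. Qed.

Let dens_ge0 A : 0 <= dens A.
Proof. by apply: integ_ge0 => x _; rewrite lee_fin. Qed.

Let dens_additive : semi_sigma_additive dens.
Proof.
apply: (@semi_sigma_additive_nng_induced _ (borel X) R mu (EFin \o f)).
  exact/measurable_EFinP.
by move=> x; rewrite lee_fin.
Qed.

Import HBNNSimple.

(** The Riesz measure is given by a density; integrals against it are computed by
  approximating the integrand by simple functions. *)
Lemma integ_dens h : bmeas h -> (forall x, 0 <= h x) ->
  integ (fun A : set X => integ mu A (EFin \o f)) setT h =
  integ mu setT (fun x => h x * (f x)%:E).
Proof.
move=> mh h0; pose s := nnsfun_approx measurableT mh.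
pose nu : {measure set (borel X) -> \bar R} :=
  HB.pack dens (isMeasure.Build _ _ _ dens dens0 dens_ge0 dens_additive).
have fE0 x : 0 <= (f x)%:E by rewrite lee_fin.
have mfE : bmeas (EFin \o f) by exact/measurable_EFinP.
have sh x : (s n x)%:E @[n --> \oo] --> h x by exact: cvg_nnsfun_approx.
have nd_s x : {homo (fun n => (s n x)%:E) : m n / (m <= n)%N >-> m <= n}.
  by move=> m n mn; rewrite lee_fin; exact/lefP/nd_nnsfun_approx.
have ms n : bmeas (fun x => (s n x)%:E) by exact/measurable_EFinP.
have step n : \int[nu]_x (s n x)%:E = \int[mu]_x ((s n x)%:E * (f x)%:E).
  pose A r := s n @^-1` [set r].
  have mA r : bset (A r) by exact: measurable_funPTI.
  have sE x : (s n x)%:E * (f x)%:E =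
      \sum_(r \in range (s n)) (r * \1_(A r) x)%:E * (f x)%:E.
    rewrite -ge0_mule_fsuml => [|r]; last by rewrite EFinM nnfun_muleindic_ge0.
    by rewrite fsumEFin// -fimfunE.
  have m1 r : bmeas (fun x => (r * \1_(A r) x)%:E).
    apply/measurable_EFinP; apply: measurable_funM; first exact: measurable_cst.
    by apply: measurable_indic; exact: mA.
  rewrite integral_nnsfun// patch_setT sintegralE.
  under eq_integral do rewrite sE.
  rewrite ge0_integral_fsum//; last 2 first.
  - by move=> r; exact: bmeasM.
  - by move=> r x _; rewrite mule_ge0// EFinM nnfun_muleindic_ge0.
  apply: eq_fsbigr => r /set_mem [x _ rE].
  under eq_integral do rewrite EFinM -muleA.
  rewrite ge0_integralZl_EFin//.
  - congr (_ * _); rewrite /= /dens /integ integral_mkcond.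
    by apply: eq_integral => z _; rewrite patchE indicE; case: ifPn; rewrite ?mul1e ?mul0e.
  - by move=> z _; rewrite mule_ge0// lee_fin indic_ge0.
  - by apply: bmeasM => //; exact: bmeas_indic.
  - by rewrite -rE.
transitivity (limn (fun n => \int[nu]_x (s n x)%:E)).
  rewrite -(@monotone_convergence _ _ _ nu)//; last first.
    by move=> n x _; rewrite lee_fin.
  by apply: (@eq_integral _ _ _ nu) => x _; apply/esym/cvg_lim => //; exact: sh.
transitivity (limn (fun n => \int[mu]_x ((s n x)%:E * (f x)%:E))).
  by congr (limn _); apply/funext => n; exact: step.
rewrite -(@monotone_convergence _ _ _ mu)//.
- by apply: eq_integral => x _; apply/cvg_lim => //; apply: cvgeZr.
- by move=> n; exact: bmeasM.
- by move=> n x _; rewrite mule_ge0// lee_fin.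
- by move=> x _ a b ab; rewrite lee_wpmul2r// nd_s.
Qed.

End Density.

Section Riesz.
Context {R : realType} {X : pmetricType R}.
Implicit Types (x y z w : X) (r s e H L rho : R) (k : nat).
Variables (mu : {sigma_finite_measure set (borel X) -> \bar R}) (CD : R).
Hypothesis dm : doubling_measure mu CD.

Definition kern x z : R := mdist x z / vol mu x (mdist x z).

Lemma vol_ge0 x r : 0 <= vol mu x r.
Proof. by rewrite /vol fine_ge0. Qed.

Lemma kern_ge0 x z : 0 <= kern x z.
Proof. by rewrite divr_ge0 ?mdist_ge0// vol_ge0. Qed.

Lemma kernxx x : kern x x = 0.
Proof. by rewrite /kern mdistxx mul0r. Qed.

Lemma vol_nondecreasing x : {homo vol mu x : r s / r <= s}.
Proof.
move=> r s rs; have [r0|r0] := leP r 0; last first.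
  apply: (vol_le dm) => //; first exact: lt_le_trans rs.
  by apply: ball_sub; rewrite mdistxx add0r.
rewrite {1}/vol (_ : ball x r = set0) ?measure0 ?vol_ge0//.
apply/seteqP; split => // z; rewrite in_ball => /lt_le_trans /(_ r0).
by rewrite ltNge mdist_ge0.
Qed.

Lemma measurable_kern x : measurable_fun [set: borel X] (kern x : borel X -> R).
Proof.
have md : measurable_fun [set: borel X] (mdist x : borel X -> R).
  by apply: bmeas_lip; exact: Lip_dist.
have mv : measurable_fun [set: R] (vol mu x).
  by apply: nondecreasing_measurable => //; exact: vol_nondecreasing.
apply: measurable_funM => //.
have := measurableT_comp (measurable_powR (-1)) (measurableT_comp mv md).
by apply: eq_measurable_fun => z _ /=; rewrite powR_inv1// vol_ge0.
Qed.

Definition rker L x y z : R :=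
  (kern x z + kern y z) * \1_(twoballs L x y `\` [set x; y]) z.

Lemma rker_ge0 L x y z : 0 <= rker L x y z.
Proof. by rewrite mulr_ge0// addr_ge0// kern_ge0. Qed.

Lemma bset_set1 x : bset [set x].
Proof.
rewrite -[X in bset X]setCK; apply: measurableC; apply: bset_open.
apply/open_ballP => z zx; exists (mdist x z).
  by rewrite mdist_gt0 eq_sym; apply/eqP.
by move=> w; rewrite in_ball => zw /= wx; move: zw; rewrite wx metric_sym ltxx.
Qed.

Lemma bset_twoballs L x y : bset (twoballs L x y).
Proof. by apply: measurableU; exact: bset_ball. Qed.

Lemma measurable_rker L x y : measurable_fun [set: borel X] (rker L x y : borel X -> R).
Proof.
apply: measurable_funM; first by apply: measurable_funD; exact: measurable_kern.
apply: measurable_indic; apply: bset_setD; first exact: bset_twoballs.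
by apply: measurableU; exact: bset_set1.
Qed.

Lemma rieszE L x y z : riesz mu L x y z = (rker L x y z)%:E.
Proof.
rewrite /riesz /rker !indicE in_setD.
have -> : (z \in [set x; y]) = (z == x) || (z == y).
  apply/idP/orP; first by move=> /set_mem [] /= ->; rewrite eqxx; [left|right].
  by move=> zxy; apply: mem_set; case: zxy => /eqP ->; [left|right].
case: (boolP ((z == x) || (z == y))) => [_|]; first by rewrite andbF mulr0.
rewrite negb_or => /andP[zx zy].
rewrite !(mu_ball dm) ?mdist_gt0 1?eq_sym// !inver !gt_eqF ?(vol_gt0 dm) ?mdist_gt0 1?eq_sym//.
by rewrite andbT !EFinM EFinD /kern !EFinM.
Qed.

Lemma integ_riesz L x y (h : X -> \bar R) : bmeas h -> (forall z, 0 <= h z)%E ->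
  integ (riesz_measure mu L x y) setT h =
  integ mu setT (fun z => h z * (rker L x y z)%:E)%E.
Proof.
move=> mh h0; rewrite -(integ_dens mu (rker_ge0 L x y) (measurable_rker L x y))//.
by congr (integ _ _ _); apply/funext => A; apply: integ_eq => z _; rewrite rieszE.
Qed.

Let rad rho k : R := (2 * rho) / (2 ^ k.+1)%:R.

Let rad_gt0 rho k : 0 < rho -> 0 < rad rho k.
Proof. by move=> r0; rewrite divr_gt0 ?mulr_gt0// ltr0n expn_gt0. Qed.

Let rad_half rho k : rad rho k = 2 * rad rho k.+1.
Proof.
rewrite /rad [in RHS]expnS natrM; field.
by rewrite pnatr_eq0 expn_eq0.
Qed.

Let rad_le rho k : 0 < rho -> rad rho k <= rho.
Proof.
move=> r0; rewrite ler_pdivrMr ?ltr0n ?expn_gt0// mulrC ler_pM2l//.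
by rewrite expnS natrM ler_peMr// ler1n expn_gt0.
Qed.

Lemma dyadic_scale rho (t : R) : 0 < t < rho -> exists k, rad rho k.+1 <= t < rad rho k.
Proof.
move=> /andP[t0 tr]; have r0 := lt_trans t0 tr.
have ex : exists n, rad rho n <= t.
  exists (Num.bound (rho / t)).
  rewrite /rad expnS natrM ler_pdivrMr ?mulr_gt0 ?ltr0n ?expn_gt0//.
  rewrite mulrCA ler_pM2l// mulrC -ler_pdivrMr//.
  have /ltW/le_trans := archi_boundP (ltW (divr_gt0 r0 t0)); apply.
  by rewrite ler_nat ltnW// ltn_expl.
case: (ex_minnP ex) => -[|n] nt nmin.
  by move: nt; rewrite /rad expn1 mulrAC divff ?mul1r// leNgt tr.
exists n; rewrite nt /= ltNge; apply/negP => /nmin; by rewrite ltnn.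
Qed.

Let cst_k rho x k : R := dblc CD 2 * rad rho k / vol mu x (rad rho k).

Let cst_k_ge0 rho x k : 0 < rho -> 0 <= cst_k rho x k.
Proof.
move=> r0; rewrite divr_ge0 ?vol_ge0// mulr_ge0// ltW ?(dblc_gt0 dm)//.
exact: rad_gt0.
Qed.

Local Open Scope ereal_scope.

Let kern_dyadic rho x z : (0 < rho)%R -> (mdist x z < rho)%R ->
  exists k, (kern x z <= cst_k rho x k * \1_(ball x (rad rho k)) z)%R.
Proof.
move=> r0 xz; have [d0|d0] := leP (mdist x z) 0%R.
  have dxz0 : mdist x z = 0%R by apply: le_anti; rewrite d0 mdist_ge0.
  exists 0%N; rewrite /kern dxz0 mul0r; apply: mulr_ge0 => //; exact: cst_k_ge0.
have [|k /andP[kd dk]] := @dyadic_scale rho (mdist x z); first by rewrite d0.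
exists k; rewrite indicE mem_ball dk mulr1 /cst_k.
have v0 := vol_gt0 dm x d0; have vk := vol_gt0 dm x (rad_gt0 k r0).
rewrite /kern ler_pdivrMr// mulrAC ler_pdivlMr// mulrC.
apply: (@le_trans _ _ (vol mu x (rad rho k) * rad rho k)%R).
  by rewrite ler_pM2l// ltW.
rewrite [leRHS]mulrAC ler_pM2r ?rad_gt0//; apply: (vol_comp dm) => //.
  exact: rad_gt0.
by rewrite mdistxx add0r rad_half ler_pM2l.
Qed.

Let term_le_nneseries (u : nat -> \bar R) k : (forall n, 0 <= u n) ->
  u k <= \sum_(n <oo) u n.
Proof.
move=> u0; apply: le_trans (nneseries_lim_ge k.+1 _) => //.
by rewrite big_nat_recr//= leeDr// sume_ge0.
Qed.

(** Along the dyadic balls [ball x (rad rho k)] the kernel is comparable to the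
  quotient of the radius by the volume, which turns an integral against the
  kernel into a geometric sum of averages. *)
Let integ_kern_dyadic rho x (h : X -> \bar R) : (0 < rho)%R -> bmeas h ->
  (forall z, 0 <= h z) ->
  integ mu (ball x rho) (fun z => h z * (kern x z)%:E) <=
  \sum_(k <oo) (dblc CD 2 * rad rho k)%:E * avg mu (ball x (rad rho k)) h.
Proof.
move=> r0 mh h0.
pose t k z := h z * (cst_k rho x k * \1_(ball x (rad rho k)) z)%:E.
have t0 k z : 0 <= t k z.
  by rewrite /t mule_ge0// lee_fin mulr_ge0// cst_k_ge0.
have mt k : bmeas (t k).
  apply: bmeasM => //; apply/measurable_EFinP; apply: measurable_funM.
    exact: measurable_cst.
  by apply: measurable_indic; exact: bset_ball.
apply: (@le_trans _ _ (integ mu (ball x rho) (fun z => \sum_(k <oo) t k z))).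
  apply: integ_le => z xz; first by rewrite mule_ge0// lee_fin kern_ge0.
  move: xz; rewrite in_ball => /(kern_dyadic r0) [k kle].
  apply: le_trans (term_le_nneseries k _) => //.
  by rewrite /t lee_wpmul2l// lee_fin.
rewrite /integ integral_nneseries//; first last.
- by move=> k; apply: measurable_funTS; exact: mt.
- exact: bset_ball.
apply: lee_nneseries => k _; first by move=> _; exact: integral_ge0.
have rk := rad_gt0 k r0; have vk := vol_gt0 dm x rk.
rewrite (avgE dm)// muleA -EFinM -/(cst_k rho x k) -integZ ?cst_k_ge0//; last exact: bset_ball.
rewrite [leRHS]integ_patch [leLHS](@integ_patch _ _ mu); apply: integ_le => z _.
  by rewrite patchE; case: ifPn.
rewrite !patchE mem_ball /t indicE mem_ball.
have [zk|zk] := boolP (mdist x z < rad rho k)%R.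
  by rewrite mulr1 muleC; case: ifPn => // _; rewrite mule_ge0// lee_fin cst_k_ge0.
by rewrite mulr0 mule0; case: ifPn.
Qed.

Let sum_rad rho c : (0 < rho)%R -> (0 <= c)%R ->
  \sum_(k <oo) (c * rad rho k)%:E <= (c * (2 * rho))%:E.
Proof.
move=> r0 c0; have := @epsilon_trick0 R (c * (2 * rho)) xpredT.
rewrite mulr_ge0// ?mulr_ge0 ?(ltW r0)// => /(_ isT); apply: le_trans.
by apply: lee_nneseries => k _; rewrite /rad mulrA// => _; rewrite lee_fin !mulr_ge0// ltW.
Qed.

(** The case [h = 1] of the dyadic estimate. *)
Lemma integ_kern_fin x rho : (0 < rho)%R ->
  integ mu (ball x rho) (fun z => (kern x z)%:E) <= (dblc CD 2 * (2 * rho))%:E.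
Proof.
move=> r0; have b0 : (0 <= dblc CD 2)%R by rewrite ltW// (dblc_gt0 dm).
apply: le_trans (sum_rad r0 b0).
rewrite (@integ_eq _ _ mu _ _ (fun z => 1 * (kern x z)%:E)); last by move=> z _; rewrite mul1e.
apply: le_trans (@integ_kern_dyadic rho x (fun=> 1) r0 _ _) _ => //.
  exact: bmeas_cst.
apply: lee_nneseries => k _.
  move=> _; apply: mule_ge0; first by rewrite lee_fin mulr_ge0// ltW// rad_gt0.
  by apply: (avg_ge0 dm) => //; exact: rad_gt0.
have rk := rad_gt0 k r0; have vk := vol_gt0 dm x rk.
rewrite (avgE dm)// (integ_ball_cst dm)//.
by rewrite mul1r -EFinM mulVf ?gt_eqF// mulr1.
Qed.

(** The sum of averages over dyadic balls is Borel in its centre, and its integral over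
  any set is controlled term by term by [integ_avg_le]; the potential itself is only
  ever bounded by it. *)
Lemma potential_majorant rho (h : X -> \bar R) :
  (0 < rho)%R -> bmeas h -> (forall z, 0 <= h z) ->
  exists G : X -> \bar R, [/\ bmeas G, (forall z, 0 <= G z),
    (forall z, integ mu (ball z rho) (fun w => h w * (kern z w)%:E) <= G z) &
    forall A A', bset A -> bset A' -> (forall z, A z -> ball z rho `<=` A') ->
      integ mu A G <= (dblc CD 2 ^+ 2 * (2 * rho))%:E * integ mu A' h].
Proof.
move=> r0 mh h0; have b0 : (0 <= dblc CD 2)%R by rewrite ltW// (dblc_gt0 dm).
have br k : (0 <= dblc CD 2 * rad rho k)%R by rewrite mulr_ge0// ltW// rad_gt0.
pose t k z := (dblc CD 2 * rad rho k)%:E * avg mu (ball z (rad rho k)) h.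
have t0 k z : 0 <= t k z.
  by apply: mule_ge0; rewrite ?lee_fin//; apply: (avg_ge0 dm) => //; exact: rad_gt0.
have mt k : bmeas (t k) by apply: bmeasZ; apply: (bmeas_avg dm) => //; exact: rad_gt0.
exists (fun z => \sum_(k <oo) t k z); split.
- exact: (@ge0_emeasurable_sum _ (borel X) R setT t xpredT (fun k z _ _ => t0 k z) (fun k _ => mt k)).
- by move=> z; exact: nneseries_ge0.
- by move=> z; exact: integ_kern_dyadic.
move=> A A' mA mA' AA'.
have I0 := @integ_ge0 _ _ mu A' h (fun x _ => h0 x).
rewrite [leLHS]/integ integral_nneseries//; last first.
  by move=> k; apply: measurable_funTS; exact: mt.
apply: (@le_trans _ _ (\sum_(k <oo) (dblc CD 2 ^+ 2 * rad rho k)%:E * integ mu A' h)).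
  apply: lee_nneseries => k _; first by move=> _; exact: integral_ge0.
  rewrite -[leLHS]/(integ mu A (t k)) integZ//; last 2 first.
  - by apply: (bmeas_avg dm) => //; exact: rad_gt0.
  - by move=> z _; apply: (avg_ge0 dm) => //; exact: rad_gt0.
  rewrite expr2 [X in X%:E * integ mu A' h]mulrAC [X in _ <= X * _]EFinM -muleA lee_wpmul2l ?lee_fin//.
  apply: (integ_avg_le dm) => //; first exact: rad_gt0.
  move=> z Az; apply: subset_trans (AA' z Az); apply: ball_sub.
  by rewrite mdistxx add0r rad_le.
have c0 : (0 <= dblc CD 2 ^+ 2)%R by rewrite exprn_ge0.
case: (integ mu A' h) I0 => [a| |]// a0; last first.
  by rewrite [leRHS]gt0_muley ?leey// lte_fin !mulr_gt0//; exact: dblc_gt0 dm _.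
under eq_eseriesr do rewrite muleC.
rewrite nneseriesZl => [|k _]; last by rewrite lee_fin mulr_ge0// ltW// rad_gt0.
by rewrite muleC lee_wpmul2r// sum_rad.
Qed.


Lemma integ_rker_le L x y rho (h : X -> \bar R) : bmeas h -> (forall z, 0 <= h z) ->
  twoballs L x y `<=` ball x rho -> twoballs L x y `<=` ball y rho ->
  integ mu setT (fun z => h z * (rker L x y z)%:E) <=
  integ mu (ball x rho) (fun z => h z * (kern x z)%:E) +
  integ mu (ball y rho) (fun z => h z * (kern y z)%:E).
Proof.
move=> mh h0 subx suby.
have mk w : bmeas (fun z => h z * (kern w z)%:E).
  by apply: bmeasM => //; apply/measurable_EFinP; exact: measurable_kern.
have k0 w z : 0 <= h z * (kern w z)%:E by rewrite mule_ge0// lee_fin kern_ge0.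
have mp w : bmeas ((fun z => h z * (kern w z)%:E) \_ (ball w rho)).
  by apply: bmeas_restrict => //; exact: bset_ball.
have p0 w z : 0 <= ((fun z => h z * (kern w z)%:E) \_ (ball w rho)) z.
  exact: erestrict_ge0.
rewrite [X in X + _]integ_patch [X in _ + X]integ_patch -integD//.
apply: integ_le => z _; first by rewrite mule_ge0// lee_fin rker_ge0.
rewrite /rker indicE; case: (boolP (z \in _)) => [/set_mem [zt _]|_].
  rewrite mulr1 !patchE !mem_set ?EFinD//; [|exact: suby|exact: subx].
  by rewrite ge0_muleDr ?lee_fin ?kern_ge0.
by rewrite mulr0 mule0 adde_ge0.
Qed.

End Riesz.

(** * Pointwise Lipschitz constants and slopes *)

Section Slope.
Context {R : realType} {X : pmetricType R}.
Implicit Types (x y z w : X) (r s e p : R) (u : X -> R).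
Local Open Scope ereal_scope.

Lemma lee_poweR p (a b : \bar R) : (0 <= p)%R -> 0 <= a -> a <= b ->
  a `^ p <= b `^ p.
Proof.
move=> p0 a0 ab; have b0 := le_trans a0 ab.
by apply: (gt0_ler_poweR p0) => //; rewrite in_itv /= leey ?a0 ?b0.
Qed.

(** The centre is not excluded from the supremum: it contributes [0 / 0 = 0],
  which makes the slope nonnegative even at isolated points. *)
Definition slope u e z : \bar R :=
  ereal_sup [set (`|u y - u z| / mdist z y)%:E | y in ball z e].

Lemma slope_ge0 u e z : (0 < e)%R -> 0 <= slope u e z.
Proof.
move=> e0; apply: ereal_sup_ubound; exists z; first by rewrite in_ball mdistxx.
by rewrite subrr normr0 mul0r.
Qed.

Lemma slope_le u e z (B : \bar R) : 0 <= B ->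
  (forall y, ball z e y -> (`|u y - u z|)%:E <= B * (mdist z y)%:E) ->
  slope u e z <= B.
Proof.
move=> B0 H; apply: ge_ereal_sup => _ [y zy <-].
have [d0|d0] := leP (mdist z y) 0%R.
  by rewrite (mdist_le0 d0) invr0 mulr0.
move: (H y zy); case: B B0 {H} => [B| |]// B0; last by rewrite leey.
by rewrite -EFinM !lee_fin ler_pdivrMr.
Qed.

Lemma slope_nondecreasing u z : {homo slope u ^~ z : r s / (r <= s)%R >-> r <= s}.
Proof.
move=> r s rs; apply: ereal_sup_le => _ [y zy <-]; exists y => //.
by move: zy; rewrite !in_ball => /lt_le_trans; apply.
Qed.

Lemma lipE u z : lip u z = ereal_inf [set slope u e z | e in [set e | (0 < e)%R]].
Proof.
rewrite /lip; case: asboolP => [[_ [V zV Vz]]|niso].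
  apply/eqP; rewrite eq_le; apply/andP; split.
    by apply: le_ereal_inf_tmp => _ [e e0 <-]; exact: slope_ge0.
  have /nbhs_ballP[e e0 eV] := zV.
  apply: le_trans (ereal_inf_lbound _) (_ : slope u e z <= 0); first by exists e.
  apply: slope_le => // y /eV Vy; have : (V `&` setT) y by [].
  by rewrite Vz => ->; rewrite subrr normr0 mdistxx mule0.
have ex e : (0 < e)%R -> exists2 y, ball z e y & y != z.
  move=> e0; apply: contrapT => H; apply: niso; split; first by rewrite inE.
  exists (ball z e); first exact: nbhsx_ballx.
  rewrite setIT; apply/seteqP; split => [y zy|_ ->]; last by rewrite in_ball mdistxx.
  by apply: contrapT => /eqP yz; apply: H; exists y.
set f := fun e : R => _.
have fE e : (0 < e)%R -> f e = slope u e z.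
  move=> e0; apply/eqP; rewrite eq_le; apply/andP; split.
    by apply: ereal_sup_le => _ [y /= [zy _] <-]; exists y.
  apply: ge_ereal_sup => _ [y zy <-].
  have [->|yz] := eqVneq y z.
    have [w zw wz] := ex e e0; apply: ereal_sup_ge; exists (`|u w - u z| / mdist z w)%:E.
      by exists w.
    by rewrite lee_fin subrr normr0 mul0r divr_ge0// mdist_ge0.
  by apply: ereal_sup_ubound; exists y.
have -> : [set slope u e z | e in [set e | (0 < e)%R]] = f @` [set` `]0%R, +oo[%R].
  apply/seteqP; split => _ [e /= e0 <-]; exists e; rewrite ?fE//=.
  - by rewrite in_itv /= andbT.
  - by move: e0; rewrite in_itv /= andbT.
  - by move: e0; rewrite in_itv /= andbT.
apply/cvg_lim => //; apply: nondecreasing_at_right_cvge => //.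
move=> r s; rewrite !in_itv /= !andbT => r0 s0 rs.
by rewrite -/(f r) -/(f s) !fE//; exact: slope_nondecreasing.
Qed.

Lemma lip_ge0 u z : 0 <= lip u z.
Proof. by rewrite lipE; apply: le_ereal_inf_tmp => _ [e e0 <-]; exact: slope_ge0. Qed.

Lemma lip_le_slope u e z : (0 < e)%R -> lip u z <= slope u e z.
Proof. by move=> e0; rewrite lipE; apply: ereal_inf_lbound; exists e. Qed.

Lemma lip_le u e z (B : \bar R) : (0 < e)%R -> 0 <= B ->
  (forall y, ball z e y -> (`|u y - u z|)%:E <= B * (mdist z y)%:E) ->
  lip u z <= B.
Proof. by move=> e0 B0 H; apply: le_trans (lip_le_slope _ _ e0) (slope_le B0 H). Qed.

(** The domination by a constant is what makes the passage to the limit possible. *)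
Lemma slope_lipschitz u K e z : (0 <= K)%R ->
  (forall x y, `|u x - u y| <= K * mdist x y)%R -> slope u e z <= K%:E.
Proof.
move=> K0 uK; apply: slope_le => // y _.
by rewrite -EFinM lee_fin metric_sym.
Qed.

Lemma Lip_nonneg u : Lip u ->
  exists2 K, (0 <= K)%R & forall x y, (`|u x - u y| <= K * mdist x y)%R.
Proof.
move=> [K uK]; exists `|K|%R => // x y; apply: (le_trans (uK x y)).
by rewrite ler_wpM2r ?mdist_ge0// ler_norm.
Qed.

(** The slope is lower semicontinuous. *)
Lemma bmeas_slope u e : (0 < e)%R -> Lip u -> bmeas (slope u e).
Proof.
move=> e0 /Lip_nonneg [K K0 uK]; apply: bmeas_open => a.
apply/open_ballP => z /= az.
have [a0|a0] := ltP a 0%R.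
  by exists 1%R => // w _; apply: lt_le_trans (slope_ge0 _ _ e0); rewrite lte_fin.
have [_ [y zy <-]] := ereal_sup_gt az; rewrite lte_fin => ay.
have d0 : (0 < mdist z y)%R.
  rewrite lt_neqAle mdist_ge0 andbT; apply/negP => /eqP d0.
  by move: ay; rewrite -d0 invr0 mulr0 ltNge a0.
move: ay; rewrite ltr_pdivlMr// => ay.
move: zy; rewrite in_ball => zy.
pose eta := (`|u y - u z| - a * mdist z y)%R.
have eta0 : (0 < eta)%R by rewrite subr_gt0.
have Ka0 : (0 < K + a + 1)%R by rewrite ltr_wpDl// addr_ge0.
exists (Num.min (e - mdist z y) (eta / (K + a + 1)))%R.
  by rewrite lt_min subr_gt0 zy divr_gt0.
move=> w; rewrite in_ball lt_min => /andP[zw1 zw2] /=.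
have wy : (mdist w y < e)%R.
  by have := metric_triangle w z y; rewrite (metric_sym w z); lra.
apply: lt_le_trans (ereal_sup_ubound _); last by exists y; [rewrite in_ball|reflexivity].
move: zw2; rewrite ltr_pdivlMr// => zw2.
have uzw := uK z w; have uyz := ler_normD (u y - u w)%R (u w - u z)%R.
rewrite subrKA in uyz; rewrite (distrC (u w)) in uyz.
have dzw := mdist_ge0 z w.
have awy : (a * mdist w y <= a * mdist z w + a * mdist z y)%R.
  by rewrite -mulrDr ler_wpM2l// (metric_sym z w) metric_triangle.
have H : (a * mdist w y < `|u y - u w|)%R.
  by move: zw2 uzw; rewrite /eta; nra.
rewrite lte_fin ltr_pdivlMr// lt_neqAle mdist_ge0 andbT; apply/negP => /eqP d1.
move: H; rewrite -d1 mulr0; have := uK y w; rewrite (metric_sym y w) -d1 mulr0.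
by move=> /le_lt_trans H /H; rewrite ltxx.
Qed.

(** The radius [2 * e] exceeds the step of the chain, so both endpoints of a link see
  each other and each of the two slopes bounds the increment. *)
Lemma UG_slope u e : (0 < e)%R -> Lip u -> UG e u (slope u (2 * e)).
Proof.
move=> e0 Lu; have e20 : (0 < 2 * e)%R by rewrite mulr_gt0.
split; [exact: bmeas_slope|by move=> x; exact: slope_ge0|move=> q N].
have [K K0 uK] := Lip_nonneg Lu.
have fin z : slope u (2 * e) z \is a fin_num.
  by rewrite ge0_fin_numE ?slope_ge0// (le_lt_trans (slope_lipschitz _ _ K0 uK))// ltry.
have up z y : (mdist z y < 2 * e)%R ->
    (`|u y - u z| <= fine (slope u (2 * e) z) * mdist z y)%R.
  move=> zy; have [zy0|zy0] := leP (mdist z y) 0%R.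
    by apply: (le_trans (uK y z)); rewrite (metric_sym y) (mdist_le0 zy0) !mulr0.
  rewrite -ler_pdivrMr// -lee_fin fineK//.
  by apply: ereal_sup_ubound; exists y => //; rewrite in_ball.
elim: N => [_|N ih qc]; first by rewrite subrr normr0 /chain_int big_geq.
rewrite /chain_int big_nat_recr//=.
have {}ih := ih (fun i iN => qc i (ltnW iN)).
apply: (@le_trans _ _ ((`|u (q N) - u (q 0%N)|)%:E + (`|u (q N.+1) - u (q N)|)%:E)).
  rewrite -EFinD lee_fin; have := ler_normD (u (q N.+1) - u (q N))%R (u (q N) - u (q 0%N))%R.
  by rewrite subrKA; lra.
apply: leeD => //; have qN := qc N (ltnSn N).
have q2 : (mdist (q N) (q N.+1) < 2 * e)%R by move: qN; rewrite /is_chain; lra.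
rewrite -(fineK (fin (q N))) -(fineK (fin (q N.+1))) inver gt_eqF// -EFinD -!EFinM lee_fin.
have := up _ _ q2; have : (mdist (q N.+1) (q N) < 2 * e)%R by rewrite metric_sym.
move=> /up; rewrite (metric_sym (q N.+1)) distrC; lra.
Qed.

Lemma ereal_inf_poweR p (s : nat -> \bar R) : (0 < p)%R -> (forall n, 0 <= s n) ->
  ereal_inf (range (fun n => s n `^ p)) = (ereal_inf (range s)) `^ p.
Proof.
move=> p0 s0; have i0 : 0 <= ereal_inf (range s) by apply: le_ereal_inf_tmp => _ [n _ <-].
apply/eqP; rewrite eq_le; apply/andP; split; last first.
  apply: le_ereal_inf_tmp => _ [n _ <-]; apply: (lee_poweR (ltW p0)) => //.
  by apply: ereal_inf_lbound; exists n.
set I := ereal_inf _.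
have I0 : 0 <= I by apply: le_ereal_inf_tmp => _ [n _ <-]; exact: poweR_ge0.
rewrite -(poweRe1 I0) -(mulVf (lt0r_neq0 p0)) poweRrM; apply: lee_poweR.
- exact: ltW.
- exact: poweR_ge0.
apply: le_ereal_inf_tmp => _ [n _ <-].
rewrite -(poweRe1 (s0 n)) -(mulfV (lt0r_neq0 p0)) poweRrM; apply: lee_poweR => //.
  by rewrite invr_ge0 ltW.
by apply: ereal_inf_lbound; exists n.
Qed.

Let eps n : R := (n.+1%:R^-1)%R.

Let eps_gt0 n : (0 < eps n)%R. Proof. by rewrite invr_gt0. Qed.

Lemma cvg_slope_poweR p u z : (0 < p)%R ->
  slope u (2 * eps n) z `^ p @[n --> \oo] --> lip u z `^ p.
Proof.
move=> p0; have e20 n : (0 < 2 * eps n)%R by rewrite mulr_gt0.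
have -> : lip u z = ereal_inf (range (fun n => slope u (2 * eps n) z)).
  rewrite lipE; apply/eqP; rewrite eq_le; apply/andP; split.
    by apply: le_ereal_inf_tmp => _ [n _ <-]; apply: ereal_inf_lbound; exists (2 * eps n)%R; first exact: e20.
  apply: le_ereal_inf_tmp => _ [e /= e0 <-].
  pose n := Num.bound (2 / e)%R.
  apply: le_trans (ereal_inf_lbound _) (slope_nondecreasing u z (_ : 2 * eps n <= e)%R).
    by exists n.
  have e2 : (0 <= 2 / e)%R by rewrite divr_ge0// ltW.
  rewrite ler_pdivrMr// mulrC -ler_pdivrMr// (le_trans (ltW (archi_boundP e2)))//.
  by rewrite ler_nat.
rewrite -ereal_inf_poweR//; last by move=> n; exact: slope_ge0.
apply: ereal_nonincreasing_cvgn => m n mn.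
apply: (lee_poweR (ltW p0)); first exact: slope_ge0.
apply: slope_nondecreasing.
by rewrite ler_pM2l// lef_pV2 ?posrE// ler_nat.
Qed.

Lemma bmeas_lip_poweR p u : (0 < p)%R -> Lip u -> bmeas (fun z => lip u z `^ p).
Proof.
move=> p0 Lu; apply: (@emeasurable_fun_cvg _ (borel X) R setT (fun n z => slope u (2 * eps n) z `^ p)).
  by move=> n; apply: bmeas_poweR; apply: bmeas_slope => //; rewrite mulr_gt0.
by move=> z _; exact: cvg_slope_poweR.
Qed.

End Slope.

(** * From chains to Lipschitz constants *)

Section ChainToLip.
Context {R : realType} {X : pmetricType R}.
Implicit Types (x y z w : X) (r s e p L : R) (u : X -> R).
Variables (mu : {sigma_finite_measure set (borel X) -> \bar R}) (CD : R).
Hypothesis dm : doubling_measure mu CD.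
Local Open Scope ereal_scope.

Lemma integrable_ball x r u M : (0 < r)%R ->
  measurable_fun [set: borel X] (u : borel X -> R) ->
  (forall z, ball x r z -> `|u z| <= M)%R ->
  mu.-integrable (ball x r : set (borel X)) (EFin \o u).
Proof.
move=> r0 mu_ uM; apply/integrableP; split.
  by apply/measurable_EFinP; exact: measurable_funTS.
apply: (@le_lt_trans _ _ (integ mu (ball x r) (fun=> M%:E))).
  by apply: integ_le => z xz //=; rewrite lee_fin uM.
by rewrite (integ_ball_cst dm)// ltry.
Qed.

Lemma avg_itv x r u (a b : R) : (0 < r)%R ->
  measurable_fun [set: borel X] (u : borel X -> R) ->
  (forall z, ball x r z -> a <= u z <= b)%R ->
  a%:E <= avg mu (ball x r) (EFin \o u) <= b%:E.
Proof.
move=> r0 mu_ uab; have v0 := vol_gt0 dm x r0.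
have intu : mu.-integrable (ball x r : set (borel X)) (EFin \o u).
  apply: (@integrable_ball x r u (`|a| + `|b|)%R r0) => // z /uab.
  rewrite ler_norml; have := ler_norm a; have := ler_norm b.
  by have := ler_norm (- a)%R; have := ler_norm (- b)%R; rewrite !normrN; lra.
have intc (c : R) : mu.-integrable (ball x r : set (borel X)) (EFin \o (fun=> c) : borel X -> _).
  by apply: (@integrable_ball x r (fun=> c) `|c|%R r0).
rewrite (avgE dm)//; apply/andP; split.
  have : integ mu (ball x r) (fun=> a%:E) <= integ mu (ball x r) (EFin \o u).
    by apply: (le_integral (bset_ball x r) (intc a) intu) => z /set_mem /uab/andP[].
  by rewrite (integ_ball_cst dm)// => H; rewrite lee_pdivlMl// -EFinM mulrC.
have : integ mu (ball x r) (EFin \o u) <= integ mu (ball x r) (fun=> b%:E).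
  by apply: (le_integral (bset_ball x r) intu (intc b)) => z /set_mem /uab/andP[].
by rewrite (integ_ball_cst dm)// => H; rewrite lee_pdivrMl// -EFinM mulrC.
Qed.

Lemma Leb_lip u x : Lip u -> Leb mu u x.
Proof.
move=> Lu; have [K K0 uK] := Lip_nonneg Lu; have mu_ := bmeas_lip Lu.
have H r : (0 < r)%R -> (u x + - K * r)%:E <= avg mu (ball x r) (EFin \o u) <= (u x + K * r)%:E.
  move=> r0; apply: avg_itv => // z; rewrite in_ball => xz.
  have := uK x z; rewrite ler_norml => /andP[].
  have : (K * mdist x z <= K * r)%R by rewrite ler_wpM2l// ltW.
  lra.
have lin (k : R) : (u x + k * r)%R @[r --> 0^'+] --> u x.
  rewrite [X in _ --> X](_ : _ = (u x + k * 0)%R); last by rewrite mulr0 addr0.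
  apply: cvgD; first exact: cvg_cst.
  by apply: cvgMr; apply: cvg_at_right_filter; exact: cvg_id.
rewrite /Leb /=; apply: (@squeeze_cvge _ _ _ _ (fun r => (u x + - K * r)%:E) _ (fun r => (u x + K * r)%:E)).
- by near=> r; apply: H.
- by apply: cvg_EFin; [near=> r|exact: lin].
- by apply: cvg_EFin; [near=> r|exact: lin].
Unshelve. all: by end_near. Qed.

Lemma rker_fin L x y : integ mu setT (fun z => (rker mu L x y z)%:E) < +oo.
Proof.
pose rho := ((`|L| + 1) * mdist x y + 1)%R; have d0 := mdist_ge0 x y.
have [Ld rhoE] : (L * mdist x y <= `|L| * mdist x y /\
    rho = `|L| * mdist x y + mdist x y + 1)%R.
  by rewrite ler_wpM2r ?ler_norm// /rho mulrDl mul1r.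
have Ld0 : (0 <= `|L| * mdist x y)%R by rewrite mulr_ge0.
have rho0 : (0 < rho)%R by rewrite rhoE; lra.
have subx : twoballs L x y `<=` ball x rho.
  move=> z [|]; rewrite !in_ball rhoE => zb; first by lra.
  by have := metric_triangle x y z; lra.
have suby : twoballs L x y `<=` ball y rho.
  move=> z [|]; rewrite !in_ball rhoE => zb; last by lra.
  by have := metric_triangle y x z; rewrite (metric_sym y x); lra.
rewrite (@integ_eq _ _ mu _ _ (fun z => 1 * (rker mu L x y z)%:E)); last first.
  by move=> z _; rewrite mul1e.
apply: le_lt_trans (integ_rker_le dm _ _ subx suby) _ => //; first exact: bmeas_cst.
have fin w : integ mu (ball w rho) (fun z => 1 * (kern mu w z)%:E) < +oo.
  under integ_eq do rewrite mul1e.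
  by rewrite (le_lt_trans (integ_kern_fin dm _ rho0))// ltry.
by rewrite lte_add_pinfty.
Qed.

(** The slopes at scale [2 * eps n] are chain gradients and decrease to [lip u]; they are
  dominated by the Lipschitz constant, and the Riesz measure is finite. *)
Lemma chain_to_lip p C L : (1 <= p)%R ->
  pointwise_chain p mu C L -> pointwise_lip p mu C L.
Proof.
move=> p1 [C0 L1 H]; split => // u Lu x y.
have p0 : (0 < p)%R by rewrite (lt_le_trans _ p1).
have [K K0 uK] := Lip_nonneg Lu.
pose e n : R := (n.+1%:R^-1)%R.
have e0 n : (0 < e n)%R by rewrite invr_gt0.
have e20 n : (0 < 2 * e n)%R by rewrite mulr_gt0.
pose R0 z := (rker mu L x y z)%:E.
have R00 z : 0 <= R0 z by rewrite lee_fin rker_ge0.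
have mR0 : bmeas R0 by apply/measurable_EFinP; exact: (measurable_rker dm).
have mlip := bmeas_lip_poweR p0 Lu.
pose f n z := slope u (2 * e n) z `^ p * R0 z.
have mf n : bmeas (f n) by apply: bmeasM => //; apply: bmeas_poweR; exact: bmeas_slope.
pose c := (C * mdist x y `^ (p - 1))%R.
have Hn n : (`|u x - u y| `^ p)%:E <= c%:E * integ mu setT (f n).
  rewrite -(integ_riesz dm); last 2 first.
  - by apply: bmeas_poweR; exact: bmeas_slope.
  - by move=> z; exact: poweR_ge0.
  exact: (H u (bmeas_lip Lu) x y (@Leb_lip u x Lu) (@Leb_lip u y Lu) (e n) (e0 n)
    (slope u (2 * e n)) (UG_slope (e0 n) Lu)).
rewrite (integ_riesz dm)//; last by move=> z; exact: poweR_ge0.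
have cvgf z : f n z @[n --> \oo] --> lip u z `^ p * R0 z.
  by apply: cvgeZr => //; exact: cvg_slope_poweR.
have gint : mu.-integrable [set: borel X] (fun z => (K `^ p)%:E * R0 z).
  apply/integrableP; split; first exact: bmeasZ.
  apply: (@le_lt_trans _ _ (integ mu setT (fun z => (K `^ p)%:E * R0 z))).
    apply: integ_le => // z _.
    by rewrite gee0_abs// mule_ge0// lee_fin powR_ge0.
  rewrite integZ// ?powR_ge0// lte_mul_pinfty ?lee_fin ?powR_ge0//.
  exact: rker_fin.
have mlim : bmeas (fun z => lip u z `^ p * R0 z) by exact: bmeasM.
have [] := @dominated_convergence _ (borel X) R mu setT measurableT f _ _ mf mlim _ gint _.
- by apply: aeW => z _; exact: cvgf.
- apply: aeW => z n _; rewrite gee0_abs ?mule_ge0 ?poweR_ge0//.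
  rewrite lee_wpmul2r// -poweR_EFin; apply: lee_poweR; rewrite ?slope_ge0 ?(ltW p0)//.
  exact: slope_lipschitz.
move=> _ _ cvgI.
have cfin : (c%:E : \bar R) \is a fin_num by [].
have cvgcI := cvgeZl cfin cvgI.
rewrite -(cvg_lim _ cvgcI)//; apply: lime_ge; first by apply/cvg_ex; eexists; exact: cvgcI.
by apply: nearW => n; exact: Hn.
Qed.

End ChainToLip.

(** * From the pointwise estimate to the Poincare inequality *)

Section LipToPoincare.
Context {R : realType} {X : pmetricType R}.
Implicit Types (x y z w : X) (r s e p L M : R) (u : X -> R).
Variables (mu : {sigma_finite_measure set (borel X) -> \bar R}) (CD : R).
Hypothesis dm : doubling_measure mu CD.
Local Open Scope ereal_scope.

Definition osc x r u c : \bar R := integ mu (ball x r) (fun z => (`|u z - c|)%:E).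

Lemma osc_ge0 x r u c : 0 <= osc x r u c.
Proof. by apply: integ_ge0 => z _; rewrite lee_fin. Qed.

Lemma avg_fine x r u M : (0 < r)%R ->
  measurable_fun [set: borel X] (u : borel X -> R) ->
  (forall z, ball x r z -> `|u z| <= M)%R ->
  avg mu (ball x r) (EFin \o u) = (fine (avg mu (ball x r) (EFin \o u)))%:E.
Proof.
move=> r0 mu_ uM; have /andP[lo hi] : (- M)%:E <= avg mu (ball x r) (EFin \o u) <= M%:E.
  by apply: (avg_itv dm) => // z /uM; rewrite ler_norml.
by rewrite fineK// fin_numE; apply/andP; split; apply/eqP => E;
   [move: lo|move: hi]; rewrite E.
Qed.

Lemma bmeas_osc u c : measurable_fun [set: borel X] (u : borel X -> R) ->
  bmeas (fun z => (`|u z - c|)%:E).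
Proof.
move=> mu_; apply/measurable_EFinP; apply: measurableT_comp => //.
by apply: measurable_funB => //; exact: measurable_cst.
Qed.

(** A constant close to [u] in mean is close to the average of [u]. *)
Lemma avg_osc x r u M c (a := fine (avg mu (ball x r) (EFin \o u))) : (0 < r)%R ->
  measurable_fun [set: borel X] (u : borel X -> R) ->
  (forall z, ball x r z -> `|u z| <= M)%R ->
  (`|a - c| * vol mu x r)%:E <= osc x r u c.
Proof.
move=> r0 mu_ uM; have v0 := vol_gt0 dm x r0; have mB := bset_ball x r.
have intu := integrable_ball dm r0 mu_ uM.
have intc : mu.-integrable (ball x r : set (borel X)) (EFin \o ((fun=> c) : borel X -> R)).
  by apply: (integrable_ball dm r0 (measurable_cst c) (M := `|c|%R)).
have E : \int[mu]_(z in ball x r) ((u z)%:E - c%:E) = ((a - c) * vol mu x r)%:E.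
  have -> : \int[mu]_(z in ball x r) ((u z)%:E - c%:E) =
            integ mu (ball x r) (EFin \o u) - integ mu (ball x r) (fun=> c%:E).
    exact: (integralB mB intu intc).
  have : avg mu (ball x r) (EFin \o u) = a%:E by exact: avg_fine r0 mu_ uM.
  rewrite (avgE dm)// => aE.
  have -> : integ mu (ball x r) (EFin \o u) = (a * vol mu x r)%:E.
    by rewrite EFinM -aE muleAC -EFinM mulVf ?gt_eqF// mul1e.
  by rewrite (integ_ball_cst dm)// -EFinB mulrBl.
have := @le_abse_integral _ (borel X) R mu (ball x r) (fun z => (u z)%:E - c%:E) mB _.
rewrite E abse_EFin normrM (gtr0_norm v0); apply.
apply: measurable_funTS; apply: emeasurable_funB; last exact: measurable_cst.
exact/measurable_EFinP.
Qed.

Lemma osc_avg x r u M c (a := fine (avg mu (ball x r) (EFin \o u))) : (0 < r)%R ->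
  measurable_fun [set: borel X] (u : borel X -> R) ->
  (forall z, ball x r z -> `|u z| <= M)%R ->
  osc x r u a <= 2%:E * osc x r u c.
Proof.
move=> r0 mu_ uM; have mB := bset_ball x r.
have H := avg_osc c r0 mu_ uM; rewrite -/a in H.
apply: (@le_trans _ _ (integ mu (ball x r) (fun z => (`|u z - c|)%:E + (`|a - c|)%:E))).
  apply: integ_le => z _; first by rewrite lee_fin.
  rewrite -EFinD lee_fin (distrC a).
  by have := ler_normD (u z - c)%R (c - a)%R; rewrite subrKA.
rewrite integD//; [|exact: bmeas_osc|exact: bmeas_cst|by move=> *; rewrite lee_fin..].
rewrite (integ_ball_cst dm)// -/(osc x r u c).
have -> : 2%:E = 1 + 1 :> \bar R by rewrite -EFinD.
by rewrite ge0_muleDl ?lee_fin// mul1e leeD2l.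
Qed.

Let cpot L : R := dblc CD 2 ^+ 2 * (2 * ((L + 1) * 2)).

(** The constant is [u w] for a point [w] whose potential is at most the average of the
  potentials over the ball. *)
Lemma pointwise_osc p C L u x r tau k : (1 <= p)%R -> pointwise_lip p mu C L ->
  Lip u -> (0 < r)%R -> young p tau k ->
  exists c, osc x r u c <= (3 * r * tau * vol mu x r)%:E +
    (2 * k * C * (cpot L * r))%:E *
    integ mu (ball x ((2 * L + 3) * r)) (fun z => lip u z `^ p).
Proof.
move=> p1 [C0 L1 H] Lu r0 yg; have [t0 k0 _] := yg.
have p0 : (0 < p)%R by rewrite (lt_le_trans _ p1).
have v0 := vol_gt0 dm x r0; have mB := bset_ball x r.
pose h z := lip u z `^ p.
have h0 z : 0 <= h z by exact: poweR_ge0.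
have mh : bmeas h by exact: bmeas_lip_poweR.
pose rho := ((L + 1) * 2 * r)%R.
have rho0 : (0 < rho)%R by rewrite /rho !mulr_gt0//; lra.
have [G [mG G0 FG IG]] := potential_majorant dm rho0 mh h0.
pose I := integ mu (ball x ((2 * L + 3) * r)) h.
have IB : integ mu (ball x r) G <= (cpot L * r)%:E * I.
  apply: le_trans (IG _ (ball x ((2 * L + 3) * r)) mB (bset_ball _ _) _) _.
    move=> z; rewrite in_ball => xz; apply: ball_sub.
    by rewrite /rho; move: xz; lra.
  by rewrite le_eqVlt; apply/orP; left; apply/eqP; congr (_%:E * _); rewrite /rho /cpot; ring.
have uzw z w : ball x r z -> ball x r w ->
    (`|u z - u w|)%:E <= (2 * r * tau)%:E + (k * C)%:E * (G z + G w).
  rewrite !in_ball => xz xw.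
  have GG0 : 0 <= G z + G w by rewrite adde_ge0.
  have [->|zw] := eqVneq z w.
    rewrite subrr normr0; apply: adde_ge0.
      by rewrite lee_fin !mulr_ge0// ltW.
    by apply: mule_ge0; [rewrite lee_fin mulr_ge0// ltW|exact: adde_ge0].
  have d0 : (0 < mdist z w)%R by rewrite mdist_gt0.
  have d2 : (mdist z w < 2 * r)%R.
    by have := metric_triangle z x w; rewrite (metric_sym z x); lra.
  have Ld : (L * mdist z w + mdist z w <= rho)%R.
    have -> : (L * mdist z w + mdist z w = (L + 1) * mdist z w)%R by ring.
    by rewrite /rho -mulrA ler_pM2l ?ltW//; lra.
  have Ldw : (L * mdist z w <= rho)%R by move: Ld d0; lra.
  have := H u Lu z w; rewrite (integ_riesz dm)// => Hzw.
  apply: le_trans (powR_linear p1 (normr_ge0 _) d0 C0 _ yg Hzw) _.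
    apply: integ_ge0 => v _.
    by apply: mule_ge0; [exact: poweR_ge0|rewrite lee_fin rker_ge0].
  apply: leeD; first by rewrite lee_fin ler_pM2r// ltW.
  rewrite lee_pmul2l// ?lte_fin ?mulr_gt0//.
  apply: le_trans (integ_rker_le dm mh h0 (rho := rho) _ _) _; last by apply: leeD.
    by move=> v [|]; rewrite !in_ball => ?; [|have := metric_triangle z w v]; lra.
  move=> v [|]; rewrite !in_ball => ?; [have := metric_triangle w z v|]; rewrite ?(metric_sym w z); lra.
have eta0 : (0 < r * tau * vol mu x r / (k * C))%R by rewrite divr_gt0 ?mulr_gt0.
have [w Bw Gw] := exists_le_average mB (mu_ball dm x r0) v0 eta0 (fun z _ => G0 z).
exists (u w).
apply: (@le_trans _ _ (integ mu (ball x r)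
    (fun z => ((2 * r * tau)%:E + (k * C)%:E * G w) + (k * C)%:E * G z))).
  apply: integ_le => z Bz; first by rewrite lee_fin.
  apply: (le_trans (uzw z w Bz Bw)).
  by rewrite ge0_muleDr// (addeC (_ * G z)) addeA.
rewrite integD//; last 4 first.
- exact: bmeas_cst.
- exact: bmeasZ.
- move=> z _; apply: adde_ge0; first by rewrite lee_fin !mulr_ge0// ltW.
  by rewrite mule_ge0// lee_fin mulr_ge0// ltW.
- by move=> z _; rewrite mule_ge0// lee_fin mulr_ge0// ltW.
have kC0 : (0 < k * C)%R by rewrite mulr_gt0.
rewrite integZ// ?(ltW kC0)//.
have -> : integ mu (ball x r) (fun=> (2 * r * tau)%:E + (k * C)%:E * G w) =
    (2 * r * tau * vol mu x r)%:E + (k * C)%:E * ((vol mu x r)%:E * G w).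
  rewrite /integ integral_cst//.
  rewrite [X in _ * X](_ : _ = (vol mu x r)%:E); last exact: (mu_ball dm).
  rewrite ge0_muleDl ?lee_fin ?mulr_ge0 ?(ltW r0) ?(ltW t0) ?mule_ge0//.
  - by rewrite EFinM -(muleA (k * C)%:E) (muleC (G w)).
  - by rewrite lee_fin ltW.
pose J := integ mu (ball x r) G.
apply: (@le_trans _ _ ((2 * r * tau * vol mu x r)%:E +
    (k * C)%:E * (J + (r * tau * vol mu x r / (k * C))%:E) + (k * C)%:E * J)).
  by rewrite leeD2r// leeD2l// lee_pmul2l ?lte_fin.
have J0 : 0 <= J by exact: integ_ge0.
rewrite ge0_muleDr ?lee_fin ?(ltW eta0)// -EFinM mulrCA divff ?gt_eqF// mulr1.
rewrite (_ : 2 * k * C * (cpot L * r) = (k * C) * (2 * (cpot L * r)))%R; last by ring.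
rewrite [X in _ <= _ + X * _]EFinM [X in _ <= _ + (_ * X) * _]EFinM -2!muleA.
apply: (@le_trans _ _ ((3 * r * tau * vol mu x r)%:E + (k * C)%:E * (2%:E * J))).
  have -> : 2%:E * J = J + J by rewrite -[2%:E]/((1 + 1)%:E) EFinD ge0_muleDl ?lee_fin// mul1e.
  rewrite [(k * C)%:E * (J + J)]ge0_muleDr//.
  rewrite (_ : 3 * r * tau * vol mu x r = 2 * r * tau * vol mu x r + r * tau * vol mu x r)%R; last by ring.
  by rewrite EFinD addeACA -!addeA.
by rewrite leeD2l// lee_pmul2l ?lte_fin// lee_pmul2l ?lte_fin.
Qed.

Definition poincare_const p C L : R :=
  (Num.max 1 ((2 `^ p * 6 `^ (p - 1) * (4 * C * cpot L * dblc CD (2 * L + 3))) `^ p^-1))%R.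

Lemma Lip_bounded u x r : Lip u ->
  exists M, forall z, ball x r z -> (`|u z| <= M)%R.
Proof.
move=> Lu; have [K K0 uK] := Lip_nonneg Lu.
exists (`|u x| + K * r)%R => z; rewrite in_ball => xz.
have := uK z x; have := ler_normD (u z - u x)%R (u x); rewrite subrK metric_sym.
have : (K * mdist x z <= K * r)%R by rewrite ler_wpM2l// ltW.
lra.
Qed.

Lemma lip_to_poincare p C L : (1 <= p)%R -> pointwise_lip p mu C L ->
  poincare_lip p mu (poincare_const p C L) (2 * L + 3).
Proof.
move=> p1 H; have [C0 L1 _] := H.
have p0 : (0 < p)%R by rewrite (lt_le_trans _ p1).
split; [by rewrite le_max lexx|lra|move=> u g [/= Lu ->] x r r0].
have [M uM] := Lip_bounded x r Lu; have mu_ := bmeas_lip Lu.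
have v0 := vol_gt0 dm x r0; have b20 := dblc_gt0 dm 2.
have cp0 : (0 < cpot L)%R by rewrite /cpot !mulr_gt0//; lra.
have l0 : (0 < 2 * L + 3)%R by lra.
have lr0 : (0 < (2 * L + 3) * r)%R by rewrite mulr_gt0.
have v0' := vol_gt0 dm x lr0.
have b0 := dblc_gt0 dm (2 * L + 3).
rewrite (avg_fine r0 mu_ uM); set U := fine _.
rewrite (avgE dm)// -[X in _ * X <= _]/(osc x r u U).
pose h z := lip u z `^ p.
have h0 z : 0 <= h z by exact: poweR_ge0.
pose A := avg mu (ball x ((2 * L + 3) * r)) h.
have A0 : 0 <= A by exact: (avg_ge0 dm).
pose a := (r^-1)%:E * (((vol mu x r)^-1)%:E * osc x r u U).
have a0 : 0 <= a.
  by apply: mule_ge0; [|apply: mule_ge0; [|exact: osc_ge0]]; rewrite lee_fin invr_ge0 ltW.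
pose B := (4 * C * cpot L * dblc CD (2 * L + 3))%R.
have B0 : (0 < B)%R by rewrite /B; do 3! apply: mulr_gt0 => //.
have aA tau k : young p tau k -> a <= (6 * tau)%:E + k%:E * (B%:E * A).
  move=> yg; have [t0 k0 _] := yg.
  have [c oc] := pointwise_osc x p1 H Lu r0 yg.
  have {}oc := le_trans (osc_avg c r0 mu_ uM) (lee_wpmul2l (_ : 0 <= 2%:E) oc).
  pose I := integ mu (ball x ((2 * L + 3) * r)) h.
  have I0 : 0 <= I by exact: integ_ge0.
  pose q := (r^-1 * ((vol mu x r)^-1 * 2))%R.
  have q0 : (0 <= q)%R by rewrite !mulr_ge0// invr_ge0 ltW.
  apply: (@le_trans _ _ (q%:E * ((3 * r * tau * vol mu x r)%:E +
      (2 * k * C * (cpot L * r))%:E * I))).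
    rewrite /a /q (EFinM r^-1) -muleA; apply: lee_wpmul2l.
      by rewrite lee_fin invr_ge0 ltW.
    rewrite EFinM -muleA; apply: lee_wpmul2l; first by rewrite lee_fin invr_ge0 ltW.
    exact: oc.
  have Y0 : (0 <= 2 * k * C * (cpot L * r))%R by apply: ltW; do ! apply: mulr_gt0 => //.
  rewrite ge0_muleDr; last 2 first.
  - by rewrite lee_fin; apply: ltW; do ! apply: mulr_gt0 => //.
  - by rewrite mule_ge0.
  rewrite -EFinM muleA -EFinM (_ : q * (3 * r * tau * vol mu x r) = 6 * tau)%R; last first.
    by rewrite /q; field; rewrite !gt_eqF.
  rewrite leeD2l// /A (avgE dm)// -/I !muleA -!EFinM lee_wpmul2r// lee_fin.
  rewrite (_ : q * _ = k * (4 * C * cpot L) / vol mu x r)%R; last first.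
    by rewrite /q; field; rewrite !gt_eqF.
  have := vol_comp dm (H := 2 * L + 3) r0 lr0 (_ : mdist x x + _ <= _)%R.
  rewrite mdistxx add0r lexx => /(_ isT) vv.
  have vi : ((vol mu x r)^-1 <= dblc CD (2 * L + 3) / vol mu x ((2 * L + 3) * r))%R.
    by rewrite ler_pdivlMr// mulrC ler_pdivrMr.
  apply: (@le_trans _ _ (k * (4 * C * cpot L) * (dblc CD (2 * L + 3) /
      vol mu x ((2 * L + 3) * r)))%R).
    by rewrite ler_wpM2l//; apply: ltW; do ! apply: mulr_gt0 => //.
  by rewrite le_eqVlt; apply/orP; left; apply/eqP; rewrite /B; ring.
have ap : a `^ p <= (2 `^ p * 6 `^ (p - 1))%:E * (B%:E * A).
  by apply: poweR_optimize => //; rewrite mule_ge0// lee_fin ltW.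
have {}ap : a <= ((2 `^ p * 6 `^ (p - 1) * B) `^ p^-1)%:E * A `^ p^-1.
  have q0 : (0 <= p^-1)%R by rewrite invr_ge0 ltW.
  have := lee_poweR q0 (poweR_ge0 _ _) ap.
  rewrite -poweRrM mulfV ?gt_eqF// poweRe1// muleA -EFinM poweRM ?poweR_EFin//.
  by rewrite lee_fin mulr_ge0 ?(ltW B0)// mulr_ge0 ?powR_ge0.
have -> : ((vol mu x r)^-1)%:E * osc x r u U = r%:E * a.
  by rewrite /a muleA -EFinM divff ?gt_eqF// mul1e.
rewrite mulrC EFinM -muleA lee_pmul2l ?lte_fin//; apply: (le_trans ap).
by rewrite lee_wpmul2r ?poweR_ge0// lee_fin le_max lexx orbT.
Qed.

End LipToPoincare.

(** * The Poincare inequality for chain gradients *)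

Section Mollifier.
Context {R : realType} {X : pmetricType R}.
Implicit Types (x y z w : X) (r c : R).
Variables (mu : {sigma_finite_measure set (borel X) -> \bar R}) (CD : R).
Hypothesis dm : doubling_measure mu CD.
Variables (u : X -> R) (M s : R).
Hypothesis mu_ : measurable_fun [set: borel X] (u : borel X -> R).
Hypothesis uM : forall z, `|u z| <= M.
Hypothesis s0 : 0 < s.

Definition tent z w : R := Num.max 0 (s - mdist z w).

Let tent_ge0 z w : 0 <= tent z w.
Proof. by rewrite le_max lexx. Qed.

Let tent_le z w : tent z w <= s.
Proof. by rewrite ge_max (ltW s0) gerBl mdist_ge0. Qed.

Let tent_out z w : s <= mdist z w -> tent z w = 0.
Proof. by move=> H; rewrite /tent max_l// subr_le0. Qed.

Let tent_lip z z' w : `|tent z w - tent z' w| <= mdist z z'.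
Proof.
have := mdist_lip w z z'; rewrite !(metric_sym w) ler_norml => /andP[l1 l2].
have d0 := mdist_ge0 z z'.
rewrite /tent ler_norml; apply/andP.
by case: (lerP 0 (s - mdist z w)) => ?; case: (lerP 0 (s - mdist z' w)) => ?;
  split; lra.
Qed.

Let measurable_tent z : measurable_fun [set: borel X] (tent z : borel X -> R).
Proof.
apply: bmeas_lip; exists 1 => w w'; rewrite mul1r.
have tC v v' : tent v v' = tent v' v by rewrite /tent metric_sym.
by rewrite (tC z w) (tC z w') tent_lip.
Qed.

Let measurable_tentM z c :
  measurable_fun [set: borel X] ((fun w => tent z w * (u w - c)) : borel X -> R).
Proof.
apply: measurable_funM; first exact: measurable_tent.
by apply: measurable_funB => //; exact: measurable_cst.
Qed.

Let integrable_supp (f : X -> R) z r B : 0 < r ->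
  measurable_fun [set: borel X] (f : borel X -> R) ->
  (forall w, `|f w| <= B) -> (forall w, r <= mdist z w -> f w = 0) ->
  mu.-integrable [set: borel X] (EFin \o f).
Proof.
move=> r0 mf fB f0; apply/integrableP; split; first exact/measurable_EFinP.
apply: (@le_lt_trans _ _ (integ mu (ball z r) (fun=> B%:E))).
  rewrite [leRHS]integ_patch; apply: integ_le => w _ //=.
  rewrite patchE mem_ball; case: (ltP (mdist z w) r) => zw; first by rewrite lee_fin fB.
  by rewrite (f0 w zw) normr0.
by rewrite (integ_ball_cst dm)// ltry.
Qed.

Let integrable_tent z : mu.-integrable [set: borel X] (EFin \o tent z).
Proof.
apply: (@integrable_supp _ z s s) => // w; first by rewrite ger0_norm.
exact: tent_out.
Qed.

Let uB c w : `|u w - c| <= M + `|c|.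
Proof. by rewrite (le_trans (ler_normB _ _))// lerD2r. Qed.

Let integrable_tentM z c :
  mu.-integrable [set: borel X] (EFin \o (fun w => tent z w * (u w - c))).
Proof.
apply: (@integrable_supp _ z s (s * (M + `|c|))) => // w.
  by rewrite normrM ger0_norm// ler_pM.
by move=> H; rewrite (tent_out H) mul0r.
Qed.

Definition tent_mass z : R := \int[mu]_w tent z w.

Definition mollify z : R := (\int[mu]_w (tent z w * (u w - 0))) / tent_mass z.

Let tent_massE z : (tent_mass z)%:E = integ mu setT (EFin \o tent z).
Proof. by rewrite /tent_mass /Rintegral fineK//; apply: integrable_fin_num => //; exact: integrable_tent. Qed.

Lemma tent_mass_ge z : s / 2 * vol mu z (s / 2) <= tent_mass z.
Proof.
have s20 : 0 < s / 2 by rewrite divr_gt0.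
rewrite -lee_fin tent_massE -(integ_ball_cst dm)// integ_patch.
apply: integ_le => w _.
  by rewrite patchE; case: ifPn => // _; rewrite lee_fin ltW.
rewrite patchE mem_ball; case: ifPn => zw; last by rewrite lee_fin.
by rewrite lee_fin /tent le_max; apply/orP; right; lra.
Qed.

Lemma tent_mass_gt0 z : 0 < tent_mass z.
Proof.
have s20 : 0 < s / 2 by rewrite divr_gt0.
by apply: lt_le_trans (tent_mass_ge z); rewrite mulr_gt0// (vol_gt0 dm).
Qed.

Lemma mollifyB z c :
  (mollify z - c) * tent_mass z = \int[mu]_w (tent z w * (u w - c)).
Proof.
rewrite mulrBl divfK ?gt_eqF ?tent_mass_gt0//.
rewrite /tent_mass -(@RintegralZl _ (borel X) R mu setT (tent z) c measurableT (integrable_tent z)).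
rewrite -RintegralB//; last first.
  apply: (@integrable_supp _ z s (`|c| * s)) => // [|w|w].
  + by apply: measurable_funM; [exact: measurable_cst|exact: measurable_tent].
  + by rewrite normrM ler_wpM2l// ger0_norm.
  + by move=> H; rewrite (tent_out H) mulr0.
by apply: eq_Rintegral => w _; ring.
Qed.

Local Open Scope ereal_scope.

Let abs_Rintegral_le (f : X -> R) :
  mu.-integrable [set: borel X] (EFin \o f) ->
  (`|\int[mu]_w f w|)%:E <= integ mu setT (fun w => (`|f w|)%:E).
Proof.
move=> If; rewrite EFin_normr_Rintegral//.
exact: (le_abse_integral mu measurableT (measurable_int mu If)).
Qed.

Lemma mollify_near z c :
  (`|mollify z - c| * tent_mass z)%:E <= s%:E * osc mu z s u c.
Proof.
rewrite -[X in (_ * X)%R](gtr0_norm (tent_mass_gt0 z)) -normrM mollifyB.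
apply: (le_trans (abs_Rintegral_le (integrable_tentM z c))).
rewrite -integZ ?(ltW s0)//; [|exact: bset_ball|exact: bmeas_osc].
rewrite [leRHS]integ_patch; apply: integ_le => w _; first by rewrite lee_fin.
rewrite patchE mem_ball normrM ger0_norm//; case: ifPn => [_|].
  by rewrite -EFinM lee_fin ler_wpM2r.
by rewrite -leNgt => /tent_out ->; rewrite mul0r.
Qed.

Let mollify_diff z z' : (mdist z z' < s)%R ->
  (`|mollify z - mollify z'| * tent_mass z)%:E <=
  (mdist z z')%:E * osc mu z (2 * s) u (mollify z').
Proof.
move=> zz'; set c := mollify z'.
have S0 : (\int[mu]_w (tent z' w * (u w - c)) = 0)%R.
  by rewrite -mollifyB subrr mul0r.
rewrite -[X in (_ * X)%R](gtr0_norm (tent_mass_gt0 z)) -normrM mollifyB -[X in (`|X|)%R]subr0.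
have -> : (0 = \int[mu]_w (tent z' w * (u w - c)))%R by [].
rewrite -RintegralB//.
rewrite (@eq_Rintegral _ _ _ mu _ (fun w => (tent z w - tent z' w) * (u w - c))%R); last first.
  by move=> w _; rewrite mulrBl.
have fB w : (`|(tent z w - tent z' w) * (u w - c)| <= mdist z z' * `|u w - c|)%R.
  by rewrite normrM ler_wpM2r.
have f0 w : (2 * s <= mdist z w)%R -> ((tent z w - tent z' w) * (u w - c) = 0)%R.
  move=> zw; rewrite !tent_out ?subrr ?mul0r//; last by move: s0; lra.
  by have := metric_triangle z z' w; lra.
apply: (@le_trans _ _ (integ mu setT
    (fun w => (`|(tent z w - tent z' w) * (u w - c)|)%:E))).
  apply: abs_Rintegral_le.
  apply: (@integrable_supp _ z (2 * s)%R (mdist z z' * (M + `|c|))%R) => //.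
  - by rewrite mulr_gt0.
  - apply: measurable_funM; first by apply: measurable_funB; exact: measurable_tent.
    by apply: measurable_funB => //; exact: measurable_cst.
  - by move=> w; apply: (le_trans (fB w)); rewrite ler_wpM2l ?mdist_ge0.
rewrite -integZ ?mdist_ge0//; [|exact: bset_ball|exact: bmeas_osc].
rewrite [leRHS]integ_patch; apply: integ_le => w _; first by rewrite lee_fin.
rewrite patchE mem_ball; case: ifPn => [_|]; first by rewrite -EFinM lee_fin.
by rewrite -leNgt => /f0 ->; rewrite normr0.
Qed.

Let b := dblc CD 6.

Let bm : (0 < b)%R. Proof. rewrite /b; exact: (dblc_gt0 dm 6). Qed.

Let tent_mass_vol z z' : (mdist z z' <= s)%R ->
  (s / 2 * vol mu z (2 * s) <= b * tent_mass z')%R.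
Proof.
move=> zz'; have s20 : (0 < s / 2)%R by rewrite divr_gt0.
have s2 : (0 < 2 * s)%R by rewrite mulr_gt0.
have vv : (vol mu z (2 * s) <= b * vol mu z' (s / 2))%R.
  by apply: (vol_comp dm) => //; rewrite metric_sym; move: zz'; lra.
apply: (@le_trans _ _ (s / 2 * (b * vol mu z' (s / 2)))%R).
  by rewrite ler_pM2l.
by rewrite mulrCA ler_pM2l ?tent_mass_ge.
Qed.

Let osc_shift z c c' r : (0 < r)%R ->
  osc mu z r u c' <= osc mu z r u c + (`|c' - c| * vol mu z r)%:E.
Proof.
move=> r0; rewrite -(integ_ball_cst dm)// -integD//.
- apply: integ_le => w _; first by rewrite lee_fin.
  rewrite -EFinD lee_fin (distrC c').
  by have := ler_normD (u w - c)%R (c - c')%R; rewrite subrKA.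
- exact: bset_ball.
- exact: bmeas_osc.
- exact: bmeas_cst.
Qed.

Let osc_sub z z' r r' c : ball z' r' `<=` ball z r -> osc mu z' r' u c <= osc mu z r u c.
Proof. by move=> sub; apply: integ_sub => // w _; rewrite lee_fin. Qed.

(** The increment is first estimated with the constant [mollify z']: the difference of
  [u] with it integrates to zero against [tent z'], so only the variation of the tents
  counts. The oscillation also controls the distance of [mollify z'] from any other
  constant [c]. *)
Lemma mollify_lip z z' c : (mdist z z' < s)%R ->
  (`|mollify z - mollify z'| * (s * vol mu z (2 * s)))%:E <=
  (2 * b * (1 + 2 * b) * mdist z z')%:E * osc mu z (2 * s) u c.
Proof.
move=> zz'; have s2 : (0 < 2 * s)%R by rewrite mulr_gt0.
pose O := osc mu z (2 * s) u c; have O0 : 0 <= O by exact: osc_ge0.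
have v0 := vol_gt0 dm z s2.
have h1 : (s / 2 * (`|mollify z' - c| * vol mu z (2 * s)))%:E <= (b * s)%:E * O.
  apply: (@le_trans _ _ (b%:E * (`|mollify z' - c| * tent_mass z')%:E)).
    rewrite -EFinM lee_fin mulrCA [leRHS]mulrCA ler_wpM2l//.
    by apply: tent_mass_vol; exact: ltW.
  rewrite [X in _ <= X * _]EFinM -muleA lee_pmul2l ?lte_fin//.
  apply: (le_trans (mollify_near z' c)).
  rewrite lee_pmul2l ?lte_fin//; apply: osc_sub.
  by apply: ball_sub; move: zz'; lra.
have h2 : osc mu z (2 * s) u (mollify z') <= (1 + 2 * b)%:E * O.
  apply: (le_trans (osc_shift z c (mollify z') s2)).
  rewrite EFinD ge0_muleDl ?lee_fin ?mulr_ge0 ?(ltW bm)// mul1e leeD2l//.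
  have {}h1 : (2 / s)%:E * (s / 2 * (`|mollify z' - c| * vol mu z (2 * s)))%:E <=
      (2 / s)%:E * ((b * s)%:E * O).
    by rewrite lee_pmul2l// lte_fin divr_gt0.
  move: h1; rewrite muleA -!EFinM mulrA.
  have -> : (2 / s * (s / 2) = 1)%R by field; rewrite gt_eqF.
  have -> : (2 / s * (b * s) = 2 * b)%R by field; rewrite gt_eqF.
  by rewrite mul1r.
have h3 := le_trans (mollify_diff zz') (lee_wpmul2l (_ : 0 <= (mdist z z')%:E) h2).
have {}h3 := h3 (mdist_ge0 z z').
apply: (@le_trans _ _ ((2 * b)%:E * (`|mollify z - mollify z'| * tent_mass z)%:E)).
  rewrite -EFinM lee_fin mulrCA [leRHS]mulrCA [leLHS]mulrCA ler_wpM2l//.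
  have := @tent_mass_vol z z; rewrite mdistxx (ltW s0) => /(_ isT); lra.
apply: (le_trans (lee_wpmul2l (_ : 0 <= (2 * b)%:E) h3)).
  by rewrite lee_fin mulr_ge0// ltW.
rewrite !muleA -!EFinM le_eqVlt; apply/orP; left; apply/eqP.
by congr (_%:E * _); ring.
Qed.

Let M0 : (0 <= M)%R.
Proof. exact: le_trans (normr_ge0 _) (uM point). Qed.

Let osc0_le z r : (0 < r)%R -> osc mu z r u 0 <= (M * vol mu z r)%:E.
Proof.
move=> r0; rewrite -(integ_ball_cst dm)//; apply: integ_le => w _.
  by rewrite lee_fin.
by rewrite lee_fin subr0.
Qed.

Let tent_mass_vol_self z : (s * vol mu z s <= 2 * b * tent_mass z)%R.
Proof.
have s2 : (0 < 2 * s)%R by rewrite mulr_gt0.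
have := @tent_mass_vol z z; rewrite mdistxx (ltW s0) => /(_ isT).
have : (vol mu z s <= vol mu z (2 * s))%R.
  by apply: (vol_le dm) => //; apply: ball_sub; rewrite mdistxx; move: s0; lra.
rewrite -(ler_pM2l s0); lra.
Qed.

Let mollify_bound z : (`|mollify z| <= 2 * b * M)%R.
Proof.
have v0 := vol_gt0 dm z s0; have m0 := tent_mass_gt0 z.
have : (`|mollify z| * tent_mass z <= s * (M * vol mu z s))%R.
  rewrite -lee_fin; have := mollify_near z 0; rewrite subr0 => /le_trans; apply.
  by rewrite EFinM lee_pmul2l ?lte_fin// osc0_le.
move=> H; rewrite -(ler_pM2r m0); apply: (le_trans H).
have -> : (s * (M * vol mu z s) = M * (s * vol mu z s))%R by ring.
have -> : (2 * b * M * tent_mass z = M * (2 * b * tent_mass z))%R by ring.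
by rewrite ler_wpM2l// tent_mass_vol_self.
Qed.

Lemma Lip_mollify : Lip mollify.
Proof.
have b0 := bm.
exists ((2 * b * (1 + 2 * b) * M + 4 * b * M) / s)%R => z z'.
have d0 := mdist_ge0 z z'.
have c1 : (0 <= 2 * b * (1 + 2 * b) * M)%R by rewrite !mulr_ge0 ?addr_ge0 ?mulr_ge0// ltW.
have c2 : (0 <= 4 * b * M)%R by rewrite !mulr_ge0// ltW.
rewrite mulrAC ler_pdivlMr//; have [zz'|zz'] := ltP (mdist z z') s.
  have s2 : (0 < 2 * s)%R by rewrite mulr_gt0.
  have v0 := vol_gt0 dm z s2.
  have : (`|mollify z - mollify z'| * (s * vol mu z (2 * s)) <=
      2 * b * (1 + 2 * b) * mdist z z' * (M * vol mu z (2 * s)))%R.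
    rewrite -lee_fin; apply: (le_trans (mollify_lip 0 zz')).
    rewrite [leRHS]EFinM lee_wpmul2l ?osc0_le// lee_fin mulr_ge0//.
    by rewrite !mulr_ge0 ?addr_ge0 ?mulr_ge0// ltW.
  rewrite [leLHS]mulrA [leRHS]mulrA ler_pM2r// => /le_trans; apply.
  by rewrite mulrAC ler_wpM2r// lerDl.
apply: (@le_trans _ _ (4 * b * M * s)%R).
  rewrite ler_wpM2r ?(ltW s0)//; apply: (le_trans (ler_normB _ _)).
  by have := mollify_bound z; have := mollify_bound z'; lra.
apply: (@le_trans _ _ (4 * b * M * mdist z z')%R); first by rewrite ler_wpM2l.
by rewrite ler_wpM2r// lerDr.
Qed.

Variable g : X -> \bar R.
Hypothesis mg : bmeas g.
Hypothesis g0 : forall z, 0 <= g z.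
Hypothesis ug : forall z w, (mdist z w < 4 * s)%R ->
  (`|u z - u w|)%:E <= (g z + g w) * (mdist z w)%:E.

(** On a ball smaller than the length of the chains the two-point inequality applies to
  all pairs; the constant is [u w] for a point [w] where [g] does not exceed its average. *)
Lemma osc_small z r (eta : R) : (0 < r)%R -> (r <= 2 * s)%R -> (0 < eta)%R ->
  exists c, osc mu z r u c <= (4 * r)%:E * integ mu (ball z r) g + eta%:E.
Proof.
move=> r0 rs eta0; have v0 := vol_gt0 dm z r0; have mB := bset_ball z r.
have e0 : (0 < eta / (2 * r))%R by rewrite divr_gt0// mulr_gt0.
have [w Bw gw] := exists_le_average mB (mu_ball dm z r0) v0 e0 (fun z _ => g0 z).
exists (u w); set I := integ mu (ball z r) g.
have I0 : 0 <= I by exact: integ_ge0.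
apply: (@le_trans _ _ (integ mu (ball z r) (fun y => (2 * r)%:E * (g y + g w)))).
  apply: integ_le => y By; first by rewrite lee_fin.
  move: Bw By; rewrite !in_ball => Bw By.
  have yw : (mdist y w < 2 * r)%R.
    by have := metric_triangle y z w; rewrite (metric_sym y z); lra.
  apply: (le_trans (ug _)); first by move: yw rs; lra.
  by rewrite muleC lee_wpmul2r ?adde_ge0// lee_fin ltW.
rewrite integZ//; last 3 first.
- by apply: bmeasD => //; exact: bmeas_cst.
- by rewrite mulr_ge0// ltW.
- by move=> *; exact: adde_ge0.
rewrite integD//; last exact: bmeas_cst.
have -> : integ mu (ball z r) (fun=> g w) = (vol mu z r)%:E * g w.
  rewrite /integ integral_cst// muleC; congr (_ * _).
  exact: (mu_ball dm).
apply: (@le_trans _ _ ((2 * r)%:E * (I + (I + (eta / (2 * r))%:E)))).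
  by rewrite lee_pmul2l ?lte_fin ?mulr_gt0// leeD2l.
have eE : 0 <= (eta / (2 * r))%:E by rewrite lee_fin ltW.
rewrite (ge0_muleDr _ I0 (adde_ge0 I0 eE)) (ge0_muleDr _ I0 eE) addeA.
rewrite -[(2 * r)%:E * (eta / (2 * r))%:E]EFinM.
rewrite (_ : 2 * r * (eta / (2 * r)) = eta)%R; last by field; rewrite gt_eqF.
rewrite leeD2r// (_ : 4 * r = 2 * r + 2 * r)%R; last by ring.
by rewrite EFinD ge0_muleDl// lee_fin mulr_ge0// ltW.
Qed.

Lemma lip_mollify z :
  lip mollify z <= (16 * b * (1 + 2 * b))%:E * avg mu (ball z (2 * s)) g.
Proof.
have s2 : (0 < 2 * s)%R by rewrite mulr_gt0.
have v0 := vol_gt0 dm z s2; have b0 := bm.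
have K0 : (0 < 16 * b * (1 + 2 * b))%R by rewrite !mulr_gt0// addr_gt0// mulr_gt0.
have A0 : 0 <= avg mu (ball z (2 * s)) g by exact: (avg_ge0 dm).
apply: (lip_le s0); first by rewrite mule_ge0// lee_fin ltW.
move=> y; rewrite in_ball => zy.
have [d0|d0] := leP (mdist z y) 0%R.
  by have /mdist_positivity -> := mdist_le0 d0; rewrite subrr normr0 mdistxx mule0.
rewrite (avgE dm)//; set I := integ mu _ _.
have I0 : 0 <= I by exact: integ_ge0.
case: (I =P +oo) => [->|/eqP Ioo].
  by rewrite !gt0_muley ?lte_fin ?invr_gt0// gt0_mulye ?lte_fin// leey.
have [J IE] : exists J : R, I = J%:E.
  by exists (fine I); rewrite fineK// ge0_fin_numE// lt_neqAle leey Ioo.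
have main : (`|mollify z - mollify y| * (s * vol mu z (2 * s)) <=
    2 * b * (1 + 2 * b) * mdist z y * (8 * s * J))%R.
  apply/ler_addgt0Pr => e e0.
  have q0 : (0 < 2 * b * (1 + 2 * b) * mdist z y)%R.
    by rewrite !mulr_gt0// addr_gt0// mulr_gt0.
  have eta0 : (0 < e / (2 * b * (1 + 2 * b) * mdist z y))%R by rewrite divr_gt0.
  have [c oc] := osc_small z s2 (lexx _) eta0.
  have := le_trans (mollify_lip c zy) (lee_wpmul2l (_ : 0 <= _%:E) oc).
  rewrite -/I IE -[(4 * (2 * s))%:E * J%:E]EFinM -EFinD -EFinM !lee_fin => /(_ (ltW q0)) /le_trans; apply.
  move: q0; move: (2 * b * (1 + 2 * b) * mdist z y)%R => q q0.
  by rewrite le_eqVlt; apply/orP; left; apply/eqP; field; rewrite gt_eqF.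
rewrite IE -!EFinM lee_fin distrC.
rewrite -(ler_pM2r (_ : 0 < s * vol mu z (2 * s))%R) ?mulr_gt0//.
apply: (le_trans main); rewrite le_eqVlt; apply/orP; left; apply/eqP; field.
by rewrite gt_eqF.
Qed.

Lemma dist_mollify z :
  (`|u z - mollify z|)%:E <= (2 * b * s)%:E * (avg mu (ball z s) g + g z).
Proof.
have v0 := vol_gt0 dm z s0; have b0 := bm; have m0 := tent_mass_gt0 z.
have A0 : 0 <= avg mu (ball z s) g by exact: (avg_ge0 dm).
have h1 : osc mu z s u (u z) <= s%:E * (integ mu (ball z s) g + g z * (vol mu z s)%:E).
  apply: (@le_trans _ _ (integ mu (ball z s) (fun w => s%:E * (g w + g z)))).
    apply: integ_le => w; first by rewrite lee_fin.
    rewrite in_ball => zw; have s4 : (mdist w z < 4 * s)%R.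
      by rewrite metric_sym; move: zw s0; lra.
    apply: (le_trans (ug s4)); rewrite muleC lee_wpmul2r ?adde_ge0// lee_fin.
    by rewrite metric_sym ltW.
  rewrite integZ//; last 4 first.
  - exact: bset_ball.
  - by apply: bmeasD => //; exact: bmeas_cst.
  - exact: ltW.
  - by move=> *; exact: adde_ge0.
  rewrite integD//; [|exact: bset_ball|exact: bmeas_cst].
  rewrite [X in _ * (_ + X)](_ : _ = g z * (vol mu z s)%:E)//.
  rewrite /integ integral_cst; last exact: bset_ball.
  by congr (_ * _); exact: (mu_ball dm).
have h2 := le_trans (mollify_near z (u z)) (lee_wpmul2l (_ : 0 <= s%:E) h1).
have {}h2 := h2 (ltW s0).
have gv : g z * (vol mu z s)%:E + integ mu (ball z s) g =
    (vol mu z s)%:E * (avg mu (ball z s) g + g z).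
  rewrite (avgE dm)// ge0_muleDr//; last first.
    by rewrite mule_ge0 ?integ_ge0// lee_fin invr_ge0 ltW.
  by rewrite muleA -EFinM divff ?gt_eqF// mul1e addeC (muleC (g z)).
move: h2; rewrite addeC gv; set Y := _ + g z.
have Y0 : 0 <= Y by exact: adde_ge0.
case: (Y =P +oo) => [-> _|/eqP Yoo].
  by rewrite gt0_muley ?leey// lte_fin !mulr_gt0.
have [J YE] : exists J : R, Y = J%:E.
  by exists (fine Y); rewrite fineK// ge0_fin_numE// lt_neqAle leey Yoo.
have J0 : (0 <= J)%R by move: Y0; rewrite YE lee_fin.
rewrite YE -!EFinM !lee_fin => H; rewrite (distrC (u z)) -(ler_pM2r m0).
apply: (le_trans H).
have -> : (s * (s * (vol mu z s * J)) = s * J * (s * vol mu z s))%R by ring.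
have -> : (2 * b * s * J * tent_mass z = s * J * (2 * b * tent_mass z))%R by ring.
by rewrite ler_wpM2l ?tent_mass_vol_self// mulr_ge0// ltW.
Qed.

End Mollifier.

Section ChainPoincare.
Context {R : realType} {X : pmetricType R}.
Implicit Types (x y z w : X) (r c : R).
Variables (mu : {sigma_finite_measure set (borel X) -> \bar R}) (CD : R).
Hypothesis dm : doubling_measure mu CD.
Variables (p C lam : R).
Hypothesis p1 : 1 <= p.
Hypothesis HP : poincare_lip p mu C lam.
Local Open Scope ereal_scope.

Let p0 : (0 < p)%R. Proof. by rewrite (lt_le_trans _ p1). Qed.

Lemma integ_young D (g : X -> \bar R) tau k : young p tau k -> bset D ->
  bmeas g -> (forall z, 0 <= g z) ->
  integ mu D g <= tau%:E * mu D + k%:E * integ mu D (fun z => g z `^ p).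
Proof.
move=> yg mD mg g0; have [t0 k0 _] := yg.
have gp0 z : 0 <= g z `^ p by exact: poweR_ge0.
rewrite -integZ ?(ltW k0)//; last exact: bmeas_poweR.
rewrite -integ_cst// -integD//.
- by apply: integ_le => // z _; exact: young_poweR.
- exact: bmeas_cst.
- by apply: bmeasZ; exact: bmeas_poweR.
- by move=> z _; rewrite lee_fin ltW.
- by move=> z _; rewrite mule_ge0// lee_fin ltW.
Qed.

(** Jensen's inequality, with a loss of [2 `^ p]. *)
Lemma avg_poweR_le z r (g : X -> \bar R) : (0 < r)%R ->
  bmeas g -> (forall z, 0 <= g z) ->
  avg mu (ball z r) g `^ p <= (2 `^ p)%:E * avg mu (ball z r) (fun z => g z `^ p).
Proof.
move=> r0 mg g0; have v0 := vol_gt0 dm z r0.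
have A0 : 0 <= avg mu (ball z r) g by exact: (avg_ge0 dm).
have Ap0 : 0 <= avg mu (ball z r) (fun z => g z `^ p).
  by apply: (avg_ge0 dm) => // w; exact: poweR_ge0.
have := poweR_optimize p1 A0 ltr01 Ap0; rewrite powR1 mulr1; apply.
move=> tau k yg; rewrite !(avgE dm)// mul1r.
have := integ_young yg (bset_ball z r) mg g0.
rewrite (_ : mu _ = (vol mu z r)%:E); last exact: (mu_ball dm).
have [t0 k0 _] := yg.
move=> /(lee_wpmul2l (_ : 0 <= ((vol mu z r)^-1)%:E)) => /(_ _)/le_trans; apply.
  by rewrite lee_fin invr_ge0 ltW.
rewrite ge0_muleDr; last 2 first.
- by rewrite -EFinM lee_fin mulr_ge0// ltW.
- by rewrite mule_ge0 ?integ_ge0// ?lee_fin ?ltW// => w _; exact: poweR_ge0.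
by rewrite -!EFinM mulrCA mulVf ?gt_eqF// mulr1 leeD2l// muleCA lexx.
Qed.

(** The [p]-th root on the right-hand side is linearized by [young_root]. *)
Lemma poincare_linear (u : X -> R) (h : X -> \bar R) x r tau k :
  Lip u -> (0 < r)%R -> young p tau k ->
  (forall z, ball x (lam * r) z -> lip u z <= h z) ->
  exists c, osc mu x r u c <= (C * r * (tau * vol mu x r))%:E +
    (C * r * k)%:E * integ mu (ball x (lam * r)) (fun z => h z `^ p).
Proof.
move=> Lu r0 yg lh; have [C1 lam1 P] := HP; have [t0 k0 _] := yg.
have [M uM] := Lip_bounded x r Lu; have mu_ := bmeas_lip Lu.
have v0 := vol_gt0 dm x r0.
have lr0 : (0 < lam * r)%R by rewrite mulr_gt0// (lt_le_trans _ lam1).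
have v0' := vol_gt0 dm x lr0.
have vv : (vol mu x r <= vol mu x (lam * r))%R.
  by apply: (vol_le dm) => //; apply: ball_sub; rewrite mdistxx add0r ler_peMl// ltW.
have := P u (lip u) (conj Lu erefl) x r r0.
rewrite (avg_fine dm r0 mu_ uM); set U := fine _; exists U.
have Cr0 : (0 < C * r)%R by rewrite mulr_gt0// (lt_le_trans _ C1).
set I := integ mu _ (fun z => h z `^ p).
have lp0 z : 0 <= lip u z `^ p by exact: poweR_ge0.
have A0 : 0 <= avg mu (ball x (lam * r)) (fun z => lip u z `^ p) by exact: (avg_ge0 dm).
have yr := young_root p1 yg A0.
have := le_trans (P u (lip u) (conj Lu erefl) x r r0) (lee_wpmul2l (_ : 0 <= (C * r)%:E) yr).
move=> /(_ (ltW Cr0)).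
rewrite (avg_fine dm r0 mu_ uM) -/U !(avgE dm)// -[X in _ * X <= _]/(osc mu x r u U).
move=> /(lee_wpmul2l (_ : 0 <= (vol mu x r)%:E)) => /(_ (ltW v0)).
rewrite [leLHS]muleA -[X in X * _ <= _]EFinM divff ?gt_eqF// mul1e => /le_trans; apply.
rewrite muleA -EFinM ge0_muleDr; last 2 first.
- by rewrite lee_fin ltW.
- by rewrite !mule_ge0 ?integ_ge0// lee_fin ?invr_ge0 ltW.
rewrite -EFinM (_ : vol mu x r * (C * r) * tau = C * r * (tau * vol mu x r))%R; last by ring.
rewrite leeD2l// !muleA -!EFinM.
apply: (@le_trans _ _ ((C * r * k)%:E * integ mu (ball x (lam * r)) (fun z => lip u z `^ p))).
  rewrite lee_wpmul2r ?integ_ge0// lee_fin.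
  rewrite (_ : _ / _ = C * r * k * (vol mu x r / vol mu x (lam * r)))%R; last by ring.
  by rewrite ler_piMr ?ler_pdivrMr ?mul1r// mulr_ge0 ?(ltW k0)// ltW.
rewrite lee_wpmul2l//; first by rewrite lee_fin mulr_ge0// ltW.
apply: integ_le => // z xz; apply: (lee_poweR (ltW p0) (lip_ge0 _ _)); exact: lh.
Qed.

Let b := dblc CD 6.
Let cm : R := (16 * b * (1 + 2 * b))%R.
Let d2 := dblc CD 2.

Definition chain_const : R :=
  (5 + b * (d2 + 1) * d2 + C + C * cm `^ p * 2 `^ p * d2)%R.

Variables (u : X -> R) (M eps : R) (g : X -> \bar R).
Hypothesis mu_ : measurable_fun [set: borel X] (u : borel X -> R).
Hypothesis uM : forall z, (`|u z| <= M)%R.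
Hypothesis eps0 : (0 < eps)%R.
Hypothesis mg : bmeas g.
Hypothesis g0 : forall z, 0 <= g z.
Hypothesis ug : forall z w, (mdist z w < eps)%R ->
  (`|u z - u w|)%:E <= (g z + g w) * (mdist z w)%:E.

(** The mollification at a scale comparable with [eps] is used when the radius is larger
  than that scale: its slope is controlled by averages of [g], and its distance to [u]
  by [g] itself. *)
Lemma chain_poincare x r tau k : (0 < r)%R -> young p tau k ->
  exists c, osc mu x r u c <= (chain_const * r)%:E *
    ((tau * vol mu x r)%:E +
     k%:E * integ mu (ball x ((lam + 1) * r)) (fun z => g z `^ p)).
Proof.
move=> r0 yg; have [t0 k0 _] := yg; have [C1 lam1 _] := HP.
have v0 := vol_gt0 dm x r0.
have b0 : (0 < b)%R by rewrite /b; exact: (dblc_gt0 dm 6).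
have d20 : (0 < d2)%R by rewrite /d2; exact: (dblc_gt0 dm 2).
have d21 : (1 <= d2)%R by rewrite /d2; exact: (dblc_ge1 dm 2).
have cm0 : (0 < cm)%R by rewrite /cm !mulr_gt0// addr_gt0// mulr_gt0.
have C0 : (0 < C)%R by rewrite (lt_le_trans _ C1).
pose s : R := (eps / 4)%R.
have s0 : (0 < s)%R by rewrite divr_gt0.
have s4 : (4 * s = eps)%R by rewrite /s; field.
have ug4 z w : (mdist z w < 4 * s)%R ->
    (`|u z - u w|)%:E <= (g z + g w) * (mdist z w)%:E by rewrite s4; exact: ug.
have gp0 z : 0 <= g z `^ p by exact: poweR_ge0.
have mgp : bmeas (fun z => g z `^ p) by exact: bmeas_poweR.
set I := integ mu _ (fun z => g z `^ p).
have I0 : 0 <= I by exact: integ_ge0.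
have tV0 : (0 <= tau * vol mu x r)%R by rewrite mulr_ge0 ?ltW.
pose S := (tau * vol mu x r)%:E + k%:E * I.
have kI0 : 0 <= k%:E * I by apply: mule_ge0 => //; rewrite lee_fin ltW.
have tVE0 : 0 <= (tau * vol mu x r)%:E by rewrite lee_fin.
have S0 : 0 <= S by exact: adde_ge0.
have gI (D : set X) (m : R) : bset D -> mu D = m%:E -> (m <= d2 * vol mu x r)%R ->
    D `<=` ball x ((lam + 1) * r) -> integ mu D g <= d2%:E * S.
  move=> mD Dm mle DB; apply: (le_trans (integ_young yg mD mg g0)).
  rewrite Dm -EFinM /S (ge0_muleDr _ tVE0 kI0).
  apply: leeD; first by rewrite -EFinM lee_fin mulrCA ler_wpM2l// ltW.
  apply: (@le_trans _ _ (k%:E * I)).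
    by rewrite lee_wpmul2l ?lee_fin ?(ltW k0)//; exact: integ_sub.
  by rewrite lee_pemull// lee_fin.
have cc0 : (0 <= b * (d2 + 1) * d2)%R by rewrite !mulr_ge0 ?addr_ge0// ltW.
have ccC : (0 <= C * cm `^ p * 2 `^ p * d2)%R by rewrite !mulr_ge0 ?powR_ge0// ltW.
have [rs|rs] := leP r (2 * s)%R.
  have eta0 : (0 < r * (tau * vol mu x r))%R by rewrite !mulr_gt0.
  have [c oc] := osc_small dm mg g0 ug4 x r0 rs eta0.
  exists c; apply: (le_trans oc).
  apply: (@le_trans _ _ ((4 * r)%:E * S + r%:E * S)).
    apply: leeD; last first.
      by rewrite EFinM lee_pmul2l ?lte_fin// /S leeDl.
    rewrite lee_pmul2l ?lte_fin ?mulr_gt0//.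
    apply: (le_trans (integ_young yg (bset_ball x r) mg g0)).
    rewrite (_ : mu _ = (vol mu x r)%:E); last exact: (mu_ball dm).
    rewrite -EFinM /S leeD2l// lee_wpmul2l ?lee_fin ?(ltW k0)//.
    apply: integ_sub => //; apply: ball_sub; rewrite mdistxx add0r.
    by rewrite ler_peMl// ?ltW//; move: lam1; lra.
  rewrite -ge0_muleDl ?lee_fin ?mulr_ge0 ?(ltW r0)// lee_wpmul2r//.
  rewrite -EFinD lee_fin -[X in (_ + X <= _)%R]mul1r -mulrDl ler_wpM2r ?(ltW r0)//.
  by rewrite /chain_const; move: cc0 ccC C0; lra.
have s2 : (0 < 2 * s)%R by rewrite mulr_gt0.
have r20 : (0 < 2 * r)%R by rewrite mulr_gt0.
have lr0 : (0 < lam * r)%R by rewrite mulr_gt0//; lra.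
pose v := mollify mu u s.
have lv z : lip v z <= cm%:E * avg mu (ball z (2 * s)) g.
  exact: (lip_mollify dm mu_ uM s0 mg g0 ug4 z).
have Lv : Lip v := Lip_mollify dm mu_ uM s0.
have [c oc] := @poincare_linear v (fun z => cm%:E * avg mu (ball z (2 * s)) g) x r
  tau k Lv r0 yg (fun z _ => lv z).
have v2 : (vol mu x (2 * r) <= d2 * vol mu x r)%R.
  by apply: (vol_comp dm) => //; rewrite mdistxx add0r.
have B2 : ball x (2 * r) `<=` ball x ((lam + 1) * r).
  by apply: ball_sub; rewrite mdistxx add0r ler_pM2r//; lra.
have mB2 : mu (ball x (2 * r)) = (vol mu x (2 * r))%:E by exact: (mu_ball dm).
have g2 := gI _ _ (bset_ball x (2 * r)) mB2 v2 B2.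
have first_part : integ mu (ball x r) (fun z => (`|u z - v z|)%:E) <=
    (b * (d2 + 1) * d2 * r)%:E * S.
  apply: (@le_trans _ _ (integ mu (ball x r)
      (fun z => (2 * b * s)%:E * (avg mu (ball z s) g + g z)))).
    apply: integ_le => z _; first by rewrite lee_fin.
    exact: (dist_mollify dm mu_ uM s0 mg g0 ug4 z).
  have mavg : bmeas (fun z => avg mu (ball z s) g) by exact: (bmeas_avg dm).
  have avg0 z : 0 <= avg mu (ball z s) g by exact: (avg_ge0 dm).
  rewrite integZ//; last 4 first.
  - exact: bset_ball.
  - exact: bmeasD.
  - by rewrite !mulr_ge0// ltW.
  - by move=> z _; exact: adde_ge0.
  rewrite integD//; last exact: bset_ball.
  apply: (@le_trans _ _ ((2 * b * s)%:E * ((d2 + 1)%:E * (d2%:E * S)))).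
    rewrite lee_wpmul2l//; first by rewrite lee_fin !mulr_ge0// ltW.
    rewrite EFinD [leRHS]ge0_muleDl ?lee_fin ?(ltW d20)// mul1e; apply: leeD.
      apply: le_trans (_ : d2%:E * integ mu (ball x (2 * r)) g <= _).
        apply: (integ_avg_le dm) => //; [exact: bset_ball..|].
        move=> z; rewrite in_ball => xz; apply: ball_sub.
        by move: xz rs s0; lra.
      by rewrite lee_pmul2l ?lte_fin.
    apply: le_trans g2; apply: integ_sub => //; apply: ball_sub.
    by rewrite mdistxx; move: r0; lra.
  rewrite !muleA -!EFinM lee_wpmul2r// lee_fin.
  have -> : (2 * b * s * (d2 + 1) * d2 = b * (d2 + 1) * d2 * (2 * s))%R by ring.
  by rewrite ler_wpM2l// ltW.
have second_part : osc mu x r v c <= ((C + C * cm `^ p * 2 `^ p * d2) * r)%:E * S.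
  apply: (le_trans oc).
  apply: (@le_trans _ _ ((C * r)%:E * (tau * vol mu x r)%:E +
      (C * r)%:E * ((cm `^ p * 2 `^ p * d2)%:E * (k%:E * I)))).
    rewrite -EFinM leeD2l// (EFinM _ k) -muleA lee_wpmul2l ?lee_fin ?mulr_ge0 ?(ltW r0) ?(ltW C0)//.
    rewrite muleCA lee_wpmul2l ?lee_fin ?(ltW k0)//.
    apply: (@le_trans _ _ (integ mu (ball x (lam * r)) (fun z =>
        (cm `^ p * 2 `^ p)%:E * avg mu (ball z (2 * s)) (fun z => g z `^ p)))).
      apply: integ_le => z _; first exact: poweR_ge0.
      rewrite poweRM ?lee_fin ?(ltW cm0)//; last exact: (avg_ge0 dm).
      rewrite poweR_EFin EFinM -muleA lee_wpmul2l ?lee_fin ?powR_ge0//.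
      exact: avg_poweR_le.
    rewrite integZ//; last 4 first.
    - exact: bset_ball.
    - exact: (bmeas_avg dm).
    - by rewrite mulr_ge0 ?powR_ge0.
    - by move=> z _; exact: (avg_ge0 dm).
    rewrite [X in _ <= X * _]EFinM -muleA lee_wpmul2l ?lee_fin ?mulr_ge0 ?powR_ge0//.
    apply: (integ_avg_le dm) => //; [exact: bset_ball..|].
    move=> z; rewrite in_ball => xz; apply: ball_sub.
    by move: xz rs; rewrite mulrDl mul1r; lra.
  have -> : ((C + C * cm `^ p * 2 `^ p * d2) * r =
    C * r + C * r * (cm `^ p * 2 `^ p * d2))%R by ring.
  have D0 : (0 <= cm `^ p * 2 `^ p * d2)%R by rewrite !mulr_ge0 ?powR_ge0// ltW.
  have Cr0 : (0 <= C * r)%R by rewrite mulr_ge0// ltW.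
  have CrD0 : (0 <= C * r * (cm `^ p * 2 `^ p * d2))%R by exact: mulr_ge0.
  rewrite [X in _ <= X * _]EFinD [leRHS]ge0_muleDl ?lee_fin//; apply: leeD.
    by rewrite lee_wpmul2l ?lee_fin// /S leeDl.
  rewrite [X in _ <= X * _]EFinM -muleA lee_wpmul2l ?lee_fin// lee_wpmul2l ?lee_fin//.
  by rewrite /S leeDr.
exists c.
apply: (@le_trans _ _ (integ mu (ball x r) (fun z => (`|u z - v z|)%:E) + osc mu x r v c)).
  have mv := bmeas_lip Lv.
  rewrite -integD//; last 3 first.
  - exact: bset_ball.
  - apply/measurable_EFinP; apply: measurableT_comp => //.
    exact: measurable_funB.
  - exact: bmeas_osc.
  apply: integ_le => z _; first by rewrite lee_fin.
  rewrite -EFinD lee_fin.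
  by have := ler_normD (u z - v z)%R (v z - c)%R; rewrite subrKA.
apply: (le_trans (leeD first_part second_part)).
rewrite -ge0_muleDl; [|by rewrite lee_fin mulr_ge0// ltW|]; last first.
  by rewrite lee_fin mulr_ge0// ?(ltW r0)// addr_ge0// ltW.
rewrite lee_wpmul2r// -EFinD lee_fin -mulrDl ler_wpM2r ?(ltW r0)//.
by rewrite /chain_const; lra.
Qed.

End ChainPoincare.

(** * Chains of balls *)

Section WellChained.
Context {R : realType} {X : pmetricType R}.
Implicit Types (x y z w : X) (r c d e : R).
Variables (mu : {sigma_finite_measure set (borel X) -> \bar R}) (CD : R).
Hypothesis dm : doubling_measure mu CD.

Definition chain_in (A T : set X) (delta : R) y (q : nat -> X) N :=
  [/\ q 0%N = y, T (q N), is_chain delta q N & forall i, (i <= N)%N -> A (q i)].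

Lemma chain_rcons A delta y z z' q N : A z' -> mdist z z' <= delta ->
  chain_in A [set z] delta y q N -> exists q', chain_in A [set z'] delta y q' N.+1.
Proof.
move=> Az' zz' [q0 /= qN qc qA].
exists (fun i => if (i <= N)%N then q i else z'); split => //=.
- by rewrite ltnn.
- move=> i; rewrite ltnS => iN; rewrite iN; case: (ltnP i N) => [iN'|Ni].
    exact: qc.
  by have -> : i = N; [apply/eqP; rewrite eqn_leq iN|rewrite qN].
- by move=> i iN; case: leqP => [iN'|_] //; exact: qA.
Qed.

Lemma osc_point x r u c w e : 0 < e -> ball w e `<=` ball x r ->
  (forall z, ball w e z -> u z = u w) ->
  ((`|u w - c| * vol mu w e)%:E <= osc mu x r u c)%E.
Proof.
move=> e0 sub uw; rewrite -(integ_ball_cst dm)//.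
apply: integ_mono => [z _|z _|z wz]; rewrite ?lee_fin//.
by split; [exact: sub|rewrite uw].
Qed.

Variables (p C lam : R).
Hypothesis p1 : 1 <= p.
Hypothesis HP : poincare_lip p mu C lam.

(** The indicator of the points reached by chains, cut off outside a large ball, is
  Lipschitz and has zero slope in a smaller one, hence is constant there. *)
Lemma well_chained x y delta : 0 < delta -> x != y ->
  exists q N, chain_in (ball x ((2 * lam + 1) * mdist x y)) [set x] delta y q N.
Proof.
move=> delta0 xy; set d := mdist x y; have d0 : 0 < d by rewrite mdist_gt0.
have [C1 lam1 _] := HP; have p0 : 0 < p by rewrite (lt_le_trans _ p1).
pose A := ball x ((2 * lam + 1) * d).
pose U z := exists q N, chain_in A [set z] delta y q N.
have UA z : U z -> A z by move=> [q [N [_ /= <- _ H]]]; exact: H.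
have Ay : A y by rewrite /A in_ball -/d; nra.
have Uy : U y.
  by exists (fun=> y), 0%N; split => // i; rewrite ?mdistxx ?ltW// => _.
have Uext z z' : mdist z z' <= delta -> A z' -> U z -> U z'.
  by move=> zz' Az' [q [N qN]]; have [q' qN'] := chain_rcons Az' zz' qN; exists q', N.+1.
pose phi z : R := Num.min 1 (Num.max 0 ((2 * lam + 1) - mdist x z / d)).
have phi_lip z z' : `|phi z - phi z'| <= mdist z z' / d.
  have : `|mdist x z / d - mdist x z' / d| <= mdist z z' / d.
    by rewrite -mulrBl normrM [X in _ * X]gtr0_norm ?invr_gt0// ler_pM2r ?invr_gt0// mdist_lip.
  rewrite /phi; move: (mdist x z / d) (mdist x z' / d) (mdist z z' / d) => a b e.
  rewrite !ler_norml => /andP[l1 l2].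
  case: (lerP 0 (2 * lam + 1 - a)) => ?; case: (lerP 0 (2 * lam + 1 - b)) => ?;
    rewrite /Num.min; case: ltP => ?; case: ltP => ?; apply/andP; split; lra.
have phi01 z : 0 <= phi z <= 1.
  by rewrite /phi ge_min lexx le_min ler01 le_max lexx.
have phi1 z : mdist x z <= 2 * lam * d -> phi z = 1.
  move=> H; rewrite /phi min_l// le_max; apply/orP; right.
  by rewrite lerBrDr -lerBrDl ler_pdivrMr//; lra.
have phi0 z : ~ A z -> phi z = 0.
  rewrite /A in_ball => /negP; rewrite -leNgt => H; rewrite /phi max_l ?min_r//.
  by rewrite subr_le0 ler_pdivlMr.
pose u z := if `[< U z >] then phi z else 0.
have u01 z : 0 <= u z <= 1 by rewrite /u; case: ifP => // _; rewrite lexx ler01.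
have uext z z' : mdist z z' <= delta -> A z -> A z' -> `|u z - u z'| <= `|phi z - phi z'|.
  move=> zz' Az Az'; rewrite /u; case: asboolP => Uz; case: asboolP => Uz' //.
  - by exfalso; apply: Uz'; exact: Uext Uz.
  - by exfalso; apply: Uz; apply: Uext Uz'; rewrite // metric_sym.
  - by rewrite subrr normr0.
have uout z z' : ~ A z -> `|u z - u z'| <= `|phi z - phi z'|.
  move=> Az; rewrite (phi0 z Az) /u (asboolF (fun H => Az (UA _ H))) !sub0r !normrN.
  by case: ifP => // _; rewrite normr0.
have Lu : Lip u.
  exists (d^-1 + delta^-1) => z z'; have dz := mdist_ge0 z z'.
  rewrite mulrDl; have [zz'|zz'] := leP (mdist z z') delta; last first.
    rewrite ler_wpDl//; first by rewrite mulr_ge0// invr_ge0 ltW.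
    apply: (@le_trans _ _ 1); last by rewrite mulrC ler_pdivlMr// mul1r ltW.
    by have := u01 z; have := u01 z'; rewrite ler_norml; lra.
  apply: ler_wpDr; first by rewrite mulr_ge0// invr_ge0 ltW.
  rewrite mulrC; apply: le_trans (phi_lip z z').
  have [Az|Az] := pselect (A z); last exact: uout.
  have [Az'|Az'] := pselect (A z'); first exact: uext.
  by rewrite distrC [leRHS]distrC; exact: uout.
have loc z : mdist x z < 2 * lam * d ->
    exists e, [/\ 0 < e, ball z e `<=` ball x (2 * lam * d) &
                forall w, ball z e w -> u w = u z].
  move=> xz; exists (Num.min delta (2 * lam * d - mdist x z)).
  rewrite lt_min delta0 subr_gt0 xz; split => //.
    by apply: ball_sub; rewrite -lerBrDl ge_min lexx orbT.
  move=> w; rewrite in_ball lt_min => /andP[zw1 zw2].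
  have xw : mdist x w < 2 * lam * d by have := metric_triangle x z w; lra.
  have AS v : mdist x v < 2 * lam * d -> A v.
    by rewrite /A in_ball => H; apply: (lt_trans H); rewrite ltr_pM2r// ltrDl.
  have := uext z w (ltW zw1) (AS _ xz) (AS _ xw).
  by rewrite (phi1 z (ltW xz)) (phi1 w (ltW xw)) subrr normr0 normr_le0 subr_eq0 => /eqP.
apply: contrapT => nUx.
have ux0 : u x = 0 by rewrite /u asboolF.
have uy1 : u y = 1.
  by rewrite /u asboolT// phi1// -/d; nra.
have d20 : 0 < 2 * d by rewrite mulr_gt0.
have [ex [ex0 exs exu]] : exists e, [/\ 0 < e, ball x e `<=` ball x (2 * d) &
    forall w, ball x e w -> u w = u x].
  have [|e [e0 _ eu]] := loc x; first by rewrite mdistxx; nra.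
  exists (Num.min e (2 * d)); rewrite lt_min e0 d20; split => // [|w].
    by apply: ball_sub; rewrite mdistxx add0r ge_min lexx orbT.
  by rewrite in_ball lt_min => /andP[H _]; apply: eu; rewrite in_ball.
have [ey [ey0 eys eyu]] : exists e, [/\ 0 < e, ball y e `<=` ball x (2 * d) &
    forall w, ball y e w -> u w = u y].
  have [|e [e0 _ eu]] := loc y; first by rewrite -/d; nra.
  exists (Num.min e d); rewrite lt_min e0 d0; split => // [|w].
    apply: ball_sub; rewrite -/d; have : Num.min e d <= d by rewrite ge_min lexx orbT.
    lra.
  by rewrite in_ball lt_min => /andP[H _]; apply: eu; rewrite in_ball.
have vx := vol_gt0 dm x ex0; have vy := vol_gt0 dm y ey0; have V0 := vol_gt0 dm x d20.
pose S := (vol mu x ex)^-1 + (vol mu y ey)^-1.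
have S0 : 0 < S by rewrite addr_gt0 ?invr_gt0.
have B0 : 0 < C * (2 * d) * vol mu x (2 * d) * S by rewrite !mulr_gt0//; lra.
(* With this [tau] the constant would be within a total of [1 / 2] of both values. *)
pose tau := (2 * (C * (2 * d) * vol mu x (2 * d) * S))^-1.
have tau0 : 0 < tau by rewrite invr_gt0 mulr_gt0.
have lip0 z : ball x (lam * (2 * d)) z -> (lip u z <= 0)%E.
  rewrite in_ball => xz; have [|e [e0 _ eu]] := loc z; first by move: xz; lra.
  by apply: (lip_le e0) => // w /eu ->; rewrite subrr normr0 mul0e.
have [c] := @poincare_linear _ _ mu _ dm p C lam p1 HP u (fun=> 0%E) x (2 * d) tau _ Lu
  d20 (young_powR p1 tau0) lip0.
rewrite poweR0r ?gt_eqF// integ_cst ?mul0e ?mule0 ?adde0; last exact: bset_ball.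
move=> oc.
have hx := le_trans (osc_point c ex0 exs exu) oc.
have hy := le_trans (osc_point c ey0 eys eyu) oc.
move: hx hy; rewrite !lee_fin ux0 uy1 -!ler_pdivlMr// => hx hy.
have : (1 : R) <= `|0 - c| + `|1 - c|.
  by have := ler_normD (1 - c) (c - 0); rewrite subrKA subr0 normr1 (distrC c); lra.
have := lerD hx hy; rewrite -mulrDr -/S => /[swap] /le_trans /[apply].
have -> : C * (2 * d) * (tau * vol mu x (2 * d)) * S = 2^-1.
  transitivity (tau * (C * (2 * d) * vol mu x (2 * d) * S)); first by ring.
  have half (b : R) : b != 0 -> (2 * b)^-1 * b = 2^-1 by move=> ?; rewrite invfM -mulrA mulVf ?mulr1.
  by apply: half; rewrite gt_eqF.
by rewrite leNgt invf_lt1// ltr1n.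
Qed.

End WellChained.

(** * Shortest chains *)

Section ShortestChain.
Context {R : realType} {X : pmetricType R}.
Implicit Types (x y z w : X) (r c d e : R).
Variables (mu : {sigma_finite_measure set (borel X) -> \bar R}) (CD : R).
Hypothesis dm : doubling_measure mu CD.

(** In a chain of minimal length all shortcuts are excluded, and only the last point
  can belong to the target. *)
Lemma shortest_chain A T (delta : R) y q N : chain_in A T delta y q N ->
  exists q' N', [/\ chain_in A T delta y q' N',
    forall i, (i < N')%N -> ~ T (q' i) &
    forall i j, (i.+1 < j)%N -> (j <= N')%N -> delta < mdist (q' i) (q' j)].
Proof.
move=> qN; pose P n := `[< exists q', chain_in A T delta y q' n >].
have exP : exists n, P n by exists N; apply/asboolP; exists q.
case: (ex_minnP exP) => n /asboolP[q' Q] nmin; exists q', n; split => //.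
- move=> i iN Ti; have := nmin i; rewrite leqNgt iN => H; suff : false by [].
  apply: H; apply/asboolP; exists q'; case: Q => ? ? qc qA; split => //.
  + by move=> j ji; apply: qc; exact: ltn_trans iN.
  + by move=> j ji; apply: qA; exact: leq_trans (ltnW iN).
- move=> i j ij jn; rewrite ltNge; apply/negP => dij.
  have := nmin (n - (j - i.+1))%N; rewrite leqNgt ltn_subrL subn_gt0 ij (leq_trans _ jn) ?(leq_ltn_trans _ ij)//=.
  move=> H; suff : false by [].
  apply: H; apply/asboolP.
  case: Q => q0 qn qc qA.
  exists (fun l => if (l <= i)%N then q' l else q' (l + (j - i.+1))%N); split => //=.
  + by rewrite ifN ?subnK//; [lia|rewrite -ltnNge; lia].
  + move=> l ln; case: (ltngtP l i) => [li|li|->].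
    * by apply: qc; lia.
    * by rewrite addSn; apply: qc; lia.
    * by rewrite (_ : i.+1 + (j - i.+1) = j)%N//; lia.
  + by move=> l ln; case: ifP => _; apply: qA; lia.
Qed.

(** Every second point of the chain is the centre of one of disjoint balls of
  comparable size. *)
Lemma chain_size A x (delta rho : R) q N : 0 < delta ->
  A `<=` ball x rho -> (forall i, (i <= N)%N -> A (q i)) ->
  (forall i j, (i.+1 < j)%N -> (j <= N)%N -> delta < mdist (q i) (q j)) ->
  N%:R <= 2 * dblc CD (4 * rho / delta + 2).
Proof.
move=> delta0 Arho qA sep; set H := dblc _ _.
have qr i : (i <= N)%N -> mdist x (q i) < rho by move=> /qA/Arho; rewrite in_ball.
have rho0 : 0 < rho by rewrite (le_lt_trans (mdist_ge0 _ _) (qr 0%N _)).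
have rd0 : 0 < rho + delta by rewrite addr_gt0.
have dh0 : 0 < delta / 2 by rewrite divr_gt0.
pose n := N./2.+1.
pose F (i : 'I_n) : set (borel X) := ball (q i.*2) (delta / 2).
have in2 (i : 'I_n) : (i.*2 <= N)%N by have := ltn_ord i; rewrite /n; lia.
have tF : trivIset setT F.
  apply/trivIsetP => i j _ _; wlog ij : i j / (i < j)%N.
    move=> W ij; have [ij'|ji] := ltnP i j; first exact: W.
    by rewrite setIC; apply: W; rewrite 1?eq_sym// ltn_neqAle eq_sym ij.
  move=> _; rewrite -subset0 => z []; rewrite /F !in_ball => zi zj.
  have : delta < mdist (q i.*2) (q j.*2) by apply: sep => //; lia.
  by have := metric_triangle (q i.*2) z (q j.*2); rewrite (metric_sym z); move: zi zj; lra.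
have : (mu (\big[setU/set0]_(i < n) F i) <= mu (ball x (rho + delta)))%E.
  apply: le_measure; rewrite ?inE; [|exact: bset_ball|].
    by apply: bigsetU_measurable => i _; exact: bset_ball.
  rewrite -bigcup_mkord_ord => z [i' _]; set i := inord i'; rewrite /F; apply: ball_sub.
  by have := qr _ (in2 i); lra.
rewrite measure_bigsetU_ord//; last by move=> i; exact: bset_ball.
rewrite (mu_ball dm)//.
rewrite (eq_bigr (fun i : 'I_n => (vol mu (q i.*2) (delta / 2))%:E)); last first.
  by move=> i _; exact: (mu_ball dm).
rewrite sumEFin lee_fin => V.
have H0 : 0 < H := dblc_gt0 dm _.
have v0 := vol_gt0 dm x rd0.
have : n%:R * (vol mu x (rho + delta) / H) <= vol mu x (rho + delta).
  apply: le_trans V; rewrite mulr_natl -[n in X in X <= _]card_ord -sumr_const.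
  apply: ler_sum => i _; rewrite ler_pdivrMr// mulrC.
  apply: (vol_comp dm) => //; rewrite metric_sym.
  have -> : (4 * rho / delta + 2) * (delta / 2) = 2 * rho + delta by field; rewrite gt_eqF.
  by have := qr _ (in2 i); lra.
rewrite mulrA ler_pdivrMr// mulrC ler_pM2l// => nH.
apply: (@le_trans _ _ (2 * n%:R)); last by rewrite ler_pM2l.
by rewrite -natrM ler_nat /n; lia.
Qed.
End ShortestChain.

(** * Telescoping along chains *)

Section Telescoping.
Context {R : realType} {X : pmetricType R}.
Implicit Types (x y z w : X) (r d e : R).
Variables (mu : {sigma_finite_measure set (borel X) -> \bar R}) (CD : R).
Hypothesis dm : doubling_measure mu CD.

Lemma integ_le_weight A (h : X -> \bar R) (f : X -> R) (a b : R) :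
  bset A -> bmeas h -> (forall z, 0 <= h z)%E -> bmeas (EFin \o f) ->
  0 <= a -> 0 <= b -> (forall z, A z -> 0 <= f z /\ a <= b * f z) ->
  (a%:E * integ mu A h <= b%:E * integ mu A (fun z => h z * (f z)%:E))%E.
Proof.
move=> mA mh h0 mf a0 b0 af.
rewrite -integZ// -integZ//; last 2 first.
- exact: bmeasM.
- by move=> z /af[f0 _]; rewrite mule_ge0 ?lee_fin.
apply: integ_le => z Az; first by rewrite mule_ge0 ?lee_fin.
have [f0 afz] := af _ Az.
by rewrite muleCA -EFinM muleC lee_wpmul2l ?lee_fin.
Qed.

Variables (lam L1 C0 : R).
Hypotheses (lam1 : 1 <= lam) (L11 : 1 <= L1) (C00 : 0 < C0).

(** With these values a ball of radius [2 * kappa * d], enlarged by the factor [lam],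
  stays in an annulus when its centre is at distance at least [d / (2 * step_ratio)], and
  the annuli of every second step do not meet. *)
Definition step_ratio := 4 * (L1 + 1).
Definition kappa := (8 * lam * step_ratio)^-1.
Definition link_const := 4 * C0 * dblc CD ((L1 + 4) / (kappa / step_ratio)).

Lemma step_ratio_ge8 : 8 <= step_ratio. Proof. by rewrite /step_ratio; move: L11; lra. Qed.
Lemma step_ratio_gt0 : 0 < step_ratio. Proof. by have := step_ratio_ge8; lra. Qed.
Lemma kappa_gt0 : 0 < kappa.
Proof.
by rewrite invr_gt0; apply: mulr_gt0 step_ratio_gt0; have := lam1; lra.
Qed.
Lemma kappa_lam : 8 * (lam * kappa) = step_ratio^-1.
Proof.
have r0 := step_ratio_gt0; have l0 : 0 < lam by move: lam1; lra.
by rewrite /kappa; field; rewrite !gt_eqF.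
Qed.
Lemma step_ratioV_le : step_ratio^-1 <= 8^-1.
Proof. by rewrite lef_pV2 ?posrE ?step_ratio_gt0// step_ratio_ge8. Qed.
Lemma kappa_le : 8 * kappa <= step_ratio^-1.
Proof. by rewrite -kappa_lam ler_pM2l// ler_peMl// ltW// kappa_gt0. Qed.
Lemma kappa_ratio : kappa / step_ratio <= kappa.
Proof.
rewrite ler_piMr ?(ltW kappa_gt0)//; apply: le_trans step_ratioV_le _; lra.
Qed.
Lemma link_const_gt0 : 0 < link_const.
Proof. by rewrite !mulr_gt0// (dblc_gt0 dm). Qed.

Variables (h : X -> \bar R) (tau k : R).
Hypotheses (mh : bmeas h) (h0 : forall z, (0 <= h z)%E) (tau0 : 0 < tau) (k0 : 0 < k).

(** [c z r] stands for an approximate mean value of [u] on the ball. The pair varies with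
  the level of truncation of a function, whereas the chains are chosen once for all
  levels; statements below quantify over admissible pairs after the geometric choices. *)
Definition admissible (u : X -> R) (c : X -> R -> R) :=
  measurable_fun [set: borel X] (u : borel X -> R) /\
  forall z r, 0 < r -> (osc mu z r u (c z r) <=
    (C0 * r)%:E * ((tau * vol mu z r)%:E + k%:E * integ mu (ball z (lam * r)) h))%E.

Lemma integ_h_ge0 A : (0 <= integ mu A h)%E.
Proof. exact: integ_ge0. Qed.

(** The two mean values are compared on a ball contained in both balls, whose measure is
  comparable with that of the ball of radius [d] around [x]. *)
Lemma link u c x z w v d r r' s A : admissible u c -> 0 < d ->
  0 < r <= 2 * d -> 0 < r' <= 2 * d -> kappa / step_ratio * d <= s ->
  ball v s `<=` ball z r -> ball v s `<=` ball w r' ->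
  mdist v z + r <= (L1 + 4) * d -> mdist v w + r' <= (L1 + 4) * d ->
  mdist v x + d <= (L1 + 4) * d ->
  ball z (lam * r) `<=` A -> ball w (lam * r') `<=` A ->
  (`|c z r - c w r'|%:E <= link_const%:E *
     ((d * tau)%:E + (k * (d / vol mu x d))%:E * integ mu A h))%E.
Proof.
move=> [mu_ oc] d0 /andP[r0 rd] /andP[r'0 r'd] sd sz sw vz vw vx Az Aw.
have kr0 : 0 < kappa / step_ratio by rewrite divr_gt0 ?kappa_gt0 ?step_ratio_gt0.
have s0 : 0 < s by rewrite (lt_le_trans _ sd)// mulr_gt0.
have vs0 := vol_gt0 dm v s0; have vx0 := vol_gt0 dm x d0.
rewrite /link_const; set H := dblc CD _; have H0 : 0 < H := dblc_gt0 dm _.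
set vs := vol mu v s in vs0 *.
have volH y (e : R) : 0 < e -> mdist v y + e <= (L1 + 4) * d -> vol mu y e <= H * vs.
  move=> e0 ye; apply: (vol_comp dm) => //; apply: (le_trans ye).
  rewrite -mulrA ler_pM2l; last by move: L11; lra.
  by rewrite mulrC ler_pdivlMr// mulrC.
set J := integ mu A h; have J0 : (0 <= J)%E := integ_h_ge0 A.
have osc_bd y (e : R) : 0 < e -> e <= 2 * d -> mdist v y + e <= (L1 + 4) * d ->
    ball v s `<=` ball y e -> ball y (lam * e) `<=` A ->
    (integ mu (ball v s) (fun q => `|u q - c y e|%:E) <=
      (2 * C0 * d)%:E * ((tau * (H * vs))%:E + k%:E * J))%E.
  move=> e0 ed ye sub subA.
  apply: (@le_trans _ _ (osc mu y e u (c y e))); first by apply: integ_sub => // *; rewrite lee_fin.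
  apply: (le_trans (oc _ _ e0)); apply: lee_pmul.
  - by rewrite lee_fin mulr_ge0// ltW.
  - rewrite adde_ge0 ?mule_ge0 ?integ_h_ge0// lee_fin ?(ltW k0)//.
    by rewrite mulr_ge0// ltW// (vol_gt0 dm).
  - by rewrite lee_fin [leRHS]mulrAC [leRHS]mulrC ler_pM2l.
  - apply: leeD; first by rewrite lee_fin ler_pM2l// volH.
    by rewrite lee_pmul2l ?lte_fin// integ_sub.
have mosc a : bmeas (fun q => `|u q - a|%:E) by exact: bmeas_osc.
have key : ((`|c z r - c w r'| * vs)%:E <=
    (4 * C0 * d)%:E * ((tau * (H * vs))%:E + k%:E * J))%E.
  rewrite /vs -(integ_ball_cst dm)//.
  apply: (@le_trans _ _ (integ mu (ball v s)
      (fun q => `|u q - c z r|%:E + `|u q - c w r'|%:E))%E).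
    apply: integ_le => q _; first by rewrite lee_fin.
    by rewrite -EFinD lee_fin (distrC (u q)); have := ler_normD (c z r - u q) (u q - c w r'); rewrite subrKA.
  rewrite integD//; last exact: bset_ball.
  apply: (le_trans (leeD (osc_bd _ _ r0 rd vz sz Az) (osc_bd _ _ r'0 r'd vw sw Aw))).
  have C2d : 0 <= 2 * C0 * d by rewrite !mulr_ge0// ltW.
  by rewrite -ge0_muleDl ?lee_fin// -EFinD (_ : 2 * C0 * d + 2 * C0 * d = 4 * C0 * d)//; ring.
have C4 : 0 < 4 * C0 * H by rewrite !mulr_gt0.
have kd : 0 < k * (d / vol mu x d) by rewrite mulr_gt0// divr_gt0.
clear osc_bd; case: J J0 key => [j| |] // J0.
  rewrite -!(EFinM, EFinD) !lee_fin -ler_pdivlMr// => /le_trans; apply.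
  rewrite ler_pdivrMr//.
  have Vx : vol mu x d <= H * vs by exact: volH.
  rewrite [leLHS]mulrDr [X in _ <= X * _]mulrDr [leRHS]mulrDl; apply: lerD; first by rewrite le_eqVlt; apply/orP; left; apply/eqP; ring.
  rewrite (_ : 4 * C0 * H * (k * (d / vol mu x d) * j) * vs =
    4 * C0 * d * (k * j) * ((H * vs) / vol mu x d)); last by ring.
  rewrite ler_peMr//; last by rewrite ler_pdivlMr// mul1r.
  by rewrite !mulr_ge0// ltW.
by move=> _; rewrite gt0_muley ?lte_fin// addey// gt0_muley ?lte_fin// leey.
Qed.

Definition shell x d : set X := [set z | d / (4 * step_ratio) <= mdist x z < (L1 + 1) * d].

Lemma bset_shell x d : bset (shell x d).
Proof.
rewrite (_ : shell x d = ball x ((L1 + 1) * d) `\` ball x (d / (4 * step_ratio))).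
  by apply: bset_setD; exact: bset_ball.
apply/seteqP; split => z /=; rewrite !in_ball.
  by move=> /andP[H1 H2]; split => //; apply/negP; rewrite -leNgt.
by move=> [H1 /negP]; rewrite -leNgt => H2; apply/andP; split.
Qed.

(** On the shell the kernel is bounded below by a multiple of its value at distance [d]. *)
Lemma shell_kern x d : 0 < d -> ((d / vol mu x d)%:E * integ mu (shell x d) h <=
  (4 * step_ratio * dblc CD (L1 + 1))%:E *
   integ mu (shell x d) (fun z => h z * (kern mu x z)%:E))%E.
Proof.
move=> d0; have r0 := step_ratio_gt0; have H0 := dblc_gt0 dm (L1 + 1).
have vd := vol_gt0 dm x d0.
apply: integ_le_weight => //.
- exact: bset_shell.
- by apply/measurable_EFinP; exact: (measurable_kern dm).
- by rewrite divr_ge0// ltW.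
- by rewrite ltW// mulr_gt0// mulr_gt0.
move=> z /andP[dz zd]; split; first exact: kern_ge0.
have rz : 0 < mdist x z by rewrite (lt_le_trans _ dz)// divr_gt0// mulr_gt0.
have vz := vol_gt0 dm x rz.
have : vol mu x (mdist x z) <= dblc CD (L1 + 1) * vol mu x d.
  by apply: (vol_comp dm) => //; rewrite mdistxx add0r ltW.
rewrite /kern => vle; rewrite ler_pdivrMr//.
set D := dblc CD _ in H0 vle *; set rho := mdist x z in dz zd rz vz vle *.
rewrite [leRHS](_ : _ = rho * (4 * step_ratio) * (D * vol mu x d) / vol mu x rho); last by ring.
rewrite ler_pdivlMr//; apply: ler_pM => //; rewrite ?(ltW d0) ?(ltW vz)//.
by move: dz; rewrite ler_pdivrMr// mulr_gt0.
Qed.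

End Telescoping.

(** * Approaching a point *)

Section Approach.
Context {R : realType} {X : pmetricType R}.
Implicit Types (x y z w : X) (r d e : R).
Variables (mu : {sigma_finite_measure set (borel X) -> \bar R}) (CD : R).
Hypothesis dm : doubling_measure mu CD.
Variables (lam L1 C0 : R).
Hypotheses (lam1 : 1 <= lam) (L11 : 1 <= L1) (C00 : 0 < C0).
Hypothesis wc : forall x y (delta : R), 0 < delta -> x != y ->
  exists q N, chain_in (ball x (L1 * mdist x y)) [set x] delta y q N.
Variables (h : X -> \bar R) (tau k : R).
Hypotheses (mh : bmeas h) (h0 : forall z, (0 <= h z)%E) (tau0 : 0 < tau) (k0 : 0 < k).

Local Notation K := (step_ratio L1).
Local Notation kap := (kappa lam L1).
Local Notation adm := (admissible mu lam C0 h tau k).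
Local Notation lk := (link_const CD lam L1 C0).

Definition step_const :=
  (2 * dblc CD (4 * L1 / kap + 2) + 1) * lk * (4 * K * dblc CD (L1 + 1)).

(** The chain is followed until it first enters the ball of radius [mdist x y / K]; being
  shortest, it has a number of elements bounded in terms of the constants. A last link
  adapts the radius to the new distance, which makes the statement ready for iteration.
  The point [y'] depends only on the geometry, and not on [u] and [c]. *)
Lemma step x y : x != y -> exists2 y',
  mdist x y / (2 * K) <= mdist x y' < mdist x y / K &
  forall u c, adm u c ->
  (`|c y (2 * kap * mdist x y) - c y' (2 * kap * mdist x y')|%:E <=
   step_const%:E * ((mdist x y * tau)%:E +
     k%:E * integ mu (shell L1 x (mdist x y)) (fun z => h z * (kern mu x z)%:E)))%E.
Proof.
move=> xy; set d := mdist x y; have d0 : 0 < d by rewrite mdist_gt0.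
have K0 := step_ratio_gt0 L11; have kap0 := kappa_gt0 lam1 L11.
have K8 := step_ratio_ge8 L11; have kapK := kappa_le lam1 L11.
have kapL := kappa_lam lam1 L11.
have KV0 : 0 < K^-1 by rewrite invr_gt0.
have KV := step_ratioV_le L11.
have lk0 : 0 < lk := link_const_gt0 dm lam L1 C00.
have dK0 : 0 < d / K by rewrite divr_gt0.
pose delta := kap * d; have delta0 : 0 < delta by rewrite mulr_gt0.
have [q1 [N1 [q10 q1N q1c q1A]]] := wc delta0 xy.
have q1T : chain_in (ball x (L1 * d)) (ball x (d / K)) delta y q1 N1.
  by split => //; rewrite q1N in_ball mdistxx.
have [q [N [[q0 qN qc qA] qT qsep]]] := shortest_chain q1T.
have Nle : N%:R <= 2 * dblc CD (4 * L1 / kap + 2).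
  rewrite (_ : 4 * L1 / kap = 4 * (L1 * d) / delta); last first.
    by rewrite /delta; field; rewrite !gt_eqF.
  exact: (chain_size dm delta0 (fun _ => id) qA qsep).
move: qN; rewrite in_ball => qN.
have N0 : (0 < N)%N.
  rewrite lt0n; apply/eqP => N0; move: qN; rewrite N0 q0 -/d.
  by apply/negP; rewrite -leNgt ler_piMr ?(ltW d0)//; move: KV; lra.
have far i : (i <= N)%N -> d / (2 * K) <= mdist x (q i).
  have half : d / (2 * K) = d / K / 2 by field; rewrite !gt_eqF.
  have dl : 8 * delta <= d / K by rewrite /delta mulrA mulrC ler_pM2l.
  move=> iN; have farT j : (j < N)%N -> d / K <= mdist x (q j).
    by move=> jN; have := qT _ jN; rewrite in_ball => /negP; rewrite -leNgt.
  have [iN'|Ni] := ltnP i N.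
    by have := farT _ iN'; rewrite half; lra.
  have -> : i = N by apply/eqP; rewrite eqn_leq iN.
  have jN : (N.-1 < N)%N by rewrite ltn_predL.
  have := farT _ jN; have := qc _ jN; rewrite (prednK N0) half.
  have := metric_triangle x (q N) (q N.-1); rewrite (metric_sym (q N)).
  by move: dl; lra.
have near_ i : (i <= N)%N -> mdist x (q i) < L1 * d by move=> /qA; rewrite in_ball.
exists (q N); first by rewrite qN far.
move=> u c uc; set d' := mdist x (q N) in qN *.
have d'0 : 0 < d' by apply: lt_le_trans (far _ (leqnn N)); rewrite divr_gt0// mulr_gt0.
pose S := shell L1 x d; set B := ((d * tau)%:E + (k * (d / vol mu x d))%:E * integ mu S h)%E.
have dvol : 0 < d / vol mu x d by rewrite divr_gt0// (vol_gt0 dm).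
have B0 : (0 <= B)%E.
  apply: adde_ge0; first by rewrite lee_fin mulr_ge0// ltW.
  by rewrite mule_ge0 ?integ_ge0// lee_fin mulr_ge0// ltW.
have kap1 : kap <= 64^-1 by move: kapK KV; lra.
have kapr : kap / K <= kap := kappa_ratio lam1 L11.
have sub i r : (i <= N)%N -> r <= 2 * delta -> ball (q i) (lam * r) `<=` S.
  move=> iN rd z; rewrite in_ball => zq.
  have lr : lam * r <= d / K / 4.
    apply: (@le_trans _ _ (lam * (2 * delta))); first by rewrite ler_pM2l//; move: lam1; lra.
    by rewrite /delta -kapL; lra.
  have := far _ iN; have := near_ _ iN.
  rewrite (_ : d / (2 * K) = d / K / 2); last by field; rewrite !gt_eqF.
  have := metric_triangle x z (q i); have := metric_triangle x (q i) z.
  rewrite (metric_sym z) => t1 t2 nr fr.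
  have dK : d / K <= d / 8 by rewrite ler_pM2l.
  rewrite /S /shell/= (_ : d / (4 * K) = d / K / 4); last by field; rewrite !gt_eqF.
  by apply/andP; split; move: dK0; lra.
have kd0 : 0 < kap * d by exact: mulr_gt0.
have kd1 : kap * d <= d / 64 by rewrite mulrC ler_pM2l.
have kKd : kap / K * d <= kap * d by rewrite ler_pM2r.
have L1d : d <= L1 * d by rewrite ler_peMl// ltW.
have one i : (i < N)%N -> (`|c (q i) (2 * delta) - c (q i.+1) (2 * delta)|%:E <= lk%:E * B)%E.
  move=> iN; have Mi := qc _ iN; have iN' := ltnW iN.
  have nri := near_ _ iN'.
  apply: (@link _ _ mu CD dm _ _ _ lam1 L11 C00 h tau k h0 tau0 k0 u c x (q i) (q i.+1) (q i) d
    (2 * delta) (2 * delta) delta S) => //; rewrite ?(metric_sym (q i) x) ?mdistxx /delta.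
  - by apply/andP; split; lra.
  - by apply/andP; split; lra.
  - by apply: ball_sub; rewrite mdistxx; lra.
  - by apply: ball_sub; rewrite metric_sym; move: Mi; rewrite /delta; lra.
  - by lra.
  - by move: Mi; rewrite /delta; lra.
  - by lra.
  - exact: sub.
  - exact: sub.
have tele i : (i <= N)%N ->
    (`|c (q 0%N) (2 * delta) - c (q i) (2 * delta)|%:E <= i%:R%:E * (lk%:E * B))%E.
  elim: i => [|i IH] iN; first by rewrite subrr normr0 mul0e.
  rewrite (_ : (i.+1%:R : R)%:E = (i%:R%:E + 1%:E)%E); last by rewrite -EFinD natr1.
  rewrite ge0_muleDl ?lee_fin// mul1e.
  apply: le_trans (leeD (IH (ltnW iN)) (one _ iN)).
  by rewrite -EFinD lee_fin; apply: le_trans (ler_normD _ _); rewrite subrKA.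
have last_link : (`|c (q N) (2 * delta) - c (q N) (2 * kap * d')|%:E <= lk%:E * B)%E.
  have nrN := near_ _ (leqnn N).
  have d'd : kap * d' <= kap * (d / K) by rewrite ler_pM2l// ltW.
  have dK : kap * (d / K) <= kap * d.
    by rewrite ler_pM2l// ler_piMr ?(ltW d0)//; move: KV; lra.
  have kd' : kap / K * d <= 2 * kap * d'.
    have := far _ (leqnn N); rewrite -/d' (_ : d / (2 * K) = d / K / 2); last by field; rewrite !gt_eqF.
    rewrite -(ler_pM2l kap0) => H; rewrite mulrAC -mulrA; move: H; lra.
  have kd'0 : 0 < kap * d' by exact: mulr_gt0.
  apply: (@link _ _ mu CD dm _ _ _ lam1 L11 C00 h tau k h0 tau0 k0 u c x (q N) (q N) (q N) d
    (2 * delta) (2 * kap * d') (2 * kap * d') S) => //; rewrite ?(metric_sym (q N) x) ?mdistxx /delta.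
  - by apply/andP; split; lra.
  - by apply/andP; split; lra.
  - by apply: ball_sub; rewrite mdistxx; lra.
  - by lra.
  - by lra.
  - by move: nrN; rewrite /d'; lra.
  - exact: sub.
  - by apply: sub => //; rewrite /delta; lra.
have D1 := dblc_ge1 dm (L1 + 1).
have M1 : 1 <= 4 * K * dblc CD (L1 + 1).
  by apply: (@le_trans _ _ (4 * K * 1)); [lra|rewrite ler_pM2l// mulr_gt0].
have M0 := lt_le_trans ltr01 M1.
set I := integ mu S _.
have I0 : (0 <= I)%E.
  by apply: integ_ge0 => z _; rewrite mule_ge0// lee_fin kern_ge0.
have BM : (B <= (4 * K * dblc CD (L1 + 1))%:E * ((d * tau)%:E + k%:E * I))%E.
  rewrite ge0_muleDr; [|by rewrite lee_fin mulr_ge0// ltW|by rewrite mule_ge0// lee_fin ltW].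
  apply: leeD.
    by rewrite -EFinM lee_fin ler_peMl// mulr_ge0// ltW.
  rewrite [X in (_ <= X)%E]muleCA EFinM -muleA lee_pmul2l ?lte_fin//.
  exact: (shell_kern dm L11).
have -> : 2 * kap * d = 2 * delta by rewrite /delta mulrA.
rewrite -q0 /step_const (EFinM _ (4 * K * dblc CD (L1 + 1))) -muleA.
apply: (@le_trans _ _ (((2 * dblc CD (4 * L1 / kap + 2) + 1) * lk)%:E * B)%E); last first.
  rewrite lee_pmul2l// lte_fin mulr_gt0//.
  by have := dblc_gt0 dm (4 * L1 / kap + 2); lra.
rewrite EFinM -muleA.
have lB0 : (0 <= lk%:E * B)%E by rewrite mule_ge0// lee_fin ltW.
apply: (@le_trans _ _ ((N%:R + 1)%:E * (lk%:E * B))%E); last first.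
  by rewrite lee_wpmul2r// lee_fin lerD2r.
rewrite EFinD ge0_muleDl ?lee_fin// mul1e.
apply: le_trans (leeD (tele _ (leqnn N)) last_link).
by rewrite -EFinD lee_fin; apply: le_trans (ler_normD _ _); rewrite subrKA.
Qed.

End Approach.

Section Iterate.
Context {R : realType} {X : pmetricType R}.
Implicit Types (x y z w : X) (r d e : R).
Variables (mu : {sigma_finite_measure set (borel X) -> \bar R}) (CD : R).
Hypothesis dm : doubling_measure mu CD.
Variables (lam L1 C0 : R).
Hypotheses (lam1 : 1 <= lam) (L11 : 1 <= L1) (C00 : 0 < C0).
Hypothesis wc : forall x y (delta : R), 0 < delta -> x != y ->
  exists q N, chain_in (ball x (L1 * mdist x y)) [set x] delta y q N.
Variables (h : X -> \bar R) (tau k : R).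
Hypotheses (mh : bmeas h) (h0 : forall z, (0 <= h z)%E) (tau0 : 0 < tau) (k0 : 0 < k).

Local Notation K := (step_ratio L1).
Local Notation kap := (kappa lam L1).
Local Notation adm := (admissible mu lam C0 h tau k).
Local Notation sc := (step_const CD lam L1 C0).

Definition potential x r := integ mu (ball x r) (fun z => h z * (kern mu x z)%:E)%E.

Lemma hkern_ge0 x z : (0 <= h z * (kern mu x z)%:E)%E.
Proof. by rewrite mule_ge0// lee_fin kern_ge0. Qed.

Lemma bmeas_hkern x : bmeas (fun z => h z * (kern mu x z)%:E)%E.
Proof. by apply: bmeasM => //; apply/measurable_EFinP; exact: (measurable_kern dm). Qed.

Lemma potential_ge0 x r : (0 <= potential x r)%E.
Proof. by apply: integ_ge0 => z _; exact: hkern_ge0. Qed.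

Lemma potential_le x r r' : r <= r' -> (potential x r <= potential x r')%E.
Proof.
move=> rr'; apply: integ_sub => [z _|]; first exact: hkern_ge0.
by apply: ball_sub; rewrite mdistxx add0r.
Qed.

Lemma step_const_gt0 : 0 < sc.
Proof.
have lk0 := link_const_gt0 dm lam L1 C00; have K0 := step_ratio_gt0 L11.
have := dblc_gt0 dm (4 * L1 / kap + 2); have := dblc_gt0 dm (L1 + 1) => D1 D2.
rewrite /step_const; apply: mulr_gt0; last by rewrite mulr_gt0// mulr_gt0.
by apply: mulr_gt0 => //; lra.
Qed.

Lemma weighted_sum (A B C D E : \bar R) (a b e : R) :
  (0 <= A)%E -> (0 <= B)%E -> (0 <= C)%E -> (A + C <= D)%E -> (B <= E)%E -> a + b <= e ->
  (a%:E + k%:E * A + (b%:E + k%:E * (B + C)) <= e%:E + k%:E * (D + E))%E.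
Proof.
move=> A0 B0 C0' AC BE abe; rewrite addeACA -EFinD -ge0_muleDr ?adde_ge0//.
apply: leeD; first by rewrite lee_fin.
by rewrite lee_pmul2l ?lte_fin// (addeC B) addeA leeD.
Qed.

(** The shells of consecutive steps may overlap, but those of every second step are
  disjoint. *)
Lemma approach x y t : 0 < t -> t <= mdist x y -> exists2 y',
  t / (2 * K) <= mdist x y' < t &
  forall u c, adm u c ->
  (`|c y (2 * kap * mdist x y) - c y' (2 * kap * mdist x y')|%:E <=
   sc%:E * ((2 * mdist x y * tau)%:E + k%:E * (potential x ((L1 + 1) * mdist x y) +
     potential x ((L1 + 1) * mdist x y / K))))%E.
Proof.
move=> t0 ty.
have K0 := step_ratio_gt0 L11; have K8 := step_ratio_ge8 L11.
have [n yn] : exists n, mdist x y < t * K ^+ n.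
  exists (Num.bound (mdist x y / t)); rewrite mulrC -ltr_pdivrMr//.
  have dt : 0 <= mdist x y / t by rewrite divr_ge0 ?mdist_ge0// ltW.
  apply: (lt_trans (archi_boundP dt)).
  apply: (@lt_le_trans _ _ (2 ^+ Num.bound (mdist x y / t))); first by rewrite -natrX ltr_nat ltn_expl.
  by rewrite lerXn2r ?nnegrE ?(ltW K0)//; lra.
elim: n y ty yn => [y ty|n IH y ty yn]; first by rewrite expr0 mulr1 ltNge ty.
have d0 : 0 < mdist x y by exact: lt_le_trans ty.
have xy : x != y by rewrite -mdist_gt0.
have sc0 := step_const_gt0.
have [y' /andP[d1 d2] st] := step dm lam1 L11 C00 wc mh h0 tau0 k0 xy.
set d := mdist x y in ty yn d0 d1 d2 st *; set d' := mdist x y' in d1 d2 st *.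
have L2 : 0 < L1 + 1 by move: L11; lra.
have sh0 : (0 <= integ mu (shell L1 x d) (fun z => h z * (kern mu x z)%:E))%E.
  by apply: integ_ge0 => z _; exact: hkern_ge0.
have shT : shell L1 x d `<=` ball x ((L1 + 1) * d).
  by move=> z /andP[_]; rewrite in_ball.
have d'0 : 0 < d' by apply: lt_le_trans d1; rewrite divr_gt0// mulr_gt0.
have [d't|td'] := ltP d' t.
  exists y'; first by rewrite d't andbT (le_trans _ d1)// ler_pM2r// invr_gt0 mulr_gt0.
  move=> u c uc; apply: (le_trans (st _ _ uc)).
  rewrite lee_pmul2l ?lte_fin//; apply: leeD.
    by rewrite lee_fin ler_pM2r//; lra.
  rewrite lee_pmul2l ?lte_fin//; apply: (@le_trans _ _ (potential x ((L1 + 1) * d))).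
    by apply: integ_sub => // z _; exact: hkern_ge0.
  by rewrite leeDl// potential_ge0.
have yn' : d' < t * K ^+ n.
  by apply: (lt_le_trans d2); rewrite ler_pdivrMr// -mulrA -exprSr ltW.
have [y'' y''t H] := IH y' td' yn'.
exists y'' => // u c uc.
have st1 := st _ _ uc; have st2 := H _ _ uc.
have d'd : d' <= d / 8.
  by apply: (le_trans (ltW d2)); rewrite ler_pM2l// lef_pV2 ?posrE.
have far : (integ mu (shell L1 x d) (fun z => h z * (kern mu x z)%:E) +
    potential x ((L1 + 1) * d' / K) <= potential x ((L1 + 1) * d))%E.
  apply: integ_setU => //.
  - exact: bset_shell.
  - exact: bset_ball.
  - exact: bmeas_hkern.
  - by move=> z _; exact: hkern_ge0.
  - rewrite -subset0 => z [/andP[z1 _]]; rewrite in_ball => z2.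
    have e1 : (L1 + 1) * d' / K = d' / 4.
      by rewrite /step_ratio invfM mulrAC mulrCA mulfV ?gt_eqF// mulr1 mulrC.
    move: (le_lt_trans z1 z2); rewrite e1 invfM mulrA mulrAC ltr_pM2r//.
    by rewrite ltNge (ltW d2).
  - apply: ball_sub; rewrite mdistxx add0r -mulrA ler_pM2l//.
    by rewrite ler_pdivrMr//; nra.
have near_ : (potential x ((L1 + 1) * d') <= potential x ((L1 + 1) * d / K))%E.
  by apply: potential_le; rewrite -mulrA ler_pM2l// ltW.
apply: (@le_trans _ _ (`|c y (2 * kap * d) - c y' (2 * kap * d')|%:E +
   `|c y' (2 * kap * d') - c y'' (2 * kap * mdist x y'')|%:E)%E).
  by rewrite -EFinD lee_fin; apply: le_trans (ler_normD _ _); rewrite subrKA.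
apply: (le_trans (leeD st1 st2)).
have P0 r : (0 <= potential x r)%E by exact: potential_ge0.
have k00 : (0 <= k%:E)%E by rewrite lee_fin ltW.
rewrite -ge0_muleDr; last 2 first.
- by apply: adde_ge0; [rewrite lee_fin mulr_ge0// ltW|exact: mule_ge0].
- by apply: adde_ge0; [rewrite lee_fin !mulr_ge0// ltW|apply: mule_ge0 => //; exact: adde_ge0].
rewrite lee_pmul2l ?lte_fin//; apply: weighted_sum => //.
by move: d'd d0; rewrite -/d' -mulrDl ler_pM2r//; lra.
Qed.

(** The punctured balls around the point have measure comparable with that of the balls:
  they contain a ball around a point provided by [approach]. But they decrease to the
  empty set. *)
Lemma no_atom x y : x != y -> mu [set x] = 0%E.
Proof.
move=> xy; have d0 : 0 < mdist x y by rewrite mdist_gt0.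
have K0 := step_ratio_gt0 L11; have K8 := step_ratio_ge8 L11.
have D0 := dblc_gt0 dm (8 * K).
have K20 : 0 < 2 * K by rewrite pmulr_rgt0.
have mx : bset [set x] := bset_set1 x.
have low r : 0 < r -> r <= mdist x y ->
    (mu [set x] <= (dblc CD (8 * K))%:E * mu (ball x r `\ x))%E.
  move=> r0 ry; have r20 : 0 < r / 2 by rewrite divr_gt0.
  have r2y : r / 2 <= mdist x y by move: r0 ry; lra.
  have [y' /andP[y1 y2] _] := approach r20 r2y.
  set d' := mdist x y' in y1 y2.
  have rd' : r <= 4 * K * d'.
    move: y1; rewrite ler_pdivrMr// => y1.
    by rewrite (_ : 4 * K * d' = 2 * (d' * (2 * K))); [move: y1; lra|ring].
  have d'0 : 0 < d' by apply: lt_le_trans y1; rewrite divr_gt0.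
  apply: (@le_trans _ _ ((dblc CD (8 * K))%:E * mu (ball y' d')))%E.
    apply: (@le_trans _ _ (mu (ball x r))).
      apply: le_measure; rewrite ?inE//; first exact: bset_ball.
      by move=> _ ->; rewrite in_ball mdistxx.
    rewrite !(mu_ball dm)// -EFinM lee_fin; apply: (vol_comp dm) => //.
    by rewrite metric_sym -/d'; move: rd' y2; lra.
  rewrite lee_pmul2l ?lte_fin//; apply: le_measure; rewrite ?inE.
  - exact: bset_ball.
  - by apply: bset_setD => //; exact: bset_ball.
  move=> z y'z; split.
    by move: z y'z; apply: ball_sub; rewrite -/d'; move: y2; lra.
  by move=> zx; move: y'z; rewrite zx in_ball metric_sym ltxx.
pose F n : set (borel X) := ball x (n.+1%:R^-1 * mdist x y) `\ x.
have Fcap : \bigcap_n F n = set0.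
  rewrite -subset0 => z Fz; have [zx|zx] := eqVneq x z.
    by have [_] := Fz 0%N I; apply; rewrite zx.
  have xz0 : 0 < mdist x z by rewrite mdist_gt0.
  have [+ _] := Fz (Num.bound (mdist x y / mdist x z)) I; rewrite in_ball.
  apply/negP; rewrite -leNgt mulrC ler_pdivrMr// mulrC -ler_pdivrMr//.
  apply: (le_trans (ltW (archi_boundP _))); last by rewrite ler_nat.
  by rewrite divr_ge0// ltW.
have mF n : measurable (F n) by apply: bset_setD => //; exact: bset_ball.
have cvgF : mu \o F @ \oo --> 0%E.
  rewrite -(measure0 mu) -Fcap; apply: nonincreasing_cvg_mu => //.
  - apply: (bset_mu_fin dm (mF _)) => z [+ _]; exact.
  - by rewrite Fcap.
  - move=> n m nm; apply/subsetPset => z [xz zx]; split => //.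
    move: z xz zx => z + _; apply: ball_sub; rewrite mdistxx add0r ler_pM2r//.
    by rewrite lef_pV2 ?posrE// ler_nat.
apply/eqP; rewrite eq_le measure_ge0 andbT.
have cvgDF : (fun n => (dblc CD (8 * K))%:E * mu (F n))%E @ \oo --> ((dblc CD (8 * K))%:E * 0)%E.
  exact: cvgeZl.
rewrite -[leRHS](mule0 (dblc CD (8 * K))%:E).
apply: (cvge_to_ge cvgDF); apply: nearW => n; apply: low.
  by rewrite mulr_gt0// invr_gt0.
by rewrite ler_piMl ?(ltW d0)// invf_le1// ler1n.
Qed.

End Iterate.

(** * Averages over small balls *)

Section Endpoint.
Context {R : realType} {X : pmetricType R}.
Implicit Types (x y z w : X) (r d e : R).
Variables (mu : {sigma_finite_measure set (borel X) -> \bar R}) (CD : R).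
Hypothesis dm : doubling_measure mu CD.
Variables (lam L1 C0 : R).
Hypotheses (lam1 : 1 <= lam) (L11 : 1 <= L1) (C00 : 0 < C0).
Hypothesis wc : forall x y (delta : R), 0 < delta -> x != y ->
  exists q N, chain_in (ball x (L1 * mdist x y)) [set x] delta y q N.
Variables (h : X -> \bar R) (tau k : R).
Hypotheses (mh : bmeas h) (h0 : forall z, (0 <= h z)%E) (tau0 : 0 < tau) (k0 : 0 < k).

Local Notation K := (step_ratio L1).
Local Notation kap := (kappa lam L1).
Local Notation adm := (admissible mu lam C0 h tau k).
Local Notation sc := (step_const CD lam L1 C0).
Local Notation pot := (potential mu h).

Definition end_const :=
  2 * sc + (6 * K + C0 + 6) * (dblc CD kap^-1 * (4 * K * dblc CD (L1 + 1))).

Definition two_point eps (u : X -> R) := forall z w, mdist z w < eps ->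
  (`|u z - u w|%:E <= (mdist z w)%:E * ((2 * tau)%:E + k%:E * (h z + h w)))%E.

(** Averaging in [w'] the triangle inequality through [u w']. *)
Lemma integ_two_point u (c t s eta : R) z w : measurable_fun [set: borel X] (u : borel X -> R) ->
  0 < s -> 0 < t -> h z = eta%:E -> (forall w', ball w s w' -> mdist z w' < 3 * t) ->
  two_point (3 * t) u ->
  ((`|u z - c| * vol mu w s)%:E <=
   (3 * t)%:E * (((2 * tau + k * eta) * vol mu w s)%:E + k%:E * integ mu (ball w s) h)
   + osc mu w s u c)%E.
Proof.
move=> mu_ s0 t0 hz near_ tp; rewrite -(integ_ball_cst dm)//.
have eta0 : 0 <= eta by rewrite -lee_fin -hz.
have t30 : 0 <= 3 * t by rewrite mulr_ge0// ltW.
have mB := bset_ball w s; have k00 := ltW k0.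
have c0 : (0 <= (2 * tau + k * eta)%:E)%E.
  by rewrite lee_fin addr_ge0// mulr_ge0// ltW.
rewrite -(integ_ball_cst dm)// -integZ//.
have mkh : bmeas (fun z => k%:E * h z)%E by exact: bmeasZ.
have kh0 w' : (0 <= k%:E * h w')%E by rewrite mule_ge0// lee_fin ltW.
rewrite -integD//; last exact: bmeas_cst.
rewrite -integZ//; last 2 first.
- by apply: bmeasD => //; exact: bmeas_cst.
- by move=> w' _; exact: adde_ge0.
rewrite -integD//; last 3 first.
- by apply: bmeasZ; apply: bmeasD => //; exact: bmeas_cst.
- exact: bmeas_osc.
- by move=> w' _; rewrite mule_ge0 ?lee_fin//; exact: adde_ge0.
apply: integ_le => w' ww'; first by rewrite lee_fin.
apply: (@le_trans _ _ (`|u z - u w'|%:E + `|u w' - c|%:E)%E).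
  by rewrite -EFinD lee_fin; apply: le_trans (ler_normD _ _); rewrite subrKA.
apply: leeD => //; have zw := near_ _ ww'; apply: (le_trans (tp _ _ zw)).
apply: lee_pmul; rewrite ?lee_fin ?mdist_ge0 ?(ltW zw)//.
  rewrite adde_ge0 ?mule_ge0 ?adde_ge0// lee_fin ?(ltW k0)//.
  by rewrite mulr_ge0// ltW.
by rewrite hz ge0_muleDr ?lee_fin// addeA EFinD.
Qed.

Lemma endpoint_real (t d d' s v V i j eta a M H1 : R) : 0 < t -> t <= d -> t <= 2 * K * d' ->
  0 < d' -> 0 < s -> s <= d' -> d' <= d -> 0 < v -> 0 < V -> V <= H1 * v ->
  0 <= i -> 0 <= j -> 1 <= M -> 1 <= H1 -> d' / V * j <= M * i ->
  a * v <= 3 * t * ((2 * tau + k * eta) * v + k * j) + C0 * s * (tau * v + k * j) ->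
  a <= (6 * K + C0 + 6) * (H1 * M) * (d * tau + k * i) + 3 * t * (k * eta).
Proof.
move=> t0 td tK d'0 s0 sd d'd v0 V0 VH i0 j0 M1 H11 ji.
have K0 := step_ratio_gt0 L11; have M0 := lt_le_trans ltr01 M1; have H0 := lt_le_trans ltr01 H11.
have HM1 : 1 <= H1 * M by rewrite mulr_ege1.
have dj : d' * j <= H1 * M * i * v.
  move: ji; rewrite mulrAC ler_pdivrMr// => /le_trans; apply.
  rewrite (_ : H1 * M * i * v = M * i * (H1 * v)); last by ring.
  by rewrite ler_wpM2l// mulr_ge0// ltW.
move=> av; rewrite -(ler_pM2r v0); apply: (le_trans av).
have e1 : 3 * t * ((2 * tau + k * eta) * v + k * j) + C0 * s * (tau * v + k * j) =
  (6 * t + C0 * s) * (tau * v) + (3 * t + C0 * s) * j * k + 3 * t * (k * eta) * v by ring.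
rewrite e1 [leRHS]mulrDl lerD2r.
have Q0 : 0 < 6 * K + C0 + 6 by rewrite !addr_gt0// pmulr_rgt0.
have e2 : (6 * K + C0 + 6) * (H1 * M) * (d * tau + k * i) * v =
  (6 * K + C0 + 6) * (H1 * M) * d * (tau * v) + (6 * K + C0 + 6) * (H1 * M * i * v) * k by ring.
rewrite e2; apply: lerD.
  rewrite ler_pM2r ?mulr_gt0//.
  apply: (@le_trans _ _ ((6 * K + C0 + 6) * d)); last first.
    rewrite ler_pM2r; last exact: lt_le_trans td.
    by rewrite ler_peMr// ltW.
  have d0 := lt_le_trans t0 td.
  have : C0 * s <= C0 * d by rewrite ler_pM2l//; lra.
  have : 0 < 6 * K * d by rewrite mulr_gt0// pmulr_rgt0.
  by move: td; lra.
rewrite ler_pM2r//; apply: (@le_trans _ _ ((6 * K + C0 + 6) * (d' * j))); last by rewrite ler_pM2l.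
rewrite mulrA ler_wpM2r//.
have : C0 * s <= C0 * d' by rewrite ler_pM2l.
by move: tK d'0; lra.
Qed.

Lemma double_sum (A B : \bar R) (d : R) : 0 < d -> (0 <= A)%E -> (B <= A)%E ->
  ((2 * d * tau)%:E + k%:E * (A + B) <= 2%:E * ((d * tau)%:E + k%:E * A))%E.
Proof.
move=> d0 A0 BA; rewrite [leRHS]ge0_muleDr; last 2 first.
- by rewrite lee_fin mulr_ge0// ltW.
- by rewrite mule_ge0// lee_fin ltW.
rewrite -EFinM mulrA leeD2l// muleCA lee_pmul2l ?lte_fin//.
rewrite (_ : 2%:E = (1%:E + 1%:E)%E); last by rewrite -EFinD.
by rewrite ge0_muleDl ?lee_fin// !mul1e leeD2l.
Qed.

(** The point at distance about [mdist x z] from [x] provided by [approach] is close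
  enough to [z] for the two-point inequality. Nothing is required from the integral of
  [h] on balls that contain [x]. *)
Lemma dist_endpoint x y z eps u c : x != z -> adm u c -> two_point eps u ->
  mdist x z <= mdist x y -> 3 * mdist x z < eps ->
  (`|u z - c y (2 * kap * mdist x y)|%:E <=
   end_const%:E * ((mdist x y * tau)%:E + k%:E * pot x ((L1 + 1) * mdist x y))
   + (3 * mdist x z)%:E * (k%:E * h z))%E.
Proof.
move=> xz uc tp zy zeps; set t := mdist x z in zy zeps *; set d := mdist x y in zy *.
have t0 : 0 < t by rewrite mdist_gt0.
have d0 : 0 < d := lt_le_trans t0 zy.
have K0 := step_ratio_gt0 L11; have K8 := step_ratio_ge8 L11; have kap0 := kappa_gt0 lam1 L11.
have kapK := kappa_le lam1 L11; have KV := step_ratioV_le L11; have kapL := kappa_lam lam1 L11.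
have sc0 : 0 < sc := step_const_gt0 dm lam L11 C00.
pose M := 4 * K * dblc CD (L1 + 1); pose H1 := dblc CD kap^-1.
have H11 : 1 <= H1 := dblc_ge1 dm _.
have M1 : 1 <= M.
  have D1 := dblc_ge1 dm (L1 + 1).
  by apply: (@le_trans _ _ (4 * K * 1)); [lra|rewrite ler_pM2l// pmulr_rgt0].
have E0 : 0 < (6 * K + C0 + 6) * (H1 * M).
  apply: mulr_gt0; first by rewrite !addr_gt0// pmulr_rgt0.
  by apply: mulr_gt0; apply: lt_le_trans ltr01 _.
have EC : 0 < end_const by rewrite /end_const addr_gt0// mulr_gt0.
have I0 : (0 <= pot x ((L1 + 1) * d))%E := potential_ge0 mu h0 _ _.
have [y' /andP[y1 y2] ap] := approach dm lam1 L11 C00 wc mh h0 tau0 k0 t0 zy.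
set d' := mdist x y' in y1 y2 ap.
have d'0 : 0 < d' by apply: lt_le_trans y1; rewrite divr_gt0// pmulr_rgt0.
pose s := 2 * kap * d'; have s0 : 0 < s by rewrite /s mulr_gt0// pmulr_rgt0.
have kap1 : kap <= 64^-1 by move: kapK KV; lra.
have sd' : 32 * s <= d'.
  have : kap * d' <= 64^-1 * d' by rewrite ler_pM2r.
  by rewrite /s; lra.
have lsd : lam * s <= d' / (4 * K).
  rewrite (_ : lam * s = 8 * (lam * kap) * d' / 4); last by rewrite /s; field.
  by rewrite kapL (invfM 4 K) (_ : K^-1 * d' / 4 = d' * (4^-1 * K^-1))//; ring.
have dK32 : d' / (4 * K) <= d' / 32.
  by rewrite (invfM 4 K) ler_pM2l//; move: KV; lra.
have v0 := vol_gt0 dm y' s0; have V0 := vol_gt0 dm x d'0.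
have VH : vol mu x d' <= H1 * vol mu y' s.
  apply: (vol_comp dm) => //; rewrite metric_sym -/d'.
  rewrite (_ : kap^-1 * s = 2 * d'); first by lra.
  by rewrite /s [2 * kap]mulrC -mulrA mulKf ?gt_eqF.
have {}ap := ap _ _ uc.
have ap2 : (`|c y' s - c y (2 * kap * d)|%:E <=
    (2 * sc)%:E * ((d * tau)%:E + k%:E * pot x ((L1 + 1) * d)))%E.
  rewrite distrC; apply: (le_trans ap).
  rewrite (mulrC 2 sc) (EFinM sc) -muleA lee_pmul2l ?lte_fin//.
  apply: double_sum => //; apply: (potential_le mu h0).
  by rewrite ler_piMr ?mulr_ge0 ?(ltW d0)//; move: L11 KV; lra.
have potle : (pot x ((L1 + 1) * d') <= pot x ((L1 + 1) * d))%E.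
  by apply: (potential_le mu h0); rewrite ler_pM2l; [exact: le_trans (ltW y2) zy|move: L11; lra].
move: I0 ap2 potle; move: (pot x ((L1 + 1) * d)) => [i| |] //; last first.
  move=> _ _ _; rewrite gt0_muley ?lte_fin// addey// gt0_muley ?lte_fin// addye ?leey//.
  by rewrite gt_eqF// (lt_le_trans ltNy0)// !mule_ge0// lee_fin ?(ltW k0)// mulr_ge0// ltW.
rewrite lee_fin => i0 ap2 potle.
move: (h0 z); case hz : (h z) => [eta| |] //; last first.
  have hk : (k%:E * +oo = +oo)%E by rewrite gt0_muley ?lte_fin.
  by move=> _; rewrite hk gt0_muley ?lte_fin ?mulr_gt0// addey// leey.
rewrite lee_fin => eta0.
have near_ w : ball y' s w -> mdist z w < 3 * t.
  rewrite in_ball => wy'; have := metric_triangle z x w; have := metric_triangle x y' w.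
  by rewrite (metric_sym z x) -/t -/d'; lra.
have tp3 : two_point (3 * t) u by move=> a b ab; apply: tp; exact: lt_trans zeps.
have := integ_two_point (c y' s) uc.1 s0 t0 hz near_ tp3.
set J := integ mu (shell L1 x d') h.
have shellsub r : r <= d' / (4 * K) -> ball y' r `<=` shell L1 x d'.
  move=> rd w; rewrite in_ball => wy'.
  have := metric_triangle x w y'; have := metric_triangle x y' w.
  rewrite (metric_sym w) -/d' => t1 t2; rewrite /shell/=.
  have L1d : d' <= L1 * d' by rewrite ler_peMl// ltW.
  by apply/andP; split; lra.
have J1 : (integ mu (ball y' s) h <= J)%E.
  apply: integ_sub => //; apply: shellsub; apply: le_trans lsd.
  by rewrite ler_peMl// ltW.
have J2 : (osc mu y' s u (c y' s) <= (C0 * s)%:E * ((tau * vol mu y' s)%:E + k%:E * J))%E.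
  apply: (le_trans (uc.2 _ _ s0)); rewrite lee_pmul2l ?lte_fin ?mulr_gt0// leeD2l//.
  by rewrite lee_pmul2l ?lte_fin// integ_sub//; exact: shellsub.
have J3 : ((d' / vol mu x d')%:E * J <= M%:E * i%:E)%E.
  apply: (le_trans (shell_kern dm L11 mh h0 x d'0)); rewrite -/M.
  rewrite lee_pmul2l ?lte_fin ?(lt_le_trans ltr01 M1)//; apply: le_trans potle.
  apply: integ_sub => w; first by move=> _; exact: hkern_ge0.
  by move=> /andP[_]; rewrite in_ball.
have J0 : (0 <= J)%E by exact: integ_ge0.
have dV : 0 < d' / vol mu x d' by rewrite divr_gt0.
move: J1 J2 J3 J0; case: J => [j| |] //; last first.
  by move=> _ _; rewrite gt0_muley ?lte_fin// -EFinM leye_eq.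
move=> J1 J2; rewrite -!EFinM !lee_fin => J3 j0 main.
have {main} : `|u z - c y' s| * vol mu y' s <= 3 * t * ((2 * tau + k * eta) * vol mu y' s + k * j)
    + C0 * s * (tau * vol mu y' s + k * j).
  rewrite -lee_fin; apply: (le_trans main); rewrite EFinD.
  rewrite -(EFinM k) -EFinD -EFinM in J2.
  apply: leeD => //; rewrite (EFinM (3 * t)) lee_pmul2l ?lte_fin ?mulr_gt0// EFinD leeD2l// (EFinM k).
  by rewrite lee_pmul2l ?lte_fin.
have tKd' : t <= 2 * K * d'.
  have K20 : 0 < 2 * K by rewrite pmulr_rgt0.
  by rewrite (mulrC _ d') -ler_pdivrMr.
have sd1 : s <= d' by lra.
move=> /(endpoint_real t0 zy tKd' d'0 s0 sd1 (le_trans (ltW y2) zy) v0 V0 VH i0 j0 M1 H11 J3) fin.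
rewrite -(EFinM k) -EFinD -EFinM lee_fin in ap2.
apply: (@le_trans _ _ (`|u z - c y' s| + `|c y' s - c y (2 * kap * d)|)).
  by apply: le_trans (ler_normD _ _); rewrite subrKA.
apply: (le_trans (lerD fin ap2)); rewrite le_eqVlt; apply/orP; left; apply/eqP.
by rewrite /end_const /M /H1; ring.
Qed.

End Endpoint.

Section BoundedEstimate.
Context {R : realType} {X : pmetricType R}.
Implicit Types (x y z w : X) (r d e : R).
Variables (mu : {sigma_finite_measure set (borel X) -> \bar R}) (CD : R).
Hypothesis dm : doubling_measure mu CD.
Variables (lam L1 C0 : R).
Hypotheses (lam1 : 1 <= lam) (L11 : 1 <= L1) (C00 : 0 < C0).
Hypothesis wc : forall x y (delta : R), 0 < delta -> x != y ->
  exists q N, chain_in (ball x (L1 * mdist x y)) [set x] delta y q N.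
Variables (h : X -> \bar R) (tau k : R).
Hypotheses (mh : bmeas h) (h0 : forall z, (0 <= h z)%E) (tau0 : 0 < tau) (k0 : 0 < k).

Local Notation K := (step_ratio L1).
Local Notation kap := (kappa lam L1).
Local Notation adm := (admissible mu lam C0 h tau k).
Local Notation pot := (potential mu h).
Local Notation ec := (end_const CD lam L1 C0).
Local Notation lk := (link_const CD lam L1 C0).

Lemma end_const_gt0 : 0 < ec.
Proof.
have K0 := step_ratio_gt0 L11; have sc0 := step_const_gt0 dm lam L11 C00.
rewrite /end_const; apply: addr_gt0; first by rewrite pmulr_rgt0.
apply: mulr_gt0; first by rewrite !addr_gt0// pmulr_rgt0.
by apply: mulr_gt0; [exact: (dblc_gt0 dm)|rewrite mulr_gt0 ?(dblc_gt0 dm)// pmulr_rgt0].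
Qed.

Lemma integ_setD A N f : bset A -> bset N -> bmeas f -> (forall z, 0 <= f z)%E ->
  mu N = 0%E -> integ mu A f = integ mu (A `\` N) f.
Proof.
by move=> mA mN mf f0 N0; apply: ge0_negligible_integral => //; exact: measurable_funTS.
Qed.

(** The pointwise bound is integrated: on [ball x s] one has
  [mdist x z <= vol mu x s * kern mu x z], which turns the last term of the bound into
  the potential. The centre itself is negligible. *)
Lemma osc_endpoint x y eps u c s : x != y -> adm u c -> two_point h tau k eps u ->
  0 < s -> s <= mdist x y -> 3 * s <= eps ->
  (osc mu x s u (c y (2 * kap * mdist x y)%R) <= ((ec + 3) * vol mu x s)%:E *
    ((mdist x y * tau)%:E + k%:E * pot x ((L1 + 1) * mdist x y)))%E.
Proof.
move=> xy uc tp s0 sd seps; set d := mdist x y in sd *.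
have d0 : 0 < d := lt_le_trans s0 sd; have v0 := vol_gt0 dm x s0.
have ec0 := end_const_gt0.
have mx0 := no_atom dm lam1 L11 C00 wc mh h0 tau0 k0 xy.
have mB := bset_ball x s; have mx := bset_set1 x.
have mB' := bset_setD mB mx.
pose c0 := c y (2 * kap * d).
pose I := pot x ((L1 + 1) * d).
have I0 : (0 <= I)%E := potential_ge0 mu h0 _ _.
have Is : (pot x s <= I)%E.
  apply: (potential_le mu h0); apply: (le_trans sd).
  by rewrite ler_peMl// ?(ltW d0)//; move: L11; lra.
have pt z : x != z -> ball x s z -> (`|u z - c0|%:E <=
    ec%:E * ((d * tau)%:E + k%:E * I) + (3 * k * vol mu x s)%:E * (h z * (kern mu x z)%:E))%E.
  move=> xz; rewrite in_ball => zs; have t0 : 0 < mdist x z by rewrite mdist_gt0.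
  have t1 : mdist x z <= mdist x y := le_trans (ltW zs) sd.
  have t2 : 3 * mdist x z < eps by apply: lt_le_trans seps; rewrite ltr_pM2l.
  apply: (le_trans (dist_endpoint dm lam1 L11 C00 wc mh h0 tau0 k0 xz uc tp t1 t2)).
  apply: leeD => //; rewrite muleA -EFinM (muleC (h z)) muleA -EFinM lee_wpmul2r// lee_fin.
  rewrite (_ : 3 * k * vol mu x s * kern mu x z = 3 * k * (vol mu x s * kern mu x z)); last by ring.
  rewrite mulrAC ler_pM2l ?mulr_gt0// /kern mulrA ler_pdivlMr; last exact: (vol_gt0 dm).
  by rewrite mulrC ler_pM2r//; apply: (vol_nondecreasing dm); exact: ltW.
have [Ifin|] := boolP (I \is a fin_num); last first.
  rewrite -/I ge0_fin_numE// -leNgt leye_eq => /eqP ->.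
  rewrite gt0_muley ?lte_fin// addey// gt0_muley ?leey// lte_fin mulr_gt0//.
  by rewrite addr_gt0.
have [i iI] : exists i, I = i%:E by exists (fine I); rewrite fineK.
rewrite -/I iI in Is I0 pt *; rewrite lee_fin in I0.
have E0 : 0 <= d * tau + k * i by rewrite addr_ge0// mulr_ge0// ltW.
rewrite /osc (integ_setD mB mx)//; last exact: bmeas_osc uc.1.
have mk := bmeas_hkern dm mh x.
apply: (@le_trans _ _ (integ mu (ball x s) (fun z => (ec * (d * tau + k * i))%:E +
    (3 * k * vol mu x s)%:E * (h z * (kern mu x z)%:E))%E)).
  apply: integ_mono => [z _|z _|z [zs zx]]; first by rewrite lee_fin.
    by rewrite adde_ge0// ?mule_ge0 ?lee_fin ?kern_ge0 ?mulr_ge0// ltW.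
  split => //; have pz := pt z; rewrite -(EFinM k i) -EFinD -(EFinM ec) in pz; apply: pz => //.
  by apply/eqP => xz; apply: zx; rewrite -xz.
have c30 : 0 <= 3 * k * vol mu x s by rewrite !mulr_ge0// ltW.
rewrite integD//; last 4 first.
- exact: bmeas_cst.
- exact: bmeasZ.
- by move=> z _; rewrite lee_fin mulr_ge0// ltW.
- by move=> z _; rewrite mule_ge0 ?lee_fin ?mule_ge0 ?lee_fin ?kern_ge0.
rewrite integZ//; last by move=> z _; exact: hkern_ge0.
rewrite (integ_ball_cst dm)//.
apply: (@le_trans _ _ ((ec * (d * tau + k * i) * vol mu x s)%:E + (3 * k * vol mu x s)%:E * i%:E)%E).
  by rewrite leeD2l// lee_wpmul2l ?lee_fin.
rewrite -EFinM -EFinD -(EFinM k i) -EFinD -EFinM lee_fin.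
rewrite (_ : (ec + 3) * vol mu x s * (d * tau + k * i) =
  ec * (d * tau + k * i) * vol mu x s + (3 * k * vol mu x s * i + 3 * vol mu x s * (d * tau))); last by ring.
by rewrite lerD2l ler_wpDr// !mulr_ge0// ltW.
Qed.

Variable L : R.
Hypotheses (LL1 : L1 + 1 <= L) (Llam : 2 * lam <= L).

Definition rker_integ x y := integ mu setT (fun z => h z * (rker mu L x y z)%:E)%E.

Lemma hrker_ge0 x y z : (0 <= h z * (rker mu L x y z)%:E)%E.
Proof. by rewrite mule_ge0// lee_fin rker_ge0. Qed.

Lemma rker_out x y z : mdist x z < L * mdist x y -> z != x -> z != y ->
  rker mu L x y z = kern mu x z + kern mu y z.
Proof.
move=> xz zx zy; rewrite /rker indicE mem_set ?mulr1//; split.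
  by left; rewrite in_ball.
by move=> [] /eqP; apply/negP.
Qed.

Lemma potential_le_rker x y : x != y -> (pot x ((L1 + 1) * mdist x y) <= rker_integ x y)%E.
Proof.
move=> xy; have d0 : 0 < mdist x y by rewrite mdist_gt0.
have mx0 := no_atom dm lam1 L11 C00 wc mh h0 tau0 k0 xy.
have my0 : mu [set y] = 0%E by apply: (no_atom dm lam1 L11 C00 wc mh h0 tau0 k0 (y := x)); rewrite eq_sym.
rewrite /potential (integ_setD (N := [set y]))//; last 4 first.
- exact: bset_ball.
- exact: bset_set1.
- exact: (bmeas_hkern dm).
- by move=> z; exact: hkern_ge0.
apply: integ_mono => [z _|z _|z [xz zy]]; [exact: hkern_ge0|exact: hrker_ge0|split => //].
rewrite lee_wpmul2l// lee_fin; have [->|zx] := eqVneq z x; first by rewrite kernxx rker_ge0.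
rewrite rker_out//; first by rewrite lerDl kern_ge0.
  by move: xz; rewrite in_ball => /lt_le_trans; apply; rewrite ler_pM2r.
by apply/eqP => zy'; apply: zy.
Qed.

(** Every point of the ball is at distance at least [mdist x y / 2] from [x] or from [y],
  so that one of the two kernels is bounded below there. *)
Lemma ball_le_rker x y : x != y ->
  ((mdist x y / vol mu x (mdist x y))%:E * integ mu (ball x (lam * (2 * mdist x y))) h <=
   (2 * dblc CD (2 * lam + 2))%:E * rker_integ x y)%E.
Proof.
move=> xy; set d := mdist x y; have d0 : 0 < d by rewrite mdist_gt0.
have mx0 := no_atom dm lam1 L11 C00 wc mh h0 tau0 k0 xy.
have my0 : mu [set y] = 0%E by apply: (no_atom dm lam1 L11 C00 wc mh h0 tau0 k0 (y := x)); rewrite eq_sym.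
have mB := bset_ball x (lam * (2 * d)); have V0 := vol_gt0 dm x d0.
have H0 := dblc_gt0 dm (2 * lam + 2).
have mx := bset_set1 x; have my := bset_set1 y.
rewrite (integ_setD mB mx)// (integ_setD (bset_setD mB mx) my)//.
set A := _ `\` _; have mA : bset A by do ! apply: bset_setD.
apply: (@le_trans _ _ ((2 * dblc CD (2 * lam + 2))%:E *
    integ mu A (fun z => h z * (rker mu L x y z)%:E)))%E; last first.
  rewrite lee_pmul2l ?lte_fin ?mulr_gt0//; apply: integ_sub => // z _; exact: hrker_ge0.
apply: integ_le_weight => //.
- by apply/measurable_EFinP; exact: (measurable_rker dm).
- by rewrite divr_ge0// ltW.
- by rewrite mulr_ge0// ltW.
move=> z [[xz zx] zy]; split; first exact: rker_ge0.
move: xz; rewrite in_ball => xz.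
rewrite rker_out; last 3 first.
- by apply: (lt_le_trans xz); rewrite mulrA ler_pM2r// mulrC.
- by apply/eqP => e; apply: zx.
- by apply/eqP => e; apply: zy.
have low a : 0 < mdist a z -> d <= 2 * mdist a z -> mdist x a + mdist a z <= (2 * lam + 2) * d ->
    d / vol mu x d <= 2 * dblc CD (2 * lam + 2) * kern mu a z.
  move=> a0 da H; have va := vol_gt0 dm a a0.
  have vle := vol_comp dm d0 a0 H.
  rewrite /kern ler_pdivrMr// [leRHS](_ : _ = 2 * mdist a z *
    (dblc CD (2 * lam + 2) * vol mu x d) / vol mu a (mdist a z)); last by ring.
  by rewrite ler_pdivlMr//; apply: ler_pM => //; exact: ltW.
have t1 := metric_triangle x z y; have t2 := metric_triangle y x z.
rewrite (metric_sym z) -/d in t1; rewrite (metric_sym y x) -/d in t2.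
have D20 : 0 <= 2 * dblc CD (2 * lam + 2) by rewrite mulr_ge0// ltW.
have lamd : d <= lam * d by rewrite ler_peMl// ltW.
have [near_|far] := leP d (2 * mdist x z).
  apply: (le_trans (low x _ near_ _)).
  - by move: near_ d0; lra.
  - by rewrite mdistxx; move: xz d0; lra.
  - by rewrite ler_wpM2l// lerDl kern_ge0.
apply: (le_trans (low y _ _ _)).
- by move: far d0 t1; lra.
- by move: far d0 t1; lra.
- by rewrite -/d; move: far d0 t2 lamd; lra.
- by rewrite ler_wpM2l// lerDr kern_ge0.
Qed.

Lemma rker_integC x y : rker_integ x y = rker_integ y x.
Proof.
apply: integ_eq => z _; rewrite /rker /twoballs (metric_sym y x) addrC; congr (_ * (_ * _)%:E)%E.
by rewrite (setUC (ball y _)) (setUC [set y]).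
Qed.

(** Both small balls are linked to the ball of radius [2 * d] around [x]. *)
Lemma top_link x y u c : x != y -> adm u c ->
  (`|c y (2 * kap * mdist x y) - c x (2 * kap * mdist x y)|%:E <=
   (4 * lk * dblc CD (2 * lam + 2))%:E * ((mdist x y * tau)%:E + k%:E * rker_integ x y))%E.
Proof.
move=> xy uc; set d := mdist x y; have d0 : 0 < d by rewrite mdist_gt0.
have K0 := step_ratio_gt0 L11; have kap0 := kappa_gt0 lam1 L11.
have kapK := kappa_le lam1 L11; have KV := step_ratioV_le L11; have kapL := kappa_lam lam1 L11.
have lk0 : 0 < lk := link_const_gt0 dm lam L1 C00.
have D1 := dblc_ge1 dm (2 * lam + 2).
have kd0 : 0 < kap * d by exact: mulr_gt0.
have kd1 : kap * d <= 64^-1 * d by rewrite ler_pM2r//; move: kapK KV; lra.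
have lkd : lam * (2 * kap * d) <= d / 32.
  rewrite (_ : lam * _ = 8 * (lam * kap) * d / 4); last by field.
  rewrite kapL -mulrA; apply: (@le_trans _ _ (8^-1 * (d / 4))); last by lra.
  by rewrite ler_pM2r// divr_gt0.
have L1d : d <= L1 * d by rewrite ler_peMl// ltW.
have lamd : d <= lam * d by rewrite ler_peMl// ltW.
have kKd : kap / K * d <= kap * d by rewrite ler_pM2r//; exact: kappa_ratio.
set J := integ mu (ball x (lam * (2 * d))) h.
have lnk w : mdist w x <= d -> (`|c w (2 * kap * d) - c x (2 * d)|%:E <=
    lk%:E * ((d * tau)%:E + (k * (d / vol mu x d))%:E * J))%E.
  move=> wx; have w0 := mdist_ge0 w x.
  apply: (@link _ _ mu CD dm _ _ _ lam1 L11 C00 h tau k h0 tau0 k0 u c x w x w d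
    (2 * kap * d) (2 * d) (2 * kap * d) _) => //; rewrite ?mdistxx.
  - by apply/andP; split; move: kd0 kd1 d0; lra.
  - by apply/andP; split; move: d0; lra.
  - by move: kKd kd0; lra.
  - by apply: ball_sub; rewrite metric_sym; move: kd1 d0 wx; lra.
  - by move: kd1 d0 L1d; lra.
  - by move: wx d0 L1d; lra.
  - by move: wx d0 L1d; lra.
  - by apply: ball_sub; rewrite metric_sym; move: wx lkd d0 lamd; lra.
have l1 : (`|c y (2 * kap * d) - c x (2 * d)|%:E <=
    lk%:E * ((d * tau)%:E + (k * (d / vol mu x d))%:E * J))%E by apply: lnk; rewrite metric_sym.
have l2 : (`|c x (2 * d) - c x (2 * kap * d)|%:E <=
    lk%:E * ((d * tau)%:E + (k * (d / vol mu x d))%:E * J))%E.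
  by rewrite distrC; apply: lnk; rewrite mdistxx ltW.
have JW := ball_le_rker xy; rewrite -/d -/J in JW.
set W := rker_integ x y in JW *.
have W0 : (0 <= W)%E by apply: integ_ge0 => z _; exact: hrker_ge0.
pose D := 2 * dblc CD (2 * lam + 2); have D1' : 1 <= D by rewrite /D; move: D1; lra.
have bd : ((d * tau)%:E + (k * (d / vol mu x d))%:E * J <= D%:E * ((d * tau)%:E + k%:E * W))%E.
  rewrite [leRHS]ge0_muleDr; last 2 first.
  - by rewrite lee_fin mulr_ge0// ltW.
  - by rewrite mule_ge0// lee_fin ltW.
  apply: leeD; first by rewrite -EFinM lee_fin ler_peMl// mulr_ge0// ltW.
  by rewrite [leRHS]muleCA (EFinM k) -muleA lee_pmul2l ?lte_fin.
have lb := lee_wpmul2l (_ : 0 <= lk%:E)%E bd.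
apply: (@le_trans _ _ (`|c y (2 * kap * d) - c x (2 * d)|%:E + `|c x (2 * d) - c x (2 * kap * d)|%:E)%E).
  by rewrite -EFinD lee_fin; apply: le_trans (ler_normD _ _); rewrite subrKA.
have lk00 : (0 <= lk%:E)%E by rewrite lee_fin ltW.
apply: (le_trans (leeD (le_trans l1 (lb lk00)) (le_trans l2 (lb lk00)))).
have D0 : 0 <= lk * D by rewrite mulr_ge0 ?(ltW lk0)// (le_trans ler01).
by rewrite !muleA -!EFinM -ge0_muleDl ?lee_fin// -EFinD (_ : lk * D + lk * D = 4 * lk * dblc CD (2 * lam + 2))// /D; ring.
Qed.

Definition avg_const := 2 * (ec + 3) + 4 * lk * dblc CD (2 * lam + 2).

Lemma avg_const_gt0 : 0 < avg_const.
Proof.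
have ec0 := end_const_gt0; have lk0 : 0 < lk := link_const_gt0 dm lam L1 C00.
rewrite /avg_const addr_gt0//; first by rewrite mulr_gt0// addr_gt0.
by rewrite mulr_gt0 ?(dblc_gt0 dm)// mulr_gt0.
Qed.

Lemma bounded_estimate x y eps u c M s : x != y -> adm u c -> two_point h tau k eps u ->
  (forall z, `|u z| <= M) -> 0 < s -> s <= mdist x y -> 3 * s <= eps ->
  (`|fine (avg mu (ball x s) (EFin \o u)) - fine (avg mu (ball y s) (EFin \o u))|%:E <=
   avg_const%:E * ((mdist x y * tau)%:E + k%:E * rker_integ x y))%E.
Proof.
move=> xy uc tp uM s0 sd seps; set d := mdist x y in sd *.
have d0 : 0 < d := lt_le_trans s0 sd; have ec0 := end_const_gt0.
have one a b : a != b -> mdist a b = d -> rker_integ a b = rker_integ x y ->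
  (`|fine (avg mu (ball a s) (EFin \o u)) - c b (2 * kap * d)|%:E <=
    (ec + 3)%:E * ((d * tau)%:E + k%:E * rker_integ x y))%E.
  move=> ab abd <-; have va := vol_gt0 dm a s0.
  have sab : s <= mdist a b by rewrite abd.
  have := osc_endpoint ab uc tp s0 sab seps; rewrite abd => H.
  rewrite -(@lee_pmul2r _ (vol mu a s)%:E)// ?lte_fin// -EFinM.
  apply: le_trans (avg_osc dm (M := M) _ s0 uc.1 (fun z _ => uM z)) _; apply: (le_trans H).
  rewrite muleAC -EFinM lee_pmul2l ?lte_fin//; last by rewrite mulr_gt0// addr_gt0.
  apply: leeD => //; rewrite lee_pmul2l ?lte_fin//.
  by have := potential_le_rker ab; rewrite abd.
have h1 := one x y xy erefl erefl.
have h2 : (`|c x (2 * kap * d) - fine (avg mu (ball y s) (EFin \o u))|%:E <=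
    (ec + 3)%:E * ((d * tau)%:E + k%:E * rker_integ x y))%E.
  by rewrite distrC; apply: one; rewrite 1?eq_sym// 1?metric_sym// rker_integC.
have h3 := top_link xy uc; rewrite -/d in h3.
have W0 : (0 <= (d * tau)%:E + k%:E * rker_integ x y)%E.
  apply: adde_ge0; first by rewrite lee_fin mulr_ge0// ltW.
  by rewrite mule_ge0 ?lee_fin ?(ltW k0)//; apply: integ_ge0 => z _; exact: hrker_ge0.
have lk0 : 0 < lk := link_const_gt0 dm lam L1 C00.
have D0 := dblc_gt0 dm (2 * lam + 2).
apply: (@le_trans _ _ ((ec + 3)%:E * ((d * tau)%:E + k%:E * rker_integ x y) +
  (4 * lk * dblc CD (2 * lam + 2))%:E * ((d * tau)%:E + k%:E * rker_integ x y) +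
  (ec + 3)%:E * ((d * tau)%:E + k%:E * rker_integ x y))%E).
  apply: le_trans (leeD (leeD h1 h3) h2); rewrite -!EFinD lee_fin.
  set a := fine _; set b := fine _; set p := c y _; set q := c x _.
  have := ler_normD (a - p) (p - q); have := ler_normD (a - p + (p - q)) (q - b).
  by rewrite !subrKA; lra.
have e30 : 0 <= ec + 3 by rewrite addr_ge0// ltW.
have l0 : 0 <= 4 * lk * dblc CD (2 * lam + 2).
  by rewrite mulr_ge0 ?(ltW D0)// mulr_ge0// ltW.
move: ((d * tau)%:E + k%:E * rker_integ x y)%E W0 => E E0.
have ac : avg_const = ec + 3 + 4 * lk * dblc CD (2 * lam + 2) + (ec + 3) by rewrite /avg_const; ring.
have ac0 := avg_const_gt0.
case: E E0 => [e| |] // _; last by rewrite [leRHS]gt0_muley ?leey ?lte_fin.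
by rewrite -!EFinM -!EFinD lee_fin ac !(mulrDl _ _ e).
Qed.

End BoundedEstimate.

(** * From the Poincare inequality to the pointwise estimate along chains *)

Section PoincareToChain.
Context {R : realType} {X : pmetricType R}.
Implicit Types (x y z w : X) (r d e : R).
Variables (mu : {sigma_finite_measure set (borel X) -> \bar R}) (CD : R).
Hypothesis dm : doubling_measure mu CD.

Lemma cvg_dist_le (T : Type) (F : set_system T) (FF : ProperFilter F) (a b : T -> R) (l m q : R) :
  a @ F --> l -> b @ F --> m -> (\forall t \near F, `|a t - b t| <= q) -> `|l - m| <= q.
Proof.
move=> al bm H; have C : (fun t => `|a t - b t|) @ F --> `|l - m|.
  by apply: cvg_norm; exact: cvgB.
exact: (cvgr_to_le C H).
Qed.

Definition clamp (n : nat) (a : R) : R := Num.max (- n%:R) (Num.min n%:R a).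

Lemma clamp_bound n a : `|clamp n a| <= n%:R.
Proof.
rewrite /clamp ler_norml le_max lexx ge_max ge_min lexx /= andbT.
by rewrite (le_trans _ (ler0n _ n))// oppr_le0.
Qed.

Lemma clamp_dist n a b : `|clamp n a - clamp n b| <= `|a - b|.
Proof.
have bd (c d : R) : c - d <= `|c - d| /\ d - c <= `|c - d|.
  by split; [exact: ler_norm|rewrite distrC; exact: ler_norm].
have maxd (e c d : R) : `|Num.max e c - Num.max e d| <= `|c - d|.
  have [t1 t2] := bd c d.
  by case: (leP e c) => ec; case: (leP e d) => ed; rewrite ler_norml; apply/andP; split; lra.
have mind (e c d : R) : `|Num.min e c - Num.min e d| <= `|c - d|.
  have [t1 t2] := bd c d.
  by case: (leP e c) => ec; case: (leP e d) => ed; rewrite ler_norml; apply/andP; split; lra.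
exact: le_trans (maxd _ _ _) (mind _ _ _).
Qed.

Lemma clamp_id n a : `|a| <= n%:R -> clamp n a = a.
Proof. by rewrite ler_norml /clamp => /andP[na an]; rewrite min_r// max_r. Qed.

Lemma clamp_le n a : `|clamp n a| <= `|a|.
Proof. by have := clamp_dist n a 0; rewrite [clamp n 0]clamp_id ?normr0// !subr0. Qed.

Lemma measurable_clamp n (u : X -> R) : measurable_fun [set: borel X] (u : borel X -> R) ->
  measurable_fun [set: borel X] (clamp n \o u : borel X -> R).
Proof.
move=> mu_.
have : measurable_fun [set: borel X] ((fun=> - n%:R) \max ((fun=> n%:R) \min u) : borel X -> R).
  by apply: measurable_maxr; [|apply: measurable_minr => //]; exact: measurable_cst.
exact.
Qed.

Lemma cvg_avg_clamp x s (u : X -> R) : 0 < s ->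
  measurable_fun [set: borel X] (u : borel X -> R) ->
  avg mu (ball x s) (EFin \o u) \is a fin_num ->
  fine (avg mu (ball x s) (EFin \o (clamp n \o u))) @[n --> \oo] -->
    fine (avg mu (ball x s) (EFin \o u)).
Proof.
move=> s0 mu_ fin; have mB : measurable (ball x s : set (borel X)) by exact: bset_ball.
have v0 := vol_gt0 dm x s0.
have Ifin : integ mu (ball x s) (EFin \o u) \is a fin_num.
  move: fin; rewrite (avgE dm)//; case: (integ _ _ _) => [//| |].
    by rewrite gt0_muley ?lte_fin ?invr_gt0.
  by rewrite gt0_muleNy ?lte_fin ?invr_gt0.
have muB : measurable_fun (ball x s : set (borel X)) (u : borel X -> R) by exact: measurable_funTS.
have gint : mu.-integrable (ball x s : set (borel X)) (fun z => `|u z|%:E).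
  apply/integrableP; split; first by apply/measurable_EFinP; exact: measurableT_comp.
  have := @integral_fin_num_abs _ (borel X) R mu _ u mB muB.
  rewrite (_ : (_ \is a fin_num)%E = true); last exact: Ifin.
  move=> /idP; apply: le_lt_trans; apply: ge0_le_integral => //.
  - by apply/measurable_EFinP; do ! apply: measurableT_comp => //.
  - by apply/measurable_EFinP; do ! apply: measurableT_comp => //.
  - by move=> z _; rewrite /= normr_id.
have mf n : measurable_fun (ball x s : set (borel X)) (EFin \o (clamp n \o u)).
  by apply/measurable_EFinP; apply: measurable_funTS; exact: measurable_clamp.
have mlim : measurable_fun (ball x s : set (borel X)) (EFin \o u) by exact/measurable_EFinP.
have [] := @dominated_convergence _ (borel X) R mu (ball x s) mB
  (fun n => EFin \o (clamp n \o u)) _ _ mf mlim _ gint _.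
- apply: aeW => z _; apply: cvg_near_cst; near=> n.
  rewrite /= clamp_id//; near: n; exists (Num.bound `|u z|) => // n /= nb.
  by apply: (le_trans (ltW (archi_boundP (normr_ge0 _)))); rewrite ler_nat.
- by apply: aeW => z n _; rewrite /= lee_fin clamp_le.
move=> _ _ cvgI; apply: fine_cvg; rewrite fineK//.
rewrite (avgE dm)//.
under eq_fun do rewrite (avgE dm)//.
exact: cvgeZl.
Unshelve. all: by end_near. Qed.

Variables (p C lam0 : R).
Hypothesis p1 : 1 <= p.
Hypothesis HP : poincare_lip p mu C lam0.

(** The absolute value makes the positivity of the constant evident. *)
Definition osc_const := `|chain_const CD p C| + 1.
Definition pointwise_const := avg_const CD (lam0 + 1) (2 * lam0 + 1) osc_const.

Lemma UG_pair eps u (g : X -> \bar R) z w : UG eps u g -> mdist z w < eps ->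
  (`|u z - u w|%:E <= (g z + g w) / 2%:E * (mdist z w)%:E)%E.
Proof.
move=> [_ _ H] zw; have := H (fun n => if n is 0%N then z else w) 1%N.
rewrite distrC /chain_int big_nat1; apply.
by move=> i; rewrite ltnS leqn0 => /eqP -> /=; exact: ltW.
Qed.

(** The truncations of [u] are bounded and inherit the two-point inequality, and the
  bound does not depend on the level of truncation. The Lebesgue points enter only
  through the final limit of the averages, which in particular makes [u] integrable on
  small balls around [x] and [y]. *)
Lemma chain_linear u x y eps g tau k : measurable_fun [set: borel X] (u : borel X -> R) ->
  Leb mu u x -> Leb mu u y -> 0 < eps -> UG eps u g -> x != y -> young p tau k ->
  (`|u x - u y|%:E <= pointwise_const%:E * ((mdist x y * tau)%:E +
    k%:E * rker_integ mu (fun z => g z `^ p) (2 * lam0 + 2) x y))%E.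
Proof.
move=> mu_ Lx Ly eps0 ug xy yg; have [tau0 k0 yk] := yg; have [C1 lam1 _] := HP.
have [mg g0 _] := ug; have d0 : 0 < mdist x y by rewrite mdist_gt0.
pose h z := (g z `^ p)%E.
have h0 z : (0 <= h z)%E by exact: poweR_ge0.
have mh : bmeas h by exact: bmeas_poweR.
have lam1' : 1 <= lam0 + 1 by lra.
have L11 : 1 <= 2 * lam0 + 1 by lra.
have C00 : 0 < osc_const by rewrite /osc_const ltr_wpDl.
have wc (a b : X) (delta : R) : 0 < delta -> a != b ->
    exists q N, chain_in (ball a ((2 * lam0 + 1) * mdist a b)) [set a] delta b q N.
  by move=> delta0 ab; exact: (well_chained dm p1 HP).
have LL1 : 2 * lam0 + 1 + 1 <= 2 * lam0 + 2 by lra.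
have Llam : 2 * (lam0 + 1) <= 2 * lam0 + 2 by lra.
have half (A : \bar R) (a : R) : (0 <= A)%E -> 0 <= a -> (A / 2%:E * a%:E <= A * a%:E)%E.
  move=> A0 a0; rewrite lee_wpmul2r ?lee_fin// inver gt_eqF//.
  by case: A A0 => [b| |] // b0; rewrite -?EFinM ?lee_fin ?gt0_mulye ?lte_fin// ler_piMr//; lra.
have double (A B : \bar R) : (0 <= A)%E -> (0 <= B)%E ->
    (tau%:E + k%:E * A + (tau%:E + k%:E * B) = (2 * tau)%:E + k%:E * (A + B))%E.
  by move=> A0 B0; rewrite addeACA -EFinD ge0_muleDr// mulr_natl mulr2n.
pose v n := clamp n \o u.
have vb n z : `|v n z| <= n%:R by exact: clamp_bound.
have mv n : measurable_fun [set: borel X] (v n : borel X -> R) by exact: measurable_clamp.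
have vdist n z w : mdist z w < eps -> (`|v n z - v n w|%:E <= (g z + g w) / 2%:E * (mdist z w)%:E)%E.
  move=> zw; apply: (@le_trans _ _ `|u z - u w|%:E); first by rewrite lee_fin clamp_dist.
  exact: UG_pair zw.
have tp n : two_point h tau k eps (v n).
  move=> z w zw; apply: (le_trans (vdist n z w zw)).
  apply: (le_trans (half _ _ (adde_ge0 (g0 z) (g0 w)) (mdist_ge0 z w))).
  rewrite muleC lee_wpmul2l ?lee_fin ?mdist_ge0//.
  apply: (le_trans (leeD (young_poweR p1 yg (g0 z)) (young_poweR p1 yg (g0 w)))).
  by rewrite double//; exact: poweR_ge0.
have ex_c n : exists c, admissible mu (lam0 + 1) osc_const h tau k (v n) c.
  have H (zr : X * R) : exists c, 0 < zr.2 -> (osc mu zr.1 zr.2 (v n) c <= (osc_const * zr.2)%:E *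
      ((tau * vol mu zr.1 zr.2)%:E + k%:E * integ mu (ball zr.1 ((lam0 + 1) * zr.2)) h))%E.
    case: zr => z r /=; have [r0|r0] := ltP 0 r; last by exists 0.
    have vd a b : mdist a b < eps -> (`|v n a - v n b|%:E <= (g a + g b) * (mdist a b)%:E)%E.
      move=> ab; apply: le_trans (half _ _ (adde_ge0 (g0 a) (g0 b)) (mdist_ge0 a b)).
      exact: vdist.
    have [c oc] := chain_poincare dm p1 HP (mv n) (vb n) eps0 mg g0 vd z r0 yg.
    exists c => _; apply: (le_trans oc); apply: lee_wpmul2r; last first.
      rewrite lee_fin ler_pM2r//; have := ler_norm (chain_const CD p C).
      by rewrite /osc_const; lra.
    apply: adde_ge0; first by rewrite lee_fin mulr_ge0 ?vol_ge0// ltW.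
    apply: mule_ge0; first by rewrite lee_fin ltW.
    by apply: integ_ge0 => q _; exact: h0.
  have [c cP] := choice H; exists (fun z r => c (z, r)); split => // z r r0.
  exact: (cP (z, r)).
set W := rker_integ _ _ _ _ _.
have est n s : 0 < s -> s <= mdist x y -> 3 * s <= eps ->
    (`|fine (avg mu (ball x s) (EFin \o v n)) - fine (avg mu (ball y s) (EFin \o v n))|%:E <=
     pointwise_const%:E * ((mdist x y * tau)%:E + k%:E * W))%E.
  have [c uc] := ex_c n.
  exact: (bounded_estimate dm lam1' L11 C00 wc mh h0 tau0 k0 LL1 Llam xy uc (tp n) (vb n)).
have pc0 : 0 < pointwise_const by exact: (avg_const_gt0 dm).
have W0 : (0 <= W)%E.
  by apply: integ_ge0 => z _; apply: mule_ge0; [exact: h0|rewrite lee_fin; exact: rker_ge0].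
move: est; case: W W0 => [W| |] // W0 est; last first.
  by rewrite gt0_muley ?lte_fin// addey// gt0_muley ?lte_fin// leey.
have rE : (pointwise_const%:E * ((mdist x y * tau)%:E + k%:E * W%:E) =
    (pointwise_const * (mdist x y * tau + k * W))%:E)%E by [].
rewrite rE in est *; rewrite lee_fin.
have Ax := cvg_is_fine Lx; have Ay := cvg_is_fine Ly.
apply: (cvg_dist_le (at_right_proper_filter 0) (fine_cvg Lx) (fine_cvg Ly)).
have sm : 0 < Num.min (mdist x y) (eps / 3) by rewrite lt_min d0 divr_gt0.
near=> s.
have s0 : 0 < s by near: s; exact: nbhs_right_gt.
have : s <= Num.min (mdist x y) (eps / 3) by near: s; exact: nbhs_right_le.
rewrite le_min => /andP[sd seps].
have seps3 : 3 * s <= eps by move: seps; rewrite ler_pdivlMr// mulrC.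
have Fx : avg mu (ball x s) (EFin \o u) \is a fin_num by near: s.
have Fy : avg mu (ball y s) (EFin \o u) \is a fin_num by near: s.
apply: (cvg_dist_le _ (cvg_avg_clamp s0 mu_ Fx) (cvg_avg_clamp s0 mu_ Fy)).
by apply: nearW => n; have := est n s s0 sd seps3; rewrite lee_fin.
Unshelve. all: by end_near. Qed.

Definition pointwise_chain_const :=
  2 `^ p * pointwise_const `^ (p - 1) * pointwise_const.

Lemma poincare_to_chain : pointwise_chain p mu pointwise_chain_const (2 * lam0 + 2).
Proof.
have [C1 lam1 _] := HP; have p0 : 0 < p by rewrite (lt_le_trans _ p1).
have pc0 : 0 < pointwise_const.
  apply: (avg_const_gt0 dm); [lra|by rewrite /osc_const ltr_wpDl].
split; [by rewrite /pointwise_chain_const !mulr_gt0// powR_gt0|lra|].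
move=> u mu_ x y Lx Ly eps eps0 g ug; have [mg g0 _] := ug.
have h0 z : (0 <= g z `^ p)%E by exact: poweR_ge0.
rewrite (integ_riesz dm)//; last exact: bmeas_poweR.
set W := integ _ _ _.
have W0 : (0 <= W)%E by apply: integ_ge0 => z _; rewrite mule_ge0// lee_fin rker_ge0.
have [<-|xy] := eqVneq x y.
  rewrite subrr normr0 powR0 ?gt_eqF// mule_ge0// lee_fin mulr_ge0 ?powR_ge0//.
  by rewrite /pointwise_chain_const !mulr_ge0 ?powR_ge0// ltW.
have d0 : 0 < mdist x y by rewrite mdist_gt0.
have D0 : 0 < pointwise_const * mdist x y by rewrite mulr_gt0.
have A0 : (0 <= pointwise_const%:E * W)%E by rewrite mule_ge0// lee_fin ltW.
have := powR_optimize p1 (normr_ge0 (u x - u y)) D0 A0.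
have -> : ((pointwise_chain_const * mdist x y `^ (p - 1))%:E * W =
    (2 `^ p * (pointwise_const * mdist x y) `^ (p - 1))%:E * (pointwise_const%:E * W))%E.
  rewrite muleA -EFinM powRM ?(ltW pc0) ?(ltW d0)// /pointwise_chain_const; congr (_%:E * _)%E.
  by ring.
apply=> tau k yg; have [tau0 k0 _] := yg.
have := chain_linear mu_ Lx Ly eps0 ug xy yg => /le_trans; apply.
rewrite ge0_muleDr; last 2 first.
- by rewrite lee_fin mulr_ge0// ltW.
- by rewrite mule_ge0// lee_fin ltW.
by rewrite -EFinM mulrA leeD2l// muleCA.
Qed.

End PoincareToChain.

(** * The measure of a metric measure space *)

Section OuterMeasure.
Context {R : realType} {X : pmetricType R}.
Variables (m : {outer_measure set X -> \bar R}) (CD : R).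
Hypotheses (mm : metric_measure_space m) (CD1 : 1 <= CD) (dbl : doubling m CD).

(** If one ball were negligible, doubling would make all concentric balls negligible,
  and they cover the space. *)
Lemma outer_ball_gt0 (z : X) (r : R) : 0 < r -> (0 < m (ball z r))%E.
Proof.
move=> r0; rewrite lt_def outer_measure_ge0 andbT; apply/eqP => z0.
have zn n : m (ball z (2 ^+ n * r)) = 0%E.
  elim: n => [|n IH]; first by rewrite expr0 mul1r.
  apply/eqP; rewrite eq_le outer_measure_ge0 andbT exprS -mulrA.
  have r2 : 0 < 2 ^+ n * r by rewrite mulr_gt0// exprn_gt0.
  by apply: (le_trans (dbl z r2)); rewrite IH mule0.
have /eqP := mms_nontrivial mm; apply.
apply/eqP; rewrite eq_le outer_measure_ge0 andbT.
have -> : [set: X] = \bigcup_n ball z (2 ^+ n * r).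
  apply/seteqP; split => // w _; exists (Num.bound (mdist z w / r)) => //.
  rewrite in_ball -ltr_pdivrMr//; apply: (lt_trans (archi_boundP _)).
    by rewrite divr_ge0 ?mdist_ge0// ltW.
  by rewrite -natrX ltr_nat ltn_expl.
apply: (le_trans (outer_measure_sigma_subadditive m _)).
by rewrite eseries0// => i _ _; exact: zn.
Qed.

Lemma outer_ball_lty (z : X) (r : R) : (m (ball z r) < +oo)%E.
Proof. by apply: (@mms_bounded _ _ _ mm _ z r). Qed.

(** The restriction to Borel sets is countably additive because Borel sets are
  Caratheodory measurable; the measure is kept equal to [m] as a function, so that all
  properties of [m] transfer verbatim. *)
Lemma borel_measure : exists2 mu : {sigma_finite_measure set (borel X) -> \bar R},
  (mu : set X -> \bar R) = m & doubling_measure mu CD.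
Proof.
pose f : set (borel X) -> \bar R := m.
have f0 : f set0 = 0%E by exact: outer_measure0.
have fge0 A : (0 <= f A)%E by exact: outer_measure_ge0.
have fadd : semi_sigma_additive f.
  move=> F mF tF mU; apply: (@caratheodory_measure_sigma_additive R X m F) => //.
    by move=> i; apply: (radon_borel (mms_radon mm)); exact: mF.
  by apply: (radon_borel (mms_radon mm)); exact: mU.
pose nu : {measure set (borel X) -> \bar R} :=
  HB.pack f (isMeasure.Build _ _ _ f f0 fge0 fadd).
have sf : sigma_finite setT nu.
  exists (fun n => ball (point : X) n.+1%:R); last first.
    by move=> n; split; [exact: bset_ball|exact: outer_ball_lty].
  apply/seteqP; split => // w _; exists (Num.bound (mdist (point : X) w)) => //.
  rewrite in_ball; apply: (lt_trans (archi_boundP (mdist_ge0 _ _))).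
  by rewrite ltr_nat.
pose mu : {sigma_finite_measure set (borel X) -> \bar R} :=
  HB.pack (Measure.sort nu) (Measure_isSigmaFinite.Build _ _ _ nu sf).
exists mu => //; split => //; last exact: (mms_separable mm).
move=> z r r0; exists (fine (m (ball z r))).
  by rewrite fine_gt0// outer_ball_gt0//= outer_ball_lty.
by rewrite fineK// ge0_fin_numE ?outer_measure_ge0// outer_ball_lty.
Qed.

End OuterMeasure.

(** * The equivalence *)

Section Main.
Context {R : realType}.
Variables (p CD : R).
Hypotheses (p1 : 1 <= p) (CD1 : 1 <= CD).
Implicit Types P Q S : @mms_property R.

Lemma quant_implies_trans P Q S :
  quant_implies CD P Q -> quant_implies CD Q S -> quant_implies CD P S.
Proof.
move=> PQ QS a b; have [a1 [b1 H1]] := PQ a b; have [a2 [b2 H2]] := QS a1 b1.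
by exists a2, b2 => X m mm dbl /(H1 X m mm dbl)/(H2 X m mm dbl).
Qed.

Lemma quant_poincare_chain :
  quant_implies CD (fun X m => poincare_lip p m) (fun X m => pointwise_chain p m).
Proof.
move=> a b; exists (pointwise_chain_const CD p a b), (2 * b + 2) => X m mm dbl.
have [mu <- dm] := borel_measure mm CD1 dbl; exact: (poincare_to_chain dm p1).
Qed.

Lemma quant_chain_lip :
  quant_implies CD (fun X m => pointwise_chain p m) (fun X m => pointwise_lip p m).
Proof.
move=> a b; exists a, b => X m mm dbl.
have [mu <- dm] := borel_measure mm CD1 dbl; exact: (chain_to_lip dm p1).
Qed.

Lemma quant_lip_poincare :
  quant_implies CD (fun X m => pointwise_lip p m) (fun X m => poincare_lip p m).
Proof.
move=> a b; exists (poincare_const CD p a b), (2 * b + 3) => X m mm dbl.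
have [mu <- dm] := borel_measure mm CD1 dbl; exact: (lip_to_poincare dm p1).
Qed.

End Main.

Theorem proposition7p4 (R : realType) (p CD : R) (hp : 1 <= p) (hCD : 1 <= CD) :
  [/\ quant_equivalent CD (fun X m => poincare_lip p m) (fun X m => pointwise_chain p m),
      quant_equivalent CD (fun X m => pointwise_chain p m) (fun X m => pointwise_lip p m) &
      quant_equivalent CD (fun X m => poincare_lip p m) (fun X m => pointwise_lip p m)].
Proof.
have pc := quant_poincare_chain hp hCD; have cl := quant_chain_lip hp hCD.
have lp := quant_lip_poincare hp hCD.
split; split => //.
- exact: quant_implies_trans cl lp.
- exact: quant_implies_trans lp pc.
- exact: quant_implies_trans pc cl.
Qed.
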